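(* Let $\mathcal P$ be the Lagrangian Grassmannian of $\mathbb R^{2n}$ with its theta positive part $\mathcal P_{>0}$ and theta nonnegative part $\mathcal P_{\ge 0}$ (all notation as defined in the context). The spaces $\mathcal P_{>0}$ and $\mathcal P_{\geq 0}$ have the following properties. (1) The orbits of the $L_J^\circ$-action on $\mathcal P_{\geq 0}$ are $\mathcal P_{\geq 0}\cap P_J^-\dot v\cdot P_J^+\cap P_J^+\dot w\cdot P_J^+$ for various $v\leq w$, and each one is a connected component of the respective $P_J^-\dot v\cdot P_J^+\cap P_J^+\dot w\cdot P_J^+$. As an application, the Hausdorff closure of $\mathcal P_{>0}$ is $\mathcal P_{\geq 0}$. (2) The space $\mathcal P_{\geq 0}$ is homeomorphic to a closed ball of dimension $\frac{n(n+1)}{2}$, and $\mathcal P_{\geq 0}\setminus\mathcal P_{>0}$ is homeomorphic to a sphere of dimension $\frac{n(n+1)}{2}-1$. (3) There is a collection of pinnings $\mathrm C$ (namely the one defined in the context) such that $$\bigsqcup_{\mathbf P\in\mathrm C}\mathcal P_{(\mathbf P,>0)}\subsetneqq\mathcal P_{>0},\qquad \bigsqcup_{\mathbf P\in\mathrm C}\mathcal P_{(\mathbf P,\geq 0)}\subseteq\mathcal P_{\geq0}.$$ The equality of nonnegative parts holds when $n=2$, but fails when $n\geq 3$. (4) With respect to the extremal weight vectors $\{\dot w\eta_{\omega_n}\mid w\in W^J\}$, we have $\mathcal P_{>0} = \mathcal P_{\triangle>0}$ and $\mathcal P_{\geq0} = \mathcal P_{\triangle\geq0}$.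
   Context: Let $n$ be a positive integer and let $e_1,\dots,e_{2n}$ denote the standard basis of $\mathbb R^{2n}$, with the symplectic form given by $\begin{bmatrix}0&I_n\\-I_n&0\end{bmatrix}$. Let $$G=Sp_{2n}(\mathbb R)=\left\{\begin{bmatrix}A&B\\C&D\end{bmatrix}\in GL_{2n}(\mathbb R): A^tD-C^tB=I_n,\ A^tC=C^tA,\ B^tD=D^tB\right\}.$$ Subgroups: $T\subset G$ is the group of diagonal matrices $\mathrm{diag}(a_1,\dots,a_n,a_1^{-1},\dots,a_n^{-1})$, $a_i\in\mathbb R^*$; $T_{>0}$ is the subgroup with all $a_i>0$. $B^+=\{\begin{bmatrix}A&B\\0&(A^t)^{-1}\end{bmatrix}\in G: A\text{ upper triangular}\}$, $B^-=\{\begin{bmatrix}A&0\\C&(A^t)^{-1}\end{bmatrix}\in G: A\text{ lower triangular}\}$. $P_J^+$ (resp. $P_J^-$), where $J=\{1,\dots,n-1\}$, is the group of elements of $G$ whose lower left (resp. upper right) $n\times n$ block is zero; $L_J=P_J^+\cap P_J^-\simeq GL_n(\mathbb R)$; its identity component is $L_J^\circ=\{\mathrm{diag}(A,(A^t)^{-1}):\det A>0\}$. Flag variety: $\mathcal P=G/P_J^+$ is identified with the Lagrangian Grassmannian by $gP_J^+\mapsto g\,\mathrm{span}(e_1,\dots,e_n)$. A point is written $\begin{bmatrix}A\\C\end{bmatrix}$, meaning the column span of a $2n\times n$ matrix of rank $n$ with $A,C\in \mathrm{Mat}_{n\times n}(\mathbb R)$, $A^tC=C^tA$; $(A,C)$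 and $(Ag,Cg)$, $g\in GL_n(\mathbb R)$, represent the same point. Put $$\mathcal P_{>0}=\left\{\begin{bmatrix}I_n\\C\end{bmatrix}: C\text{ symmetric positive definite}\right\},\qquad \mathcal P_{\ge0}=\left\{\begin{bmatrix}A\\C\end{bmatrix}\in\mathcal P: A^tC=C^tA\text{ is positive semi-definite}\right\}.$$ For an element $g$ of $G$, $P_J^\pm g\cdot P_J^+$ denotes the image of $P_J^\pm g P_J^+$ in $\mathcal P$; likewise $X\cdot P_J^+$ denotes the image in $\mathcal P$ of $XP_J^+$ for a subset $X\subseteq G$. All topological notions are for the Euclidean (Hausdorff) topology. Chevalley generators and Weyl group: with $E_{i,j}$ the $2n\times 2n$ matrix units, put $\mathbf e_i=E_{i,i+1}-E_{n+i+1,n+i}$ for $1\le i\le n-1$, $\mathbf e_n=E_{n,2n}$, $\mathbf f_i=\mathbf e_i^t$, $x_i(a)=\exp(a\mathbf e_i)$, $y_i(a)=\exp(a\mathbf f_i)$. $W=N_G(T)/T$ is the Weyl group (type $C_n$) with simple reflections $s_1,\dots,s_n$, where $s_i$ is the class of $\dot s_i=x_i(-1)y_i(1)x_i(-1)$; for $w\in W$, $\dot w$ is the product of the $\dot s_i$ along any reduced expression of $w$. The order $\le$ on $W$ is the Bruhat order. $W_J$ is generated by $s_1,\dots,s_{n-1}$ and $W^J$ is the set of minimal length representatives of $W/W_J$. Pinnings and total positivity: for $\epsilon=(\epsilon_1,\dots,\epsilon_n)\in\{\pm1\}^n$ let $x_{i,\epsilon_i}(a)=x_i(\epsilon_ia)$,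 $y_{i,\epsilon_i}(a)=y_i(\epsilon_i a)$, and $$\mathrm C=\{(T,B^+,B^-,x_{i,\epsilon_i},y_{i,\epsilon_i};1\le i\le n): \epsilon_i\in\{\pm1\}\text{ for }i\ne n,\ \epsilon_n=1\}.$$ For $\mathbf P\in\mathrm C$ corresponding to $\epsilon$, let $(i_1,\dots,i_m)$ be a reduced word of the longest element of $W$ and put $U^+_{(\mathbf P,>0)}=\{x_{i_1,\epsilon_{i_1}}(a_1)\cdots x_{i_m,\epsilon_{i_m}}(a_m):a_j>0\}$, $U^-_{(\mathbf P,>0)}=\{y_{i_1,\epsilon_{i_1}}(a_1)\cdots y_{i_m,\epsilon_{i_m}}(a_m):a_j>0\}$ (independent of the reduced word), $G_{(\mathbf P,>0)}=U^-_{(\mathbf P,>0)}T_{>0}U^+_{(\mathbf P,>0)}$, and let $G_{(\mathbf P,\ge0)}$ be the submonoid of $G$ generated by $T_{>0}$ and all $x_{i,\epsilon_i}(a),y_{i,\epsilon_i}(b)$ with $a,b>0$. Then $\mathcal P_{(\mathbf P,>0)}=G_{(\mathbf P,>0)}\cdot P_J^+\subseteq\mathcal P$ and $\mathcal P_{(\mathbf P,\ge0)}=\overline{G_{(\mathbf P,\ge0)}\cdot P_J^+}\subseteq\mathcal P$ (Hausdorff closure). Generalized Plücker positivity: let $V=V_{\omega_n}$ be the irreducible subrepresentation of $\bigwedge^n\mathbb R^{2n}$ generated by the highest weight vector $\eta_{\omega_n}=e_1\wedge\cdots\wedge e_n$. The point $x=gP_J^+\in\mathcal P$ defines the line $\mathbb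 R\, g\eta_{\omega_n}\subset V$. For each $w\in W^J$ the weight space of weight $w\omega_n$ (an extremal weight) is the line spanned by $\dot w\eta_{\omega_n}$; the generalized Plücker coordinates of $x$ are the coefficients of $g\eta_{\omega_n}$ (in its weight decomposition) along the vectors $\dot w\eta_{\omega_n}$, $w\in W^J$, well defined up to a common nonzero scalar. $\mathcal P_{\triangle>0}$ (resp. $\mathcal P_{\triangle\ge0}$) is the set of $x\in\mathcal P$ whose generalized Plücker coordinates are, up to a common scalar, all positive (resp. all nonnegative).
   Formalization: In (3), strictness of the inclusion of the positive parts is asserted only for n ≥ 2 (for n = 1 the two sides are equal), and the union of the nonnegative parts is a plain union, since for n ≥ 2 all of them contain the base point; the positive parts are still proved disjoint. *)

(* Defs.v *)
From HB Require Import structures.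
From mathcomp Require Import all_boot all_order all_algebra.
From mathcomp Require Import generic_quotient.
From mathcomp Require Import all_classical all_reals all_analysis.

Set Implicit Arguments.
Unset Strict Implicit.
Unset Printing Implicit Defensive.

Import Order.TTheory GRing.Theory Num.Theory.
Import numFieldNormedType.Exports.

Local Open Scope classical_set_scope.
Local Open Scope ring_scope.

(* The topology on R and on matrices over R is the product (Euclidean) one;
   subsets of G are sets of (n + n) x (n + n) matrices.  Indices are 0-based:
   the basis vector e_(k+1) has index k, and the simple reflection s_n is the
   one of index n.-1. *)

(** * General notions *)

Definition homeomorphic (S T : topologicalType) (A : set S) (B : set T) : Prop :=
  exists (f : S -> T) (g : T -> S),
    [/\ {homo f : x / A x >-> B x}, {homo g : y / B y >-> A y},
        (forall x, A x -> g (f x) = x) /\ (forall y, B y -> f (g y) = y),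
        {within A, continuous f} & {within B, continuous g}].

Definition is_component (T : topologicalType) (A Y : set T) : Prop :=
  exists2 x, Y x & A = connected_component Y x.

Definition closed_ball_eucl (R : realType) (d : nat) : set 'rV[R]_d :=
  [set x | \sum_i x 0 i ^+ 2 <= 1].

Definition sphere_eucl (R : realType) (d : nat) : set 'rV[R]_(d.+1) :=
  [set x | \sum_i x 0 i ^+ 2 = 1].

Definition expmx (R : realType) (m : nat) (A : 'M[R]_m) : 'M[R]_m :=
  limn (series (fun k : nat => (k`!%:R)^-1 *: A ^+ k)).

Definition pos_def (R : realType) (m : nat) (C : 'M[R]_m) : Prop :=
  C^T = C /\ forall u : 'cV[R]_m, u != 0 -> 0 < (u^T *m C *m u) 0 0.

Definition pos_semidef (R : realType) (m : nat) (C : 'M[R]_m) : Prop :=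
  C^T = C /\ forall u : 'cV[R]_m, 0 <= (u^T *m C *m u) 0 0.

Definition mulS (R : realType) (m : nat) (X Y : set 'M[R]_m) : set 'M[R]_m :=
  [set g *m h | g in X & h in Y].

(** * The symplectic group and its subgroups *)

Section Groups.
Variables (R : realType) (n : nat).
Local Notation M2 := 'M[R]_(n + n).

Definition Sp : set M2 := [set g |
  let A := ulsubmx g in let B := ursubmx g in
  let C := dlsubmx g in let D := drsubmx g in
  [/\ g \in unitmx, A^T *m D - C^T *m B = 1%:M,
      A^T *m C = C^T *m A & B^T *m D = D^T *m B]].

Definition diag_sp (a : 'rV[R]_n) : M2 :=
  block_mx (diag_mx a) 0 0 (diag_mx (\row_i (a 0 i)^-1)).

Definition torus : set M2 :=
  [set t | exists2 a : 'rV[R]_n, forall i, a 0 i != 0 & t = diag_sp a].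

Definition torus_pos : set M2 :=
  [set t | exists2 a : 'rV[R]_n, forall i, 0 < a 0 i & t = diag_sp a].

(* is_trig_mx means lower triangular *)
Definition borel_plus : set M2 := [set g | Sp g /\
  exists A B, is_trig_mx A^T /\ g = block_mx A B 0 (invmx A^T)].

Definition borel_minus : set M2 := [set g | Sp g /\
  exists A C, is_trig_mx A /\ g = block_mx A 0 C (invmx A^T)].

Definition PJ_plus : set M2 := [set g | Sp g /\ dlsubmx g = 0].

Definition PJ_minus : set M2 := [set g | Sp g /\ ursubmx g = 0].

Definition LJ0 : set M2 :=
  [set g | exists2 A, 0 < \det A & g = block_mx A 0 0 (invmx A^T)].

(** * Chevalley generators and the Weyl group *)

Definition munit (a b : nat) : M2 :=
  \matrix_(k, l) ((val k == a) && (val l == b))%:R.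

Definition chev_e (i : 'I_n) : M2 :=
  if (i.+1 < n)%N then munit i i.+1 - munit (n + i.+1) (n + i)
  else munit i (n + i).

Definition chev_f (i : 'I_n) : M2 := (chev_e i)^T.

Definition xgen (i : 'I_n) (a : R) : M2 := expmx (a *: chev_e i).

Definition ygen (i : 'I_n) (a : R) : M2 := expmx (a *: chev_f i).

Definition sdot (i : 'I_n) : M2 := xgen i (-1) *m ygen i 1 *m xgen i (-1).

Definition word_dot (s : seq 'I_n) : M2 := \prod_(i <- s) sdot i.

Definition normalizer_torus : set M2 :=
  [set g | Sp g /\ [set g *m t *m invmx g | t in torus] = torus].

Definition tcoset (g : M2) : set M2 := [set g *m t | t in torus].

(* W = N_G(T) / T, its elements being cosets of T, i.e. sets of matrices. *)
Definition weyl : set (set M2) := [set tcoset g | g in normalizer_torus].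

(* [word_dot s] lies in the coset w iff the word s is an expression of w. *)
Definition reduced (w : set M2) : set (seq 'I_n) :=
  [set s | w (word_dot s) /\
    forall s', w (word_dot s') -> (size s <= size s')%N].

Definition wlength (w : set M2) : nat := size (xget [::] (reduced w)).

Definition wdot (w : set M2) : M2 := word_dot (xget [::] (reduced w)).

(* subword definition of the Bruhat order *)
Definition bruhat (v w : set M2) : Prop :=
  exists s s', [/\ reduced v s, reduced w s' & subseq s s'].

Definition longest (w : set M2) : Prop :=
  weyl w /\ forall v, weyl v -> (wlength v <= wlength w)%N.

Definition weylJ : set (set M2) :=
  [set tcoset (word_dot s) | s in [set s | all (fun i : 'I_n => i.+1 != n) s]].

(* W^J; mulS w u is the coset product w u *)
Definition weyl_minJ : set (set M2) :=
  [set w | weyl w /\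
    forall u, weylJ u -> (wlength w <= wlength (mulS w u))%N].

End Groups.

(** * The Lagrangian Grassmannian *)

Section Lagrangian.
Variables (R : realType) (n : nat).
Local Notation M2 := 'M[R]_(n + n).

Definition lag_frame : set 'M[R]_(n + n, n) := [set M | \rank M = n /\
  (usubmx M)^T *m dsubmx M = (dsubmx M)^T *m usubmx M].

Definition same_span (M N : set_type lag_frame) : bool :=
  ((\val M)^T == (\val N)^T)%MS.

Lemma same_span_refl : reflexive same_span.
Proof. by move=> M; rewrite /same_span submx_refl. Qed.

Lemma same_span_sym : symmetric same_span.
Proof. by move=> M N; rewrite /same_span andbC. Qed.

Lemma same_span_trans : transitive same_span.
Proof.
by move=> N M P /eqmxP MN /eqmxP NP; apply/eqmxP; exact: eqmx_trans MN NP.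
Qed.

Canonical same_span_equiv := EquivRel same_span
  same_span_refl same_span_sym same_span_trans.

(* Rank-n Lagrangian matrices modulo equality of column spans, with the
   quotient topology. *)
Definition lagr : Type := quotient_topology {eq_quot same_span_equiv}%qT.

HB.instance Definition _ := Topological.on lagr.

(* x is the point [A; C], where M = col_mx A C *)
Definition repr_by (x : lagr) (M : 'M[R]_(n + n, n)) : Prop :=
  exists2 f : set_type lag_frame,
    \val f = M & x = (\pi_(lagr) f)%qT.

Definition frame0 : 'M[R]_(n + n, n) := col_mx 1%:M 0.

(* x is the point of the Grassmannian identified with g P_J^+ *)
Definition is_flag (x : lagr) (g : M2) : Prop := Sp g /\ repr_by x (g *m frame0).

(* X . P_J^+ *)
Definition dotPJ (X : set M2) : set lagr :=
  [set x | exists2 g, mulS X (@PJ_plus R n) g & is_flag x g].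

Definition lagr_pos : set lagr :=
  [set x | exists2 C : 'M[R]_n, pos_def C & repr_by x (col_mx 1%:M C)].

Definition lagr_nneg : set lagr :=
  [set x | exists A C : 'M[R]_n,
    pos_semidef (A^T *m C) /\ repr_by x (col_mx A C)].

Definition LJ0_orbit (x : lagr) : set lagr :=
  [set y | exists l M, [/\ @LJ0 R n l, repr_by x M & repr_by y (l *m M)]].

(* P_J^- v . P_J^+  intersected with  P_J^+ w . P_J^+ *)
Definition richardson (v w : set M2) : set lagr :=
  dotPJ [set p *m wdot v | p in @PJ_minus R n] `&`
  dotPJ [set p *m wdot w | p in @PJ_plus R n].

End Lagrangian.

(** * Pinnings and total positivity *)

Section Pinnings.
Variables (R : realType) (n : nat).
Local Notation M2 := 'M[R]_(n + n).

Record pinning := Pinning {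
  pin_T : set M2; pin_Bp : set M2; pin_Bm : set M2;
  pin_x : 'I_n -> R -> M2; pin_y : 'I_n -> R -> M2 }.

Definition eps_pinning (eps : 'I_n -> R) : pinning :=
  Pinning (@torus R n) (@borel_plus R n) (@borel_minus R n)
    (fun i a => xgen i (eps i * a)) (fun i a => ygen i (eps i * a)).

Definition pinC : set pinning := [set eps_pinning eps | eps in
  [set eps | (forall i, eps i = 1 \/ eps i = -1) /\
             (forall i : 'I_n, i.+1 = n -> eps i = 1)]].

(* Products z_(i_1)(a_1) ... z_(i_m)(a_m) with all a_j > 0, where
   (i_1, ..., i_m) is a reduced word of the longest element; the pairs
   (i_j, a_j) are listed in s.  As the products over one reduced word do not
   depend on that word, ranging over all reduced words gives the same set. *)
Definition long_products (z : 'I_n -> R -> M2) : set M2 :=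
  [set u | exists s : seq ('I_n * R),
    [/\ exists2 w : set M2, @longest R n w & @reduced R n w (unzip1 s),
        all (fun c => 0 < c.2) s & u = \prod_(c <- s) z c.1 c.2]].

Definition U_plus (p : pinning) : set M2 := long_products (pin_x p).

Definition U_minus (p : pinning) : set M2 := long_products (pin_y p).

Definition G_pos (p : pinning) : set M2 :=
  mulS (mulS (U_minus p) (@torus_pos R n)) (U_plus p).

Inductive G_nneg (p : pinning) : set M2 :=
| G_nneg1 : G_nneg p 1%:M
| G_nneg_T t : torus_pos t -> G_nneg p t
| G_nneg_x i a : 0 < a -> G_nneg p (pin_x p i a)
| G_nneg_y i a : 0 < a -> G_nneg p (pin_y p i a)
| G_nneg_M g h : G_nneg p g -> G_nneg p h -> G_nneg p (g *m h).

Definition lagr_pin_pos (p : pinning) : set (lagr R n) := dotPJ (G_pos p).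

Definition lagr_pin_nneg (p : pinning) : set (lagr R n) :=
  closure (dotPJ (G_nneg p)).

End Pinnings.

(** * Generalized Pluecker positivity *)

Section Plucker.
Variables (R : realType) (n : nat).
Local Notation M2 := 'M[R]_(n + n).

(* The n-th tensor power of R^(2n), in coordinates on the basis
   e_(f 0) (x) ... (x) e_(f (n-1)).  The exterior power is its subspace of
   alternating tensors, v_1 /\ ... /\ v_n being the signed sum over the
   permutations of the v_i; its coordinates are n x n minors. *)
Definition tensor : Type := {ffun {ffun 'I_n -> 'I_(n + n)} -> R}.

HB.instance Definition _ := GRing.Lmodule.on tensor.

Definition tensor_act (g : M2) (v : tensor) : tensor :=
  [ffun f : {ffun 'I_n -> 'I_(n + n)} =>
     \sum_(h : {ffun 'I_n -> 'I_(n + n)}) (\prod_i g (f i) (h i)) * v h].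

Definition wedge (M : 'M[R]_(n + n, n)) : tensor :=
  [ffun f : {ffun 'I_n -> 'I_(n + n)} => \det (\matrix_(i, j) M (f i) j)].

(* e_1 /\ ... /\ e_n *)
Definition eta : tensor := wedge (@frame0 R n).

(* V_(omega_n), the linear span of the G-orbit of eta *)
Definition Vomega : set tensor :=
  [set v | exists (m : nat) (c : 'I_m -> R) (g : 'I_m -> M2),
    (forall j, Sp (g j)) /\ v = \sum_j c j *: tensor_act (g j) eta].

(* The character diag(a_1, ..., a_n, ...) |-> prod_i a_i ^ nu_i of T *)
Definition torus_char (nu : {ffun 'I_n -> int}) (t : M2) : R :=
  \prod_i t (lshift n i) (lshift n i) ^ nu i.

Definition omega_n : {ffun 'I_n -> int} := [ffun=> 1].

Definition is_extremal_weight (w : set M2) (nu : {ffun 'I_n -> int}) : Prop :=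
  forall t, torus t -> torus_char nu t = torus_char omega_n (invmx (wdot w) *m t *m wdot w).

Definition weight_space (nu : {ffun 'I_n -> int}) : set tensor :=
  [set v | Vomega v /\
    forall t, torus t -> tensor_act t v = torus_char nu t *: v].

Definition extremal_vector (w : set M2) : tensor := tensor_act (wdot w) eta.

(* v is the sum of the weight vectors u j, of distinct weights nu j, and its
   component in the weight space of weight w omega_n is c w times the
   extremal vector, for each w in W^J. *)
Definition plucker_coords (v : tensor) (c : set M2 -> R) : Prop :=
  exists (m : nat) (nu : 'I_m -> {ffun 'I_n -> int}) (u : 'I_m -> tensor),
    [/\ injective nu, forall j, weight_space (nu j) (u j), v = \sum_j u j &
        forall w, weyl_minJ w -> exists j,
          is_extremal_weight w (nu j) /\ u j = c w *: extremal_vector w].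

Definition lagr_plucker_pos : set (lagr R n) :=
  [set x | exists g c, [/\ is_flag x g, plucker_coords (tensor_act g eta) c &
    exists2 k, k != 0 & forall w, weyl_minJ w -> 0 < k * c w]].

Definition lagr_plucker_nneg : set (lagr R n) :=
  [set x | exists g c, [/\ is_flag x g, plucker_coords (tensor_act g eta) c &
    exists2 k, k != 0 & forall w, weyl_minJ w -> 0 <= k * c w]].

End Plucker.

(* Main.v *)
(* A frame [A; C] of a point is nonnegative iff A^t C is positive semidefinite,
   a condition independent of the frame and closed.

   (1) The P_J^- and P_J^+ orbits are told apart by the ranks of A and of C, so
   a Richardson piece fixes both ranks.  A nonnegative frame can be moved by
   L_J^o and a change of frame to a normal form depending only on these ranks,
   and matrices of positive determinant are joined to the identity by a curve;
   when both ranks are fixed, A^t C is positive semidefinite as soon as it is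
   positive definite on a subspace of dimension rank A + rank C - n, so that
   nonnegativity is also an open condition.

   (2) The Cayley transform X = (A - C) (A + C)^-1 identifies the nonnegative
   part with the symmetric matrices of numerical radius at most 1, the positive
   part being given by radius less than 1.  This is the unit ball of a norm,
   and rescaling along rays maps it to the Euclidean ball.

   (3) In the order e_1, ..., e_n, e_2n, ..., e_(n+1), and up to signs given by
   the pinning, the generators add nonnegative multiples of a row to a
   neighbouring one, which preserves nonnegativity of all minors, and a product
   of y_i along a reduced word makes the minor read off the word positive.  For
   the longest word this gives invertible A and C.  On the cell of a pinning,
   the signs of the entries (i, i + 1) of C A^-1 are those of the pinning, hence
   disjointness.  On its closure all entries have signs d_i d_j given by signs
   d_i, so that a positive definite matrix with three negative entries in the
   places (1, 2), (2, 3), (1, 3) is not reached for n >= 3.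

   (4) The generalized Pluecker coordinates are the determinants of the matrices
   with rows from C for i in S and from A for the other i, S a subset of
   {1, ..., n}.  If A = I they are the principal minors of C, and Sylvester's
   criterion with all principal minors applies; a nonnegative point is pushed
   into the positive part along [A + t C; C + t (A + t C)]. *)
From HB Require Import structures.
From mathcomp Require Import all_boot all_order all_algebra.
From mathcomp Require Import all_classical all_reals all_analysis.
From mathcomp Require Import generic_quotient perm.
From mathcomp Require Import ring lra zify.
Require Import Defs.

Set Implicit Arguments.
Unset Strict Implicit.
Unset Printing Implicit Defensive.

(** The ranks of a piece depend on [v] and [w] only through the numbers of vectors among e_1, ...,
    e_n that they send, up to sign, to vectors among e_(n+1), ..., e_(2n). So the Bruhat order
    enters by one inequality between these numbers, obtained from rank functions of permutations;
    conversely every pair j <= k comes from two suffixes of a reduced word of an element that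
    exchanges everything. Elements of W are cosets of T, while exchange and subwords concern words,
    which act on 2n positions as signed permutations; two words give one coset exactly when they act
    alike. In the chosen order of positions each Chevalley generator mixes adjacent rows only, which
    serves both the Bruhat order and total positivity. A frame is known up to an invertible right
    factor, which multiplies all n x n minors by one scalar of unknown sign. Sign conditions meant
    to pass to a closure are therefore put on products of two minors. The pushing curve makes two
    moves because the first only makes A invertible; the second, with the roles of A and C
    exchanged, makes the form definite and all coordinates positive. *)

(** * Words in the simple reflections of type C_n acting as signed permutations *)

Section SignedPermutations.
Variable n : nat.
Implicit Types (j p q r : nat) (s : seq 'I_n).

(* Position p < n stands for the basis vector of index p and position
   2n - 1 - p for that of index n + p, i.e. the basis is listed in the order
   e_1, ..., e_n, e_2n, ..., e_(n+1), and [refl j] is the simple reflection of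
   index j on positions. *)
Definition mirror p := n + n - 1 - p.

Definition refl j p :=
  if p == j then j.+1 else if p == j.+1 then j else
  if p == n + n - 1 - j then n + n - 2 - j else
  if p == n + n - 2 - j then n + n - 1 - j else p.

(** Letters act from the head of the word: the row of [word_dot s *m M] at position [p] is, up to
    sign, the row of [M] at position [state s p]. *)
Fixpoint state s p := if s is j :: s' then state s' (refl j p) else p.

(** The reflection exchanging [p] and [q], and with them their mirror images. *)
Definition swap2 p q r :=
  if r == p then q else if r == q then p else
  if r == mirror p then mirror q else if r == mirror q then mirror p else r.

Lemma refl_lt j p : j < n -> p < n + n -> refl j p < n + n.
Proof. by rewrite /refl => jn pn; do ?[case: ifP => ?]; lia. Qed.

Lemma reflK j p : j < n -> p < n + n -> refl j (refl j p) = p.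
Proof.
move=> jn pn; rewrite {2}/refl; do ?[case: ifP => ?];
  rewrite /refl; do ?[case: ifP => ?]; lia.
Qed.

Lemma refl_mirror j p : j < n -> p < n + n ->
  refl j (mirror p) = mirror (refl j p).
Proof.
move=> jn pn; rewrite /refl /mirror; do ?[case: ifP => ?];
  do ?[case: ifP => ?]; lia.
Qed.

Lemma refl_inj j p q : j < n -> p < n + n -> q < n + n ->
  (refl j p == refl j q) = (p == q).
Proof.
move=> jn pn qn; apply/eqP/eqP => [|->//] h.
by rewrite -(reflK jn pn) h reflK.
Qed.

Lemma mirror_lt p : p < n + n -> mirror p < n + n.
Proof. rewrite /mirror; lia. Qed.

Lemma state_lt s p : p < n + n -> state s p < n + n.
Proof.
by elim: s p => //= j s IHs p pn; apply: IHs; exact: refl_lt.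
Qed.

Lemma state_mirror s p : p < n + n -> state s (mirror p) = mirror (state s p).
Proof.
elim: s p => //= j s IHs p pn.
by rewrite refl_mirror // IHs // refl_lt.
Qed.

Lemma state_inj s p q : p < n + n -> q < n + n -> state s p = state s q -> p = q.
Proof.
elim: s p q => //= j s IHs p q pn qn /IHs h.
by apply/eqP; rewrite -(@refl_inj j) // h // refl_lt.
Qed.

Lemma swap2_conj j p q r : j < n -> p < n + n -> q < n + n -> r < n + n ->
  swap2 (refl j p) (refl j q) (refl j r) = refl j (swap2 p q r).
Proof.
move=> jn pn qn rn; rewrite /swap2 -!refl_mirror // !refl_inj ?mirror_lt //.
by case: ifP => // _; case: ifP => // _; case: ifP => // _; case: ifP.
Qed.

(** A simple reflection inverts only the adjacent pair at [j] and its mirror image, so the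
    reflection of an inverted pair is that simple reflection. *)
Lemma swap2_refl j p q r : j < n -> q < n + n -> r < n + n ->
  p < q -> refl j q < refl j p -> swap2 p q r = refl j r.
Proof.
move=> jn qn rn pq h.
have {h} [[pE qE]|[pE qE]] : (p = j /\ q = j.+1) \/
    (p = n + n - 2 - j /\ q = n + n - 1 - j).
  move: h; rewrite /refl; do ?[case: ifP => ?]; lia.
all: rewrite /swap2 /refl /mirror pE qE.
all: do ?[case: ifP => ?]; lia.
Qed.

Lemma swap2_simple j r : j < n -> r < n + n -> swap2 j j.+1 r = refl j r.
Proof.
move=> jn rn; apply: swap2_refl => //; first lia.
by rewrite /refl eqxx; case: ifP => [/eqP|/eqP] ?; rewrite ?eqxx; lia.
Qed.

Definition same_state s s' := forall r, r < n + n -> state s r = state s' r.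

(** Strong exchange: the pair [p < q] is carried along the word until a letter reverses it; that
    letter acts as the reflection of the current pair, and deleting it has the effect of
    [swap2 p q]. *)
Lemma exchange s p q : p < q -> q < n + n -> state s q < state s p ->
  exists2 s', size s' < size s &
    forall r, r < n + n -> state s' r = state s (swap2 p q r).
Proof.
elim: s p q => [|j s IHs] p q pq qn /=; first lia.
have jn := ltn_ord j => h; have pn : p < n + n by lia.
have [pq'|qp'|e] := ltngtP (refl j p) (refl j q).
- have [s' ss' sE] := IHs _ _ pq' (refl_lt jn qn) h.
  exists (j :: s') => //= r rn; rewrite sE ?refl_lt //.
  by rewrite swap2_conj.
- exists s => // r rn; rewrite (swap2_refl jn qn rn pq qp').
  by rewrite reflK.
- by move/eqP: e; rewrite refl_inj // => /eqP e; lia.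
Qed.

(** Shortest among the words with the same action; [reduced_word] and [red_reduced] relate this to
    [reduced]. *)
Definition red s := forall s', same_state s' s -> size s <= size s'.

Lemma red_nil : red [::]. Proof. by []. Qed.

Lemma red_tail (j : 'I_n) s : red (j :: s) -> red s.
Proof.
move=> rs s' h; have := rs (j :: s'); rewrite /= ltnS; apply => r rn /=.
by apply: h; rewrite refl_lt.
Qed.

(** At a descent of [s] the exchange lemma would give a word shorter than [s] with the action of
    [j :: s]. *)
Lemma red_asc (j : 'I_n) s : red (j :: s) -> state s j < state s j.+1.
Proof.
move=> rs; have jn := ltn_ord j; rewrite ltnNge; apply/negP => h.
have {}h : state s j.+1 < state s j.
  by rewrite ltn_neqAle h andbT; apply/eqP => /state_inj; lia.
have [|s' ss' sE] := exchange (ltnSn j) _ h; first lia.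
have /rs /= : same_state s' (j :: s).
  by move=> r rn; rewrite sE // swap2_simple.
lia.
Qed.

Lemma red_ex s : exists2 s', same_state s' s & red s'.
Proof.
have [m] := ubnP (size s); elim: m s => // m IHm s sm.
have [rs|] := pselect (red s); first by exists s.
move=> /existsNP[s' /not_implyP[ss' /negP]].
rewrite -ltnNge => lt.
have [|s'' h1 h2] := IHm s'; first lia.
by exists s'' => // r rn; rewrite h1 // ss'.
Qed.

(** If [j] were an ascent, a reduced word for [j :: s] would have a descent at [j], and the exchange
    lemma would turn it into a strictly shorter word for [s], although it is itself no longer than
    [s]. *)
Lemma longest_desc s : red s -> (forall s', red s' -> size s' <= size s) ->
  forall j : 'I_n, state s j.+1 < state s j.
Proof.
move=> rs ls j; have jn := ltn_ord j; rewrite ltnNge; apply/negP => h.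
have {}h : state s j < state s j.+1.
  by rewrite ltn_neqAle h andbT; apply/eqP => /state_inj; lia.
have [s1 s1E r1] := red_ex (j :: s).
have h1 : state s1 j.+1 < state s1 j.
  rewrite !s1E /=; try lia.
  by rewrite /refl !eqxx; case: ifP => [/eqP|_]; lia.
have [|s' ss' sE] := exchange (ltnSn j) _ h1; first lia.
have := rs s' _; have := ls _ r1; rewrite leqNgt => /negP h2 h3; apply: h2.
apply: leq_ltn_trans ss'; apply: h3 => r rn.
rewrite sE // swap2_simple // s1E ?refl_lt //= reflK //.
Qed.

Definition flipped s i := n <= state s i.

Definition nflip s := count (flipped s) (iota 0 n).

(** The descent at the last letter compares the image of n - 1 with its own mirror image, so this
    image is at least n; the other descents carry this down to all smaller positions. *)
Lemma longest_flipped s : red s -> (forall s', red s' -> size s' <= size s) ->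
  forall i, i < n -> flipped s i.
Proof.
move=> rs ls; have desc := longest_desc rs ls.
suff h k : k < n -> flipped s (n - k.+1).
  move=> i ni; have := h (n - i.+1); have -> : n - (n - i.+1).+1 = i by lia.
  by apply; lia.
elim: k => [|k IHk] kn.
  have n1 : n - 1 < n by lia.
  have := desc (Ordinal n1) => /=; have -> : (n - 1).+1 = mirror (n - 1).
    by rewrite /mirror; lia.
  rewrite state_mirror; last lia.
  by have := @state_lt s (n - 1); rewrite /flipped /mirror; lia.
have n1 : n - k.+2 < n by lia.
have := desc (Ordinal n1) => /=; have -> : (n - k.+2).+1 = n - k.+1 by lia.
by have := IHk (ltnW kn); rewrite /flipped; lia.
Qed.

(** The largest element [i] of [S] is moved one step up, or removed by the last letter if it is n -
    1; either way the sum of n - i over [S] decreases. *)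
Lemma word_ex (S : pred nat) : exists s, forall i, i < n -> flipped s i = S i.
Proof.
have [m] := ubnP (\sum_(i < n | S i) (n - i)); elim: m S => // m IHm S Sm.
have [/existsP[i0 Si0]|/existsPn S0] := boolP [exists i : 'I_n, S i]; last first.
  exists [::] => i ni; rewrite /flipped /= leqNgt ni.
  by have := S0 (Ordinal ni) => /= /negbTE ->.
have [i Si maxi] := @arg_maxnP _ i0 (fun i : 'I_n => S i) (fun i => i : nat) Si0.
have iN := ltn_ord i.
have [iE|ni] := eqVneq (i.+1) n.
  have [|s sE] := IHm (fun k => (k != i) && S k).
    have -> : \sum_(k < n | (k != i :> nat) && S k) (n - k) =
        \sum_(k < n | S k && (k != i)) (n - k).
      by apply: eq_bigl => k; rewrite andbC.
    have : n - i + \sum_(k < n | S k && (k != i)) (n - k) < m.+1.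
      by rewrite -(bigD1 i).
    lia.
  exists (i :: s) => k kn; rewrite /flipped /=.
  have [kE|ki] := eqVneq k i.
    have -> : refl i k = mirror i by rewrite /refl /mirror kE eqxx; lia.
    rewrite state_mirror; last lia.
    have := sE i iN; rewrite eqxx /= kE Si /flipped /mirror; lia.
  have -> : refl i k = k.
    by rewrite /refl; do ?[case: ifP => ?]; move/eqP: ki; lia.
  by have := sE k kn; rewrite ki.
have i1n : i.+1 < n by lia.
have Si1 : S i.+1 = false.
  by apply/negP => /(maxi (Ordinal i1n)) /=; lia.
pose S' k := if k == i :> nat then false else if k == i.+1 then true else S k.
have [|s sE] := IHm S'.
  rewrite (bigD1 (Ordinal i1n)) /=; last first.
    by rewrite /S' /=; case: eqP => [|_]; rewrite ?eqxx //; lia.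
  have -> : \sum_(k < n | S' k && (k != Ordinal i1n)) (n - k) =
      \sum_(k < n | S k && (k != i)) (n - k).
    apply: eq_bigl => k; rewrite /S' -!val_eqE /=.
    case: (eqVneq (k : nat) i) => [->|ki] /=; first by rewrite andbF.
    by case: (eqVneq (k : nat) i.+1) => [->|ki1] /=; rewrite ?Si1 ?andbT.
  have : n - i + \sum_(k < n | S k && (k != i)) (n - k) < m.+1.
      by rewrite -(bigD1 i).
    lia.
exists (i :: s) => k kn; rewrite /flipped /=.
have [kE|ki] := eqVneq k i.
  have -> : refl i k = i.+1 by rewrite /refl kE eqxx.
  have := sE _ i1n; rewrite /flipped => ->; rewrite /S' eqxx kE Si.
  by case: eqP => //; lia.
have [kE|ki1] := eqVneq k i.+1.
  have -> : refl i k = i by rewrite /refl kE eqxx; case: eqP => //; lia.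
  by have := sE _ iN; rewrite /flipped => ->; rewrite /S' eqxx kE Si1.
have -> : refl i k = k.
  by rewrite /refl; do ?[case: ifP => ?]; move/eqP: ki; move/eqP: ki1; lia.
by have := sE _ kn; rewrite /flipped => ->; rewrite /S' (negbTE ki) (negbTE ki1).
Qed.

(** * Rank functions and the Bruhat order *)

Definition rk (f : nat -> nat) p q := count (fun i => q <= f i) (iota 0 p).

Definition tau j p := if p == j then j.+1 else if p == j.+1 then j else p.

(** Comparing these counts for all [p] and [q] is the rank form of the Bruhat order on
    permutations. *)
Definition rk_le f g := forall p q, p <= n + n -> rk f p q <= rk g p q.

Lemma rkS f p q : rk f p.+1 q = rk f p q + (q <= f p).
Proof. by rewrite /rk -addn1 iotaD count_cat /= addn0. Qed.

Lemma eq_rk f g p q : (forall i, i < p -> f i = g i) -> rk f p q = rk g p q.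
Proof. by move=> h; apply: eq_in_count => i; rewrite mem_iota => /h ->. Qed.

Lemma rk_tau f j p q : rk (f \o tau j) p q =
  if p == j.+1 then rk f j q + (q <= f j.+1) else rk f p q.
Proof.
have lo p' : p' <= j -> rk (f \o tau j) p' q = rk f p' q.
  by move=> h; apply: eq_rk => i ip; rewrite /= /tau; do ?[case: ifP => ?]; lia.
have mid : rk (f \o tau j) j.+1 q = rk f j q + (q <= f j.+1).
  by rewrite rkS lo //= /tau eqxx.
case: ifP => [/eqP ->|/eqP pj]; first exact: mid.
have [/lo//|jp] := leqP p j.
have -> : p = j.+2 + (p - j.+2) by lia.
elim: (p - j.+2) => [|k IHk].
  rewrite addn0 rkS mid [RHS]rkS rkS /= /tau eqxx.
  by case: eqP => [|_]; lia.
rewrite addnS rkS [RHS]rkS IHk; congr (_ + (_ <= _)) => /=; congr f.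
by rewrite /tau; do ?[case: ifP => ?]; lia.
Qed.

(** The lifting step of the Bruhat order: composing with [tau j] changes only the counts over the
    first [j.+1] places, and for [g], which ascends at [j], these can only grow. *)
Lemma rk_le_tau f g j : j.+1 < n + n -> rk_le f g -> g j < g j.+1 ->
  rk_le f (g \o tau j) /\ rk_le (f \o tau j) (g \o tau j).
Proof.
move=> jn fg asc; split=> p q pn; rewrite !rk_tau; case: ifP => [/eqP pj|_];
  try exact: fg.
  by rewrite pj; have := fg j.+1 q (ltnW jn); rewrite rkS rkS; lia.
have := fg j q; have := fg j.+2 q; rewrite !rkS.
have [h1|h1] := leqP q (f j.+1); have [h2|h2] := leqP q (g j.+1); lia.
Qed.

(** Each simple reflection but the last is a product of two adjacent transpositions, which brings in
    the symmetric group on 2n positions. *)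
Lemma refl_tau j p : j.+1 < n -> p < n + n ->
  refl j p = tau j (tau (n + n - 2 - j) p).
Proof.
move=> jn pn; rewrite /refl [tau (_ - _) _]/tau.
do ?[case: ifP => ?]; rewrite /tau;
  do ?[case: ifP => ?]; lia.
Qed.

Lemma refl_tau_last j p : j.+1 = n -> p < n + n -> refl j p = tau j p.
Proof.
by move=> jn pn; rewrite /refl /tau; do ?[case: ifP => ?]; lia.
Qed.

Lemma rk_le_step (j : 'I_n) f s : rk_le f (state s) -> state s j < state s j.+1 ->
  rk_le f (state (j :: s)) /\ rk_le (f \o refl j) (state (j :: s)).
Proof.
move=> fs asc; have jn := ltn_ord j.
have ext f1 f2 g1 g2 : (forall p, p < n + n -> f1 p = f2 p) ->
    (forall p, p < n + n -> g1 p = g2 p) -> rk_le f1 g1 -> rk_le f2 g2.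
  move=> h1 h2 h p q pn; rewrite -(@eq_rk f1 f2) -?(@eq_rk g1 g2); first exact: h.
    by move=> i ip; apply: h2; lia.
  by move=> i ip; apply: h1; lia.
have j1 : j.+1 < n + n by lia.
have [jl|jl] := eqVneq j.+1 n.
  have [h1 h2] := rk_le_tau j1 fs asc.
  by split; [apply: ext h1 | apply: ext h2] => p pn //=; rewrite refl_tau_last.
have {jl} jn1 : j.+1 < n by lia.
have [h1 h2] := rk_le_tau j1 fs asc.
set k := n + n - 2 - j.
have k1 : k.+1 < n + n by rewrite /k; lia.
(* The mirror image of the ascent at [j] is an ascent at [k], out of reach of [tau j]. *)
have asc' : (state s \o tau j) k < (state s \o tau j) k.+1.
  rewrite /= /tau; do ?[case: ifP => ?]; rewrite /k; try lia.
  have -> : n + n - 2 - j = mirror j.+1 by rewrite /mirror; lia.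
  have -> : (mirror j.+1).+1 = mirror j by rewrite /mirror; lia.
  rewrite !state_mirror //; try lia.
  by have := state_lt s j1; rewrite /mirror; lia.
have [h3 _] := rk_le_tau k1 h1 asc'; have [_ h4] := rk_le_tau k1 h2 asc'.
by split; [apply: ext h3 | apply: ext h4] => p pn //=; rewrite refl_tau.
Qed.

(** As [s'] is reduced, each of its letters is prepended at an ascent; the letter is either
    prepended to the subword as well or skipped, and both preserve the comparison. *)
Lemma rk_le_subseq s s' : red s' -> subseq s s' -> rk_le (state s) (state s').
Proof.
elim: s' s => [|j s' IHs'] s rs'; first by rewrite subseq0 => /eqP -> p q.
have asc := red_asc rs'; have rs := red_tail rs'.
case: s => [|i s] /=.
  by move=> _; apply: (rk_le_step (IHs' [::] rs (sub0seq _)) asc).1.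
case: ifP => [/eqP -> h|_ h].
  exact: (rk_le_step (IHs' _ rs h) asc).2.
exact: (rk_le_step (IHs' _ rs h) asc).1.
Qed.

(** The number of flips is the rank function at (n, n). *)
Lemma nflip_subseq s s' : red s' -> subseq s s' -> nflip s <= nflip s'.
Proof. by move=> rs' /(rk_le_subseq rs')/(_ n n (leq_addr _ _)). Qed.

Lemma eq_nflip s s' : same_state s s' -> nflip s = nflip s'.
Proof.
by move=> h; apply: eq_in_count => i; rewrite mem_iota /flipped => ?; rewrite h //; lia.
Qed.

Lemma nflip_cons (j : 'I_n) s : nflip (j :: s) <= (nflip s).+1.
Proof.
have jn := ltn_ord j; rewrite /nflip.
have [jl|jl] := eqVneq j.+1 n.
  have -> : iota 0 n = iota 0 (j + 1) by congr iota; lia.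
  rewrite !iotaD !count_cat /= !addn0 add0n.
  rewrite (@eq_in_count _ (flipped (j :: s)) (flipped s)).
    by rewrite -addnS leq_add2l; case: (flipped (j :: s) j).
  move=> i; rewrite mem_iota /flipped /= => ij.
  by rewrite refl_tau_last; [rewrite /tau; do ?[case: ifP => ?]; lia | lia | lia].
have -> : count (flipped (j :: s)) (iota 0 n) = rk (state s \o tau j) n n.
  apply: eq_in_count => i; rewrite mem_iota /flipped /= => ij.
  rewrite refl_tau; try lia; rewrite [tau (_ - _) _]/tau.
  by do ?[case: ifP => ?]; lia.
by rewrite rk_tau; case: ifP => [/eqP|_]; [lia | exact: leqnSn].
Qed.

(** The empty word flips nothing and a letter adds at most one flip, so every intermediate value
    occurs along the suffixes. *)
Lemma nflip_suffix s k : k <= nflip s ->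
  exists t u, s = t ++ u /\ nflip u = k.
Proof.
elim: s => [|j s IHs].
  have -> : nflip [::] = 0.
    rewrite /nflip (@eq_in_count _ _ pred0) ?count_pred0 // => i.
    by rewrite mem_iota /flipped /=; lia.
  by rewrite leqn0 => /eqP ->; exists [::], [::]; split=> //;
    rewrite /nflip (@eq_in_count _ _ pred0) ?count_pred0 // => i;
    rewrite mem_iota /flipped /=; lia.
have := nflip_cons j s; have [ks _ _|ks h1 h2] := leqP k (nflip s).
  by have [t [u [-> uE]]] := IHs ks; exists (j :: t), u.
by exists [::], (j :: s); split=> //; lia.
Qed.

Lemma red_suffix t u : red (t ++ u) -> red u.
Proof. by elim: t => //= j t IHt /red_tail. Qed.

Lemma red_pair_ex j k : j <= k -> k <= n ->
  exists s s', [/\ red s, red s', subseq s s', nflip s = j & nflip s' = k].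
Proof.
move=> jk kn; have [s0 s0E] := word_ex predT.
have [s1 s1E r1] := red_ex s0.
have s1n : nflip s1 = n.
  rewrite (eq_nflip s1E) /nflip (@eq_in_count _ _ predT) ?count_predT ?size_iota //.
  by move=> i; rewrite mem_iota => ?; exact: s0E.
have [|t [s' [sE s'k]]] := @nflip_suffix s1 k; first by rewrite s1n.
have r' : red s' by apply: (@red_suffix t); rewrite -sE.
have [|t' [s [sE' sj]]] := @nflip_suffix s' j; first by rewrite s'k.
exists s, s'; split=> //; first by apply: (@red_suffix t'); rewrite -sE'.
by rewrite sE' suffix_subseq.
Qed.

End SignedPermutations.

Import Order.TTheory GRing.Theory Num.Theory.
Import numFieldNormedType.Exports.

Local Open Scope classical_set_scope.
Local Open Scope ring_scope.

(** * Quadratic forms, definiteness and congruence *)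

Section QuadraticForms.
Variable R : realType.

Definition qf n (K : 'M[R]_n) (u : 'cV[R]_n) : R := (u^T *m K *m u) 0 0.

Lemma trmxZ m n a (A : 'M[R]_(m, n)) : (a *: A)^T = a *: A^T.
Proof. exact: linearZ. Qed.

Lemma trmxD m n (A B : 'M[R]_(m, n)) : (A + B)^T = A^T + B^T.
Proof. exact: linearD. Qed.

Lemma trmxB m n (A B : 'M[R]_(m, n)) : (A - B)^T = A^T - B^T.
Proof. exact: linearB. Qed.

Lemma addmxE m n (A B : 'M[R]_(m, n)) i j : (A + B) i j = A i j + B i j.
Proof. exact: mxE. Qed.

Lemma scalemxE m n a (A : 'M[R]_(m, n)) i j : (a *: A) i j = a * A i j.
Proof. exact: mxE. Qed.

Lemma oppmxE m n (A : 'M[R]_(m, n)) i j : (- A) i j = - A i j.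
Proof. exact: mxE. Qed.

Definition nsq n (u : 'cV[R]_n) : R := (u^T *m u) 0 0.

Lemma nsqE n (u : 'cV[R]_n) : nsq u = \sum_i u i 0 ^+ 2.
Proof. by rewrite /nsq mxE; apply: eq_bigr => i _; rewrite mxE expr2. Qed.

Lemma nsq_ge0 n (u : 'cV[R]_n) : 0 <= nsq u.
Proof. by rewrite nsqE; apply: sumr_ge0 => i _; exact: sqr_ge0. Qed.

Lemma nsq_eq0 n (u : 'cV[R]_n) : nsq u = 0 -> u = 0.
Proof.
rewrite nsqE => /eqP; rewrite psumr_eq0 => [/allP h|i _]; last exact: sqr_ge0.
apply/matrixP => i j; rewrite mxE ord1.
by have := h i (mem_index_enum _); rewrite sqrf_eq0 => /eqP.
Qed.

Lemma nsq_gt0 n (u : 'cV[R]_n) : u != 0 -> 0 < nsq u.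
Proof.
move=> u0; rewrite lt0r nsq_ge0 andbT; apply: contraNneq u0 => /nsq_eq0 ->.
exact: eqxx.
Qed.

Lemma qfD n (K L : 'M[R]_n) u : qf (K + L) u = qf K u + qf L u.
Proof. by rewrite /qf mulmxDr mulmxDl addmxE. Qed.

Lemma qfZ n a (K : 'M[R]_n) u : qf (a *: K) u = a * qf K u.
Proof. by rewrite /qf -scalemxAr -scalemxAl scalemxE. Qed.

Lemma qfN n (K : 'M[R]_n) u : qf (- K) u = - qf K u.
Proof. by rewrite -scaleN1r qfZ mulN1r. Qed.

Lemma qf1 n (u : 'cV[R]_n) : qf 1%:M u = nsq u.
Proof. by rewrite /qf mulmx1. Qed.

Lemma qf_congr n m (N : 'M[R]_(n, m)) (K : 'M[R]_n) u :
  qf (N^T *m K *m N) u = qf K (N *m u).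
Proof. by rewrite /qf trmx_mul !mulmxA. Qed.

Lemma qf_scale n (K : 'M[R]_n) t u : qf K (t *: u) = t ^+ 2 * qf K u.
Proof.
by rewrite /qf trmxZ -!scalemxAl -scalemxAr !scalemxE; ring.
Qed.

Lemma qf_bilin n (K : 'M[R]_n) u v : K^T = K ->
  qf K (u + v) = qf K u + (v^T *m K *m u) 0 0 *+ 2 + qf K v.
Proof.
move=> sK; rewrite /qf trmxD !mulmxDl !mulmxDr !addmxE.
have -> : (u^T *m K *m v) 0 0 = (v^T *m K *m u) 0 0.
  transitivity ((u^T *m K *m v)^T 0 0); first by rewrite [RHS]mxE.
  by rewrite !trmx_mul trmxK sK mulmxA.
by rewrite mulr2n; ring.
Qed.

Lemma pos_def_psd n (K : 'M[R]_n) : pos_def K -> pos_semidef K.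
Proof.
move=> [sK pK]; split=> // u; have [->|/pK/ltW//] := eqVneq u 0.
by rewrite mulmx0 mxE.
Qed.

Lemma psd_qf n (K : 'M[R]_n) u : pos_semidef K -> 0 <= qf K u.
Proof. by move=> [_]; exact. Qed.

Lemma psd_qf_eq0 n (K : 'M[R]_n) u : pos_semidef K -> qf K u = 0 -> K *m u = 0.
Proof.
move=> pK qu; set w := K *m u; apply: nsq_eq0.
have sK := pK.1; have dw := psd_qf w pK; have cw := nsq_ge0 w.
(* With c = nsq w and d = qf K w the value at u + t w is 2 t c + t^2 d; this t makes it - c^2 (d +
   2) / (d + 1)^2, and d + 1 is positive even if d = 0. *)
pose t := - (nsq w / (qf K w + 1)).
have := psd_qf (u + t *: w) pK.
rewrite qf_bilin // qu add0r qf_scale.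
have -> : ((t *: w)^T *m K *m u) 0 0 = t * nsq w.
  by rewrite -mulmxA -/w trmxZ -scalemxAl scalemxE.
rewrite /t; set c := nsq w in cw *; set d := qf K w in dw *.
have d1 : 0 < d + 1 by lra.
have -> : - (c / (d + 1)) * c *+ 2 + (- (c / (d + 1))) ^+ 2 * d
    = - (c ^+ 2 * (d + 2) / (d + 1) ^+ 2).
  by rewrite mulr2n; field; rewrite gt_eqF.
rewrite oppr_ge0 pmulr_lle0 ?invr_gt0 ?exprn_gt0 // pmulr_lle0; last by lra.
by move=> h; apply/eqP; rewrite -(sqrf_eq0 c) eq_le h sqr_ge0.
Qed.

Lemma pos_def_unit n (K : 'M[R]_n) : pos_def K -> K \in unitmx.
Proof.
move=> [sK pK]; rewrite -row_free_unit -kermx_eq0.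
apply/eqP/row_matrixP => i; rewrite row0; set v := row i _.
apply/eqP/negP => /negP v0; have : v *m K = 0.
  by apply/sub_kermxP; exact: row_sub.
have vT0 : v^T != 0 by rewrite -[0]trmx0 (inj_eq trmx_inj).
by move=> h; have := pK v^T vT0; rewrite trmxK h mul0mx mxE ltxx.
Qed.

Lemma psd_unit_pos_def n (K : 'M[R]_n) :
  pos_semidef K -> K \in unitmx -> pos_def K.
Proof.
move=> pK uK; split=> [|u u0]; first exact: pK.1.
rewrite lt0r psd_qf // andbT; apply: contraNneq u0 => /(psd_qf_eq0 pK) h.
by rewrite -(mulKmx uK u) h mulmx0.
Qed.

Lemma psd_congr n m (N : 'M[R]_(n, m)) (K : 'M[R]_n) :
  pos_semidef K -> pos_semidef (N^T *m K *m N).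
Proof.
move=> [sK pK]; split; first by rewrite !trmx_mul trmxK sK mulmxA.
by move=> u; have := pK (N *m u); rewrite -/(qf K _) -qf_congr.
Qed.

Lemma pos_def_congr n m (N : 'M[R]_(n, m)) (K : 'M[R]_n) :
  (forall u : 'cV_m, N *m u = 0 -> u = 0) ->
  pos_def K -> pos_def (N^T *m K *m N).
Proof.
move=> Ninj [sK pK]; split; first by rewrite !trmx_mul trmxK sK mulmxA.
move=> u u0; have Nu0 : N *m u != 0 by apply: contra_neq u0; exact: Ninj.
by have := pK _ Nu0; rewrite -/(qf K _) -qf_congr.
Qed.

Lemma unit_inj n m (N : 'M[R]_n) (u : 'M[R]_(n, m)) :
  N \in unitmx -> N *m u = 0 -> u = 0.
Proof. by move=> uN h; rewrite -(mulKmx uN u) h mulmx0. Qed.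

Lemma pos_def_congr_unit n (N K : 'M[R]_n) : N \in unitmx ->
  pos_def (N^T *m K *m N) <-> pos_def K.
Proof.
move=> uN; split; last first.
  by apply: pos_def_congr => u; exact: unit_inj.
move/(@pos_def_congr _ _ (invmx N)).
rewrite !mulmxA -trmx_mul mulmxV // trmx1 mul1mx.
rewrite -mulmxA mulmxV // mulmx1; apply => u.
by apply: unit_inj; rewrite unitmx_inv.
Qed.

Lemma congr_mul n m p (N : 'M[R]_(n, m)) (L : 'M[R]_(m, p)) (K : 'M[R]_n) :
  (N *m L)^T *m K *m (N *m L) = L^T *m (N^T *m K *m N) *m L.
Proof. by rewrite trmx_mul !mulmxA. Qed.

Lemma psdD n (K L : 'M[R]_n) :
  pos_semidef K -> pos_semidef L -> pos_semidef (K + L).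
Proof.
move=> [sK pK] [sL pL]; split=> [|u]; first by rewrite trmxD sK sL.
by rewrite -/(qf _ _) qfD addr_ge0 //; [exact: pK | exact: pL].
Qed.

Lemma psd_pos_defD n (K L : 'M[R]_n) :
  pos_semidef K -> pos_def L -> pos_def (K + L).
Proof.
move=> [sK pK] [sL pL]; split=> [|u u0]; first by rewrite trmxD sK sL.
by rewrite -/(qf _ _) qfD ltr_wpDl //; [exact: pK | exact: pL].
Qed.

Lemma psdZ n a (K : 'M[R]_n) : 0 <= a -> pos_semidef K -> pos_semidef (a *: K).
Proof.
move=> a0 [sK pK]; split=> [|u]; first by rewrite trmxZ sK.
by rewrite -/(qf _ _) qfZ mulr_ge0 //; exact: pK.
Qed.

Lemma pos_defZ n a (K : 'M[R]_n) : 0 < a -> pos_def K -> pos_def (a *: K).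
Proof.
move=> a0 [sK pK]; split=> [|u u0]; first by rewrite trmxZ sK.
by rewrite -/(qf _ _) qfZ mulr_gt0 //; exact: pK.
Qed.

Lemma pos_def1 n : pos_def (1%:M : 'M[R]_n).
Proof. by split=> [|u /nsq_gt0]; [exact: trmx1 | rewrite -qf1]. Qed.

Lemma psd_gram n m (B : 'M[R]_(m, n)) : pos_semidef (B^T *m B).
Proof.
have := psd_congr B (pos_def_psd (pos_def1 m)); by rewrite mulmx1.
Qed.

Lemma qf_block n (a : 'M[R]_1) b c (D : 'M[R]_n) x v :
  qf (block_mx a b c D) (col_mx x v) =
  (x^T *m a *m x + v^T *m c *m x + (x^T *m b *m v)) 0 0 + qf D v.
Proof.
rewrite /qf tr_col_mx mul_row_block mul_row_col !mulmxDl !addmxE; ring.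
Qed.

Lemma pos_def_block1 n (a : 'M[R]_1) (D : 'M[R]_n) :
  pos_def (block_mx a 0 0 D) <-> 0 < a 0 0 /\ pos_def D.
Proof.
have aT : a^T = a by apply/matrixP => i j; rewrite mxE !ord1.
have qE x v : qf (block_mx a 0 0 D) (col_mx x v) =
    a 0 0 * x 0 0 ^+ 2 + qf D v.
  rewrite qf_block !mulmx0 !mul0mx !addr0; congr (_ + _).
  by rewrite !mxE !big_ord1 !mxE !big_ord1 !mxE; ring.
have mE (u : 'cV[R]_(1 + n)) : u = col_mx (usubmx u) (dsubmx u).
  by rewrite vsubmxK.
split=> [[sK pK]|[a0 [sD pD]]].
- split.
    have /pK : col_mx 1%:M 0 != 0 :> 'cV[R]_(1 + n).
      apply/eqP => /matrixP/(_ (lshift n 0) 0); rewrite col_mxEu !mxE => /eqP.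
      by rewrite oner_eq0.
    rewrite -/(qf _ _) qE /qf mulmx0 !mxE mulr1n.
    by rewrite expr1n mulr1 addr0.
  move: sK; rewrite tr_block_mx => /eq_block_mx[_ _ _ sD]; split=> // v v0.
  have /pK : col_mx 0 v != 0 :> 'cV[R]_(1 + n).
    by apply: contra_neq v0 => /(congr1 dsubmx); rewrite col_mxKd linear0.
  by rewrite -/(qf _ _) qE mxE expr0n mulr0 add0r.
- split; first by rewrite tr_block_mx sD aT !trmx0.
  move=> u u0; rewrite -/(qf _ _) [u]mE qE.
  have [v0|v0] := eqVneq (dsubmx u) 0.
    rewrite v0 /qf mulmx0 [X in _ + X]mxE addr0 mulr_gt0 // exprn_even_gt0 //=.
    apply: contraNneq u0 => x0; rewrite [u]mE v0.
    by rewrite -[0 in X in _ == X]col_mx0; apply/eqP; congr col_mx;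
       apply/matrixP => i j; rewrite [RHS]mxE !ord1.
  by apply: ltr_wpDl; [rewrite mulr_ge0 ?sqr_ge0 // ltW | exact: pD].
Qed.

(** Symmetric elimination of the first row and column; the block that remains is the Schur
    complement of [a]. *)
Lemma schur_congr n (a : 'M[R]_1) (b : 'M[R]_(n, 1)) (D : 'M[R]_n) :
  a 0 0 != 0 ->
  let N := block_mx 1%:M (- (a 0 0)^-1 *: b^T) 0 1%:M : 'M[R]_(1 + n) in
  N^T *m block_mx a b^T b D *m N =
  block_mx a 0 0 (D - (a 0 0)^-1 *: (b *m b^T)).
Proof.
move=> a0 N; rewrite /N tr_block_mx !trmx1 trmx0 trmxZ trmxK.
rewrite !mulmx_block !mulmx0 !mul0mx !mul1mx !mulmx1 !addr0.
have aE : a = (a 0 0)%:M by exact: mx11_scalar.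
congr block_mx.
- by rewrite -scalemxAr {2}aE mul_scalar_mx scalerA mulNr mulVf // scaleN1r addNr.
- by rewrite -scalemxAl {2}aE mul_mx_scalar scalerA mulNr mulVf // scaleN1r addNr.
- rewrite -scalemxAl {2}aE mul_mx_scalar scalerA mulNr mulVf // scaleN1r.
  rewrite addNr mul0mx add0r -scalemxAl addrC; congr (_ + _).
  by rewrite scaleNr.
Qed.

End QuadraticForms.

(** * Principal minors, Sylvester's criterion, normal form of semidefinite matrices *)

Section Minors.
Variable R : realType.

Definition msk n (S : pred 'I_n) : 'M[R]_n :=
  \matrix_(i, j) ((i == j) && S i)%:R.

(* The Pluecker coordinate of [A; C] with row i taken from C for i in S and
   from A otherwise *)
Definition plu n (S : pred 'I_n) (A C : 'M[R]_n) : R :=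
  \det ((1%:M - msk S) *m A + msk S *m C).

(** Rows outside [S] come from the identity, so this is the principal minor of [K] on [S]. *)
Definition pminor n (S : pred 'I_n) (K : 'M[R]_n) : R := plu S 1%:M K.

Lemma msk_mul n m (S : pred 'I_n) (B : 'M[R]_(n, m)) i j :
  (msk S *m B) i j = (S i)%:R * B i j.
Proof.
rewrite mxE (bigD1 i) //= !mxE eqxx /= big1 ?addr0 // => k ki.
by rewrite mxE eq_sym (negbTE ki) mul0r.
Qed.

Lemma mskC n (S : pred 'I_n) : 1%:M - msk S = msk (fun i => ~~ S i).
Proof.
apply/matrixP => i j; rewrite !mxE /=.
by case: (i == j); case: (S i); rewrite ?subrr ?subr0.
Qed.

Lemma msk0 n : msk (pred0 : pred 'I_n) = 0.
Proof. by apply/matrixP => i j; rewrite !mxE /= andbF. Qed.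

Lemma plu0 n (A C : 'M[R]_n) : plu pred0 A C = \det A.
Proof. by rewrite /plu msk0 subr0 mul1mx mul0mx addr0. Qed.

Lemma plu_mulr n S (A C h : 'M[R]_n) :
  plu S (A *m h) (C *m h) = plu S A C * \det h.
Proof. by rewrite /plu !mulmxA -mulmxDl det_mulmx. Qed.

Lemma plu_unit n S (A C : 'M[R]_n) : A \in unitmx ->
  plu S A C = pminor S (C *m invmx A) * \det A.
Proof.
move=> uA; rewrite /pminor -plu_mulr mul1mx -mulmxA mulVmx // mulmx1 //.
Qed.

Definition tailset n (S : pred 'I_(1 + n)) : pred 'I_n :=
  fun i => S (rshift 1 i).

Lemma msk_block n (S : pred 'I_(1 + n)) :
  msk S = block_mx (S (lshift n (0 : 'I_1)))%:R%:M 0 0 (msk (tailset S)).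
Proof.
apply/matrixP => i j; rewrite !mxE.
case: splitP => k ik; rewrite !mxE; case: splitP => l jl; rewrite !mxE.
- have -> : i = lshift n 0 by apply: val_inj; rewrite /= ik ord1.
  have -> : j = lshift n 0 by apply: val_inj; rewrite /= jl ord1.
  by rewrite eqxx !ord1 mulr1n.
- by rewrite -val_eqE /= ik jl !ord1.
- by rewrite -val_eqE /= ik jl !ord1.
- have -> : i = rshift 1 k by apply: val_inj.
  have -> : j = rshift 1 l by apply: val_inj.
  by rewrite (inj_eq (@rshift_inj _ _)).
Qed.

Lemma pminor_block1 n (S : pred 'I_(1 + n)) (a : 'M[R]_1) b (D : 'M[R]_n) :
  S (lshift n (0 : 'I_1)) -> a 0 0 != 0 ->
  pminor S (block_mx a b^T b D) =
  a 0 0 * pminor (tailset S) (D - (a 0 0)^-1 *: (b *m b^T)).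
Proof.
move=> S0 a0; rewrite /pminor /plu !mulmx1 mskC msk_block [msk S]msk_block.
rewrite /= S0 /= mulmx_block !mul0mx !mul_scalar_mx !scale1r !addr0 !add0r.
rewrite add_block_mx raddf0 !add0r.
rewrite -[tailset (fun i => ~~ S i)]/(fun i => ~~ tailset S i) -mskC; set P := msk _.
(* A block LU factorisation; the Schur complement appears in the lower block of [U]. *)
pose L := block_mx 1%:M 0 ((a 0 0)^-1 *: (P *m b)) 1%:M : 'M[R]_(1 + n).
pose U := block_mx a b^T 0 (1%:M - P + P *m (D - (a 0 0)^-1 *: (b *m b^T)))
  : 'M[R]_(1 + n).
have -> : block_mx a b^T (P *m b) (1%:M - P + P *m D) = L *m U.
  rewrite mulmx_block !mul1mx !mul0mx !addr0.
  congr block_mx.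
    by rewrite {2}(mx11_scalar a) mul_mx_scalar scalerA mulfV // scale1r.
  rewrite mulmxBr -scalemxAr -!scalemxAl mulmxA.
  by rewrite [RHS]addrC -[RHS]addrA subrK.
rewrite det_mulmx det_lblock !det1 !mul1r det_ublock; congr (_ * _).
by rewrite {1}(mx11_scalar a) det_scalar1.
Qed.

Lemma pminor_block1N n (S : pred 'I_(1 + n)) (a : 'M[R]_1) b c (D : 'M[R]_n) :
  ~~ S (lshift n (0 : 'I_1)) ->
  pminor S (block_mx a b c D) = pminor (tailset S) D.
Proof.
move=> S0; rewrite /pminor /plu !mulmx1 mskC msk_block [msk S]msk_block.
rewrite /= (negbTE S0) /= mulmx_block !mul0mx !mul_scalar_mx !scale0r !addr0.
rewrite add_block_mx !add0r !addr0 -[tailset (fun i => ~~ S i)]/(fun i => ~~ tailset S i).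
by rewrite -mskC det_lblock det_scalar1 mul1r.
Qed.

Definition headset n (b : bool) (S : pred 'I_n) : pred 'I_(1 + n) :=
  fun i => match fintype.split i with inl _ => b | inr j => S j end.

Lemma headsetK n b (S : pred 'I_n) : tailset (headset b S) =1 S.
Proof. by move=> i; rewrite /tailset /headset -[rshift 1 i]/(unsplit (inr i)) unsplitK. Qed.

Lemma headset0 n b (S : pred 'I_n) : headset b S (lshift n 0) = b.
Proof. by rewrite /headset -[lshift n 0]/(unsplit (inl 0)) unsplitK. Qed.

Lemma eq_plu n (S T : pred 'I_n) (A C : 'M[R]_n) :
  S =1 T -> plu S A C = plu T A C.
Proof.
move=> ST; rewrite /plu; have -> // : msk S = msk T.
by apply/matrixP => i j; rewrite !mxE ST.
Qed.

(** Induction through the Schur complement: sets containing the first index read its minors, the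
    other sets those of the block [D]. *)
Lemma sylvester n (K : 'M[R]_n) : K^T = K ->
  pos_def K <-> forall S, 0 < pminor S K.
Proof.
elim: n K => [|n IHn] K sK.
  split=> [_ S|_]; first by rewrite /pminor /plu [\det _]det_mx00.
  by split=> // u; rewrite [u]flatmx0 eqxx.
move: K sK; rewrite -[n.+1]/(1 + n)%N => K.
rewrite -[K]submxK; set a := ulsubmx K; set c := ursubmx K; set b := dlsubmx K.
set D := drsubmx K; rewrite tr_block_mx => /eq_block_mx[_ _ cE sD].
rewrite -[c]trmxK cE; set S0 := D - (a 0 0)^-1 *: (b *m b^T).
have sS0 : S0^T = S0 by rewrite trmxB trmxZ trmx_mul trmxK sD.
have aT : a^T = a by apply/matrixP => i j; rewrite mxE !ord1.
have schur : a 0 0 != 0 ->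
    pos_def (block_mx a b^T b D) <-> 0 < a 0 0 /\ pos_def S0.
  move=> a0; rewrite -pos_def_block1 -/S0 -(schur_congr b D a0).
  rewrite pos_def_congr_unit // unitmxE det_ublock !det1 mulr1 unitr1 //.
split=> [pK S|pS].
- have a0 : 0 < a 0 0.
    have u0 : col_mx 1%:M 0 != 0 :> 'cV[R]_(1 + n).
      apply/eqP => /matrixP/(_ (lshift n 0) 0); rewrite col_mxEu !mxE => /eqP.
      by rewrite oner_eq0.
    have := pK.2 _ u0; rewrite -/(qf _ _) qf_block /qf !mulmx0 trmx0 !mul0mx !addr0.
    by rewrite trmx1 mulmx1 mul1mx [X in _ + X]mxE addr0.
  have [_ pS0] := (schur (lt0r_neq0 a0)).1 pK.
  have [S0in|S0in] := boolP (S (lshift n (0 : 'I_1))).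
    rewrite pminor_block1 ?lt0r_neq0 // mulr_gt0 //.
    exact: (IHn _ sS0).1.
  rewrite pminor_block1N //; apply: (IHn _ sD).1.
  have := @pos_def_congr _ _ _ (col_mx 0 1%:M : 'M[R]_(1 + n, n)) _ _ pK.
  rewrite tr_col_mx mul_row_block trmx0 !mul0mx !add0r trmx1 !mul1mx.
  rewrite mul_row_col mulmx0 mulmx1 add0r; apply => u.
  rewrite mul_col_mx mul0mx mul1mx => /(congr1 dsubmx).
  by rewrite col_mxKd linear0.
- have a0 : 0 < a 0 0.
    (* The set containing only the first index reads the corner entry; the case of a zero corner is
       computed directly, as [pminor_block1] divides by it. *)
    have := pS (headset true (pred0 : pred 'I_n)).
    have [a0|a0] := eqVneq (a 0 0) 0; last first.
      rewrite pminor_block1 ?headset0 // /pminor (eq_plu _ _ (headsetK _ _)).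
      by rewrite plu0 det1 mulr1.
    rewrite /pminor /plu !mulmx1 mskC msk_block [msk (headset _ _)]msk_block.
    rewrite /= headset0 /= mulmx_block !mul0mx !mul_scalar_mx !scale1r !addr0 !add0r.
    have -> : msk (tailset (headset true (pred0 : pred 'I_n))) = 0.
      by apply/matrixP => i j; rewrite !mxE headsetK andbF.
    have -> : msk (tailset (fun i => ~~ headset true (pred0 : pred 'I_n) i)) = 1%:M.
      apply/matrixP => i j; rewrite !mxE /tailset /=.
      by rewrite -/(tailset _ _) headsetK andbT.
    rewrite !mul0mx add_block_mx !add0r raddf0 !addr0 det_ublock det1 mulr1.
    by rewrite add0r [a]mx11_scalar det_scalar1 [in X in _ -> X]mxE.
  apply/(schur (lt0r_neq0 a0)); split=> //; apply/(IHn _ sS0) => S.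
  have := pS (headset true S).
  rewrite pminor_block1 ?headset0 ?lt0r_neq0 // pmulr_rgt0 // /pminor.
  by rewrite (eq_plu _ _ (headsetK _ _)).
Qed.

(** Diagonalisation by congruence: a nonzero diagonal entry is moved to the corner, eliminated and
    scaled to 1. *)
Lemma psd_normal_form n (K : 'M[R]_n) : pos_semidef K ->
  exists N r, [/\ N \in unitmx, (r <= n)%N & N^T *m K *m N = pid_mx r].
Proof.
elim: n K => [|n IHn] K pK.
  exists 1%:M, 0%N; split=> //; first exact: unitmx1.
  by apply/matrixP => -[].
have [i Ki|K0] := pickP (fun i => K i i != 0); last first.
  exists 1%:M, 0%N; split=> //; first exact: unitmx1.
  suff -> : K = 0 by rewrite mulmx0 mul0mx pid_mx_0.
  (* A zero diagonal entry of a semidefinite matrix forces its whole column to vanish. *)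
  apply/matrixP => k j.
  have : K *m delta_mx j 0 = 0 :> 'cV_n.+1.
    apply: psd_qf_eq0 => //; rewrite /qf trmx_delta -rowE -colE !mxE.
    by apply/eqP/negbFE/K0.
  by rewrite -colE => /matrixP/(_ k 0); rewrite !mxE.
have Ki0 : 0 < K i i.
  rewrite lt0r Ki -[K i i](_ : qf K (delta_mx i 0) = _) ?psd_qf //.
  by rewrite /qf trmx_delta -rowE -colE !mxE.
pose N1 : 'M[R]_n.+1 := tperm_mx 0 i.
have uN1 : N1 \in unitmx by exact: unitmx_perm.
have pK1 := psd_congr N1 pK; set K1 : 'M[R]_(1 + n) := _ *m N1 in pK1.
have K1a : (ulsubmx K1) 0 0 = K i i.
  rewrite /K1 /N1 tr_tperm_mx -xrowE -xcolE !mxE.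
  have -> : lshift n (0 : 'I_1) = 0 by apply: val_inj.
  by rewrite perm.tpermL.
set a := ulsubmx K1 in K1a; set b := dlsubmx K1; set D := drsubmx K1.
have K1E : K1 = block_mx a b^T b D.
  rewrite -[K1]submxK; congr block_mx.
  by rewrite /b trmx_dlsub pK1.1.
have a0 : 0 < a 0 0 by rewrite K1a.
have := schur_congr b D (lt0r_neq0 a0).
set N2 : 'M[R]_(1 + n) := block_mx 1%:M _ 0 1%:M => /= NE.
have uN2 : N2 \in unitmx by rewrite unitmxE det_ublock !det1 mulr1 unitr1.
have pK2 := psd_congr N2 pK1; rewrite K1E NE in pK2.
set S := D - _ in pK2 NE.
have pS : pos_semidef S.
  have := psd_congr (col_mx 0 1%:M : 'M[R]_(1 + n, n)) pK2.
  rewrite tr_col_mx mul_row_block trmx0 !mul0mx !mulmx0 !add0r trmx1 !mul1mx.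
  by rewrite mul_row_col mulmx0 mulmx1 add0r.
have [N3 [r [uN3 rn N3E]]] := IHn S pS.
pose N4 : 'M[R]_(1 + n) := block_mx (Num.sqrt (a 0 0))^-1%:M 0 0 N3.
have uN4 : N4 \in unitmx.
  rewrite unitmxE /N4 det_ublock unitrM det_scalar1.
  by rewrite -unitmxE uN3 andbT unitfE invr_eq0 sqrtr_eq0 -ltNge.
have N4E : N4^T *m block_mx a 0 0 S *m N4 = pid_mx r.+1 :> 'M[R]_(1 + n).
  rewrite /N4; set s := (Num.sqrt (a 0 0))^-1.
  rewrite tr_block_mx !trmx0 tr_scalar_mx !mulmx_block.
  rewrite !mulmx0 !mul0mx !addr0 !add0r N3E.
  rewrite (mx11_scalar a) mul_scalar_mx mul_mx_scalar !scale_scalar_mx.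
  rewrite ?mul0mx ?mulmx0; have -> : s * (s * a 0 0) = 1.
    rewrite mulrA -expr2 /s exprVn sqr_sqrtr ?ltW // mulVf ?lt0r_neq0 //.
  apply/matrixP => k l; rewrite -[r.+1]/(1 + r)%N !mxE.
  case: splitP => k' kE; rewrite !mxE; case: splitP => l' lE; rewrite !mxE kE lE //=.
  - by rewrite !ord1.
  - by rewrite !ord1.
  - by rewrite !ord1.
exists (N1 *m N2 *m N4), r.+1; split=> //.
  by rewrite unitmx_mul uN4 unitmx_mul uN1 uN2.
by rewrite !congr_mul -/K1 K1E NE; exact: N4E.
Qed.

End Minors.

Definition mxsimp := (@mulmx0, @mul0mx, @mulmx1, @mul1mx, @addr0, @add0r,
  @oppr0, @mulmxN, @mulNmx, @trmx0, @trmx1, @opprK).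

(** * The symplectic group and Lagrangian frames *)

Section Symplectic.
Variable R : realType.

Lemma full_rank_injP m n (M : 'M[R]_(m, n)) :
  \rank M = n <-> forall u : 'cV[R]_n, M *m u = 0 -> u = 0.
Proof.
split=> [rM u Mu|Minj].
  have fM : row_full M by rewrite /row_full rM.
  by rewrite -[u]mul1mx -(mulVpmx fM) -mulmxA Mu mulmx0.
apply/eqP; rewrite -[_ == _]/(row_full M) -cokermx_eq0.
apply/eqP/trmx_inj/row_matrixP => i; rewrite trmx0 row0 -tr_col.
rewrite -[0]trmx0; congr (_^T); apply: Minj.
by rewrite colE mulmxA mulmx_coker mul0mx.
Qed.

Lemma inj_unitmx n (N : 'M[R]_n) :
  (forall u : 'cV[R]_n, N *m u = 0 -> u = 0) -> N \in unitmx.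
Proof. by move=> /full_rank_injP rN; rewrite -row_full_unit /row_full rN. Qed.

Lemma lag_frameP n (A C : 'M[R]_n) : lag_frame (col_mx A C) <->
  A^T *m C = C^T *m A /\
  forall u : 'cV[R]_n, A *m u = 0 -> C *m u = 0 -> u = 0.
Proof.
rewrite /lag_frame /= col_mxKu col_mxKd full_rank_injP.
split=> -[h1 h2]; split=> //.
  by move=> u Au Cu; apply: h1; rewrite mul_col_mx Au Cu col_mx0.
by move=> u; rewrite mul_col_mx -[0]col_mx0 => /eq_col_mx[]; exact: h2.
Qed.

Definition Jmx n : 'M[R]_(n + n) := block_mx 0 1%:M (- 1%:M) 0.

Lemma JmxK n : Jmx n *m (- Jmx n) = 1%:M.
Proof.
by rewrite mulmxN /Jmx mulmx_block !mxsimp opp_block_mx !mxsimp -scalar_mx_block.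
Qed.

Lemma sp_form_unit n (g : 'M[R]_(n + n)) :
  g^T *m Jmx n *m g = Jmx n -> g \in unitmx.
Proof.
move=> h; have : (- Jmx n *m g^T *m Jmx n) *m g = 1%:M.
  by rewrite -!mulmxA [X in _ *m X]mulmxA h mulNmx -mulmxN JmxK.
by case/mulmx1_unit.
Qed.

Lemma sp_formE n (g : 'M[R]_(n + n)) : g^T *m Jmx n *m g =
  let A := ulsubmx g in let B := ursubmx g in
  let C := dlsubmx g in let D := drsubmx g in
  block_mx (A^T *m C - C^T *m A) (A^T *m D - C^T *m B)
           (B^T *m C - D^T *m A) (B^T *m D - D^T *m B).
Proof.
rewrite -{1 2}[g]submxK /= /Jmx tr_block_mx !mulmx_block.
rewrite !mulmx0 !mulmxN !mulmx1 !add0r !addr0 !mulNmx.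
by congr block_mx; rewrite addrC.
Qed.

Lemma sp_form n (g : 'M[R]_(n + n)) :
  let A := ulsubmx g in let B := ursubmx g in
  let C := dlsubmx g in let D := drsubmx g in
  A^T *m D - C^T *m B = 1%:M -> A^T *m C = C^T *m A -> B^T *m D = D^T *m B ->
  g^T *m Jmx n *m g = Jmx n.
Proof.
move=> A B C D h1 h2 h3.
rewrite sp_formE /= h1 h2 h3 !subrr /Jmx; congr block_mx.
by apply: trmx_inj; rewrite trmxB [RHS]linearN /= trmx1 -h1 !trmx_mul !trmxK opprB.
Qed.

Lemma SpP n (g : 'M[R]_(n + n)) : Sp g <-> g^T *m Jmx n *m g = Jmx n.
Proof.
split=> [[_ h1 h2 h3]|h]; first exact: sp_form.
have ug := sp_form_unit h; move: h; rewrite sp_formE /=.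
move=> /eq_block_mx[h1 h2 _ h4]; split=> //; exact/subr0_eq.
Qed.

Lemma Sp_block n (A B C D : 'M[R]_n) :
  A^T *m D - C^T *m B = 1%:M -> A^T *m C = C^T *m A -> B^T *m D = D^T *m B ->
  Sp (block_mx A B C D).
Proof.
move=> h1 h2 h3; apply/SpP/sp_form;
  by rewrite ?block_mxKul ?block_mxKur ?block_mxKdl ?block_mxKdr.
Qed.

Lemma Sp_unit n (g : 'M[R]_(n + n)) : Sp g -> g \in unitmx.
Proof. by case. Qed.

Lemma Sp_mul n (g h : 'M[R]_(n + n)) : Sp g -> Sp h -> Sp (g *m h).
Proof.
move=> /SpP gE /SpP hE; apply/SpP.
by rewrite trmx_mul -!mulmxA (mulmxA _ g) (mulmxA _ (_ *m g)) mulmxA [g^T *m _]mulmxA gE hE.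
Qed.

Lemma Sp_inv n (g : 'M[R]_(n + n)) : Sp g -> Sp (invmx g).
Proof.
move=> gS; have ug := Sp_unit gS; move/SpP: gS => gE; apply/SpP.
rewrite -{1}gE !mulmxA -trmx_mul mulmxV // trmx1 mul1mx.
by rewrite -mulmxA mulmxV // mulmx1.
Qed.

Lemma Sp1 n : Sp (1%:M : 'M[R]_(n + n)).
Proof. by apply/SpP; rewrite trmx1 mul1mx mulmx1. Qed.

Definition dg n (A : 'M[R]_n) : 'M[R]_(n + n) := block_mx A 0 0 (invmx A^T).

Definition low n (S : 'M[R]_n) : 'M[R]_(n + n) := block_mx 1%:M 0 S 1%:M.

Definition upp n (S : 'M[R]_n) : 'M[R]_(n + n) := block_mx 1%:M S 0 1%:M.

Lemma Sp_dg n (A : 'M[R]_n) : A \in unitmx -> Sp (dg A).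
Proof.
move=> uA; apply/SpP; rewrite /dg /Jmx tr_block_mx !mulmx_block !trmx0.
rewrite !mxsimp mulmxV ?unitmx_tr // trmx_inv trmxK mulVmx //.
Qed.

Lemma Sp_low n (S : 'M[R]_n) : S^T = S -> Sp (low S).
Proof.
move=> sS; apply/SpP; rewrite /low /Jmx tr_block_mx !mulmx_block !trmx0 !trmx1.
by rewrite !mxsimp sS addNr.
Qed.

Lemma Sp_upp n (S : 'M[R]_n) : S^T = S -> Sp (upp S).
Proof.
move=> sS; apply/SpP; rewrite /upp /Jmx tr_block_mx !mulmx_block !trmx0 !trmx1.
by rewrite !mxsimp sS addNr.
Qed.

Lemma dg_mul_col n m (L : 'M[R]_n) (A C : 'M[R]_(n, m)) :
  dg L *m col_mx A C = col_mx (L *m A) (invmx L^T *m C).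
Proof. by rewrite /dg mul_block_col !mul0mx addr0 add0r. Qed.

Lemma low_mul_col n m (S : 'M[R]_n) (A C : 'M[R]_(n, m)) :
  low S *m col_mx A C = col_mx A (S *m A + C).
Proof. by rewrite /low mul_block_col !mul0mx !mul1mx addr0. Qed.

Lemma upp_mul_col n m (S : 'M[R]_n) (A C : 'M[R]_(n, m)) :
  upp S *m col_mx A C = col_mx (A + S *m C) C.
Proof. by rewrite /upp mul_block_col !mul0mx !mul1mx add0r. Qed.

Lemma lag_mulr n (M : 'M[R]_(n + n, n)) h : h \in unitmx ->
  lag_frame M -> lag_frame (M *m h).
Proof.
move=> uh; rewrite -[M]vsubmxK mul_col_mx => /lag_frameP[h1 h2].
apply/lag_frameP; split; last first.
  move=> u; rewrite -!mulmxA => Au Cu; have := h2 _ Au Cu; exact: unit_inj.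
by rewrite !trmx_mul -!mulmxA (mulmxA _ _ h) h1 !mulmxA.
Qed.

Lemma lag_mul n (M : 'M[R]_(n + n, n)) g : Sp g ->
  lag_frame M -> lag_frame (g *m M).
Proof.
move=> gS; have formE (N : 'M[R]_(n + n, n)) :
    N^T *m Jmx n *m N = (usubmx N)^T *m dsubmx N - (dsubmx N)^T *m usubmx N.
  rewrite -{1 2}[N]vsubmxK tr_col_mx /Jmx mul_row_block !mulmx0 mulmx1 add0r.
  by rewrite addr0 mulmxN mulmx1 mul_row_col mulNmx addrC.
move=> [rM sM]; split.
  by rewrite (eqmxMfull M _) ?row_full_unit ?(Sp_unit gS).
apply/subr0_eq; rewrite -formE trmx_mul -!mulmxA (mulmxA _ g) (mulmxA g^T).
by rewrite (mulmxA g^T); move/SpP: gS => ->; rewrite mulmxA formE sM subrr.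
Qed.

Lemma lag_frame0 n : lag_frame (@frame0 R n).
Proof.
apply/lag_frameP; split; first by rewrite trmx0 mulmx0 mul0mx.
by move=> u; rewrite mul1mx.
Qed.

Lemma lag_sym n (K : 'M[R]_n) : K^T = K -> lag_frame (col_mx 1%:M K).
Proof.
move=> sK; apply/lag_frameP; split; first by rewrite trmx1 mul1mx mulmx1.
by move=> u; rewrite mul1mx.
Qed.

(** * Points of the Grassmannian and their frames *)

Definition mkl n (M : 'M[R]_(n + n, n)) (h : lag_frame M) : lagr R n :=
  (\pi_(lagr R n) (exist _ M (mem_set h) : set_type (@lag_frame R n)))%qT.

Lemma repr_mkl n (M : 'M[R]_(n + n, n)) (h : lag_frame M) :
  repr_by (mkl h) M.
Proof. by eexists; [|reflexivity]. Qed.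

Lemma repr_ex n (M : 'M[R]_(n + n, n)) : lag_frame M -> exists x, repr_by x M.
Proof. by move=> h; exists (mkl h); exact: repr_mkl. Qed.

Lemma repr_lag n x (M : 'M[R]_(n + n, n)) : repr_by x M -> lag_frame M.
Proof. by move=> [f <- _]; exact: set_mem (valP f). Qed.

Lemma ex_repr n (x : lagr R n) : exists M, repr_by x M.
Proof. by exists (\val (repr x)); exists (repr x); rewrite ?reprK. Qed.

Lemma same_spanP n (M N : 'M[R]_(n + n, n)) : \rank M = n -> 
  reflect (exists2 h, h \in unitmx & N = M *m h) (M^T == N^T)%MS.
Proof.
move=> rM; apply: (iffP idP) => [/eqmxP MN|[h uh ->]]; last first.
  by rewrite trmx_mul; apply/eqmxP/eqmx_sym/eqmxMfull; rewrite row_full_unit unitmx_tr.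
have /submxP[D DE] : (N^T <= M^T)%MS by rewrite MN.
exists D^T; last by apply: trmx_inj; rewrite trmx_mul trmxK.
rewrite unitmx_tr -row_free_unit /row_free eqn_leq rank_leq_row /=.
by rewrite -{1}rM -mxrank_tr MN DE mxrankM_maxl.
Qed.

Lemma repr_eqP n x y (M N : 'M[R]_(n + n, n)) :
  repr_by x M -> repr_by y N ->
  x = y <-> exists2 h, h \in unitmx & N = M *m h.
Proof.
move=> [f <- ->] [g <- ->]; have rf : \rank (\val f) = n.
  by have := set_mem (valP f); case.
split=> [/eqmodP/= /(same_spanP _ rf)//|/(same_spanP _ rf) h]; exact/eqmodP.
Qed.

Lemma repr_mulr n x (M : 'M[R]_(n + n, n)) h : h \in unitmx ->
  repr_by x M -> repr_by x (M *m h).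
Proof.
move=> uh xM; have [y yM] := repr_ex (lag_mulr uh (repr_lag xM)).
suff -> : x = y by [].
by apply/(repr_eqP xM yM); exists h.
Qed.

Lemma repr_inj n x y (M : 'M[R]_(n + n, n)) :
  repr_by x M -> repr_by y M -> x = y.
Proof.
move=> xM yM; apply/(repr_eqP xM yM); exists 1%:M; rewrite ?unitmx1 //.
by rewrite mulmx1.
Qed.

(** * Normal forms under the Levi and the parabolic subgroups *)

Lemma dg_mul n (L N : 'M[R]_n) : L \in unitmx -> N \in unitmx ->
  dg L *m dg N = dg (L *m N).
Proof.
move=> uL uN; rewrite /dg mulmx_block !mxsimp; congr block_mx.
rewrite trmx_mul; have uX : N^T *m L^T \in unitmx.
  by rewrite unitmx_mul !unitmx_tr uL uN.
rewrite -[LHS](mulKmx uX) -[RHS]mulmx1; congr (_ *m _).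
by rewrite mulmxA -(mulmxA N^T) mulmxV ?unitmx_tr // mulmx1 mulmxV ?unitmx_tr.
Qed.

(** Lower block of the normal form whose upper block is [pid_mx ra]: for r <= ra the product [A^T C]
    is then [pid_mx r], and the ones from place [ra] on keep the frame injective. *)
Definition nfC n ra r : 'M[R]_n :=
  \matrix_(i, j) ((i == j) && ((i < r) || (ra <= i))%N)%:R.

(** A rank factorisation makes A the block diagonal of 1 and 0. The Lagrangian condition then makes
    [S] symmetric and kills the upper right block of C, injectivity makes the lower right block
    invertible, and a column operation clears the rest. *)
Lemma levi_form a b (A C : 'M[R]_(a + b)) :
  lag_frame (col_mx A C) -> \rank A = a ->
  exists L h S, [/\ L \in unitmx, h \in unitmx, S^T = S &
    dg L *m col_mx A C *m h =
    col_mx (block_mx 1%:M 0 0 0) (block_mx S 0 0 1%:M)].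
Proof.
move=> lM rA; pose E := col_ebase A; pose F := row_ebase A.
have uE : E \in unitmx by exact: col_ebase_unit.
have uF : F \in unitmx by exact: row_ebase_unit.
have uL : invmx E \in unitmx by rewrite unitmx_inv.
have uh : invmx F \in unitmx by rewrite unitmx_inv.
have AE : invmx E *m A *m invmx F = block_mx 1%:M 0 0 0.
  by rewrite -[A in LHS]mulmx_ebase -!mulmxA mulmxV // mulmx1 mulKmx // rA pid_mx_block.
have := lag_mulr uh (lag_mul (Sp_dg uL) lM).
rewrite dg_mul_col mul_col_mx AE; set C' := _ *m C *m _.
rewrite -[C']submxK; set S := ulsubmx C'; set C12 := ursubmx C'.
set C21 := dlsubmx C'; set C22 := drsubmx C' => /lag_frameP[sC iC].
move: sC; rewrite !tr_block_mx !mulmx_block !mxsimp => /eq_block_mx[sS C12_0 _ _].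
have uC22 : C22 \in unitmx.
  apply: inj_unitmx => u u0; have := iC (col_mx 0 u).
  rewrite !mul_block_col !mxsimp u0 C12_0 mul0mx col_mx0.
  by move=> /(_ erefl erefl) /(congr1 dsubmx); rewrite col_mxKd linear0.
pose h2 : 'M[R]_(a + b) :=
  block_mx 1%:M 0 (- (invmx C22 *m C21)) (invmx C22).
have uh2 : h2 \in unitmx.
  by rewrite unitmxE det_lblock det1 mul1r -unitmxE unitmx_inv.
exists (invmx E), (invmx F *m h2), S; split=> //.
  by rewrite unitmx_mul uh.
rewrite dg_mul_col mulmxA mul_col_mx AE -/C' mul_col_mx -[C']submxK -/S -/C12.
rewrite -/C21 -/C22 C12_0 !mulmx_block !mxsimp mulmxA mulmxV //.
by rewrite mul1mx addrN.
Qed.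

Lemma rank_dg n (A : 'M[R]_n) L h : L \in unitmx -> h \in unitmx ->
  \rank (L *m A *m h) = \rank A.
Proof.
move=> uL uh; rewrite mxrankMfree ?row_free_unit //.
by rewrite (eqmxMfull A _) ?row_full_unit.
Qed.

Lemma PJ_minus_form n (M : 'M[R]_(n + n, n)) : lag_frame M ->
  exists p h, [/\ PJ_minus p, h \in unitmx &
    p *m M *m h = col_mx (pid_mx (\rank (usubmx M))) (copid_mx (\rank (usubmx M)))].
Proof.
rewrite -[M]vsubmxK col_mxKu; set A := usubmx M; set C := dsubmx M.
move: A C (rank_leq_row A) => A C; move rE : (\rank A) => a.
move=> /subnKC; set b := (n - a)%N => nE.
move: A C rE; clearbody b; rewrite -{}nE => A C rE lM.
have [L [h [S [uL uh sS NF]]]] := levi_form lM rE.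
pose S' : 'M[R]_(a + b) := block_mx S 0 0 0.
have sS' : S'^T = S' by rewrite tr_block_mx !trmx0 sS.
exists (low (- S') *m dg L), h; split=> //.
  split; first by apply: Sp_mul; [apply: Sp_low; rewrite linearN /= sS' | exact: Sp_dg].
  by rewrite /low /dg mulmx_block !mxsimp block_mxKur.
rewrite -!mulmxA [dg L *m _]mulmxA NF low_mul_col.
rewrite /copid_mx pid_mx_block; congr col_mx.
rewrite /S' mulNmx mulmx_block !mxsimp opp_block_mx add_block_mx !mxsimp.
rewrite addNr scalar_mx_block opp_block_mx add_block_mx !mxsimp.
by rewrite addrN.
Qed.

End Symplectic.

(** * Orbits of the parabolic subgroups and normal forms under the Levi subgroup *)

Section Orbits.
Variable R : realType.

Lemma dg1_frame0 n (k : 'M[R]_n) : dg k *m @frame0 R n = @frame0 R n *m k.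
Proof. by rewrite /frame0 dg_mul_col mul_col_mx !mxsimp. Qed.

(** The frame [A; C] is completed by the rotated frame [-C; A], normalised by the Gram matrix [E],
    which is invertible because the frame is injective. *)
Lemma flag_ex n (x : lagr R n) : exists g, is_flag x g.
Proof.
have [M xM] := ex_repr x; have lM := repr_lag xM; move: xM lM.
rewrite -[M]vsubmxK; set A := usubmx M; set C := dsubmx M => xM /lag_frameP[sAC iAC].
pose E := A^T *m A + C^T *m C.
have sE : E^T = E by rewrite trmxD !trmx_mul !trmxK.
have uE : E \in unitmx.
  apply: inj_unitmx => u Eu; have : qf E u = 0 by rewrite /qf -mulmxA Eu mulmx0 mxE.
  rewrite qfD -[A^T]mulmx1 -[C^T]mulmx1 !qf_congr !qf1 => /eqP.
  rewrite paddr_eq0 ?nsq_ge0 // => /andP[/eqP/nsq_eq0 h1 /eqP/nsq_eq0 h2].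
  exact: iAC.
pose g : 'M[R]_(n + n) := block_mx A (- (C *m invmx E)) C (A *m invmx E).
exists g; split; last by rewrite /g /frame0 mul_block_col !mxsimp.
apply: Sp_block => //; first by rewrite mulmxN opprK !mulmxA -mulmxDl mulmxV.
rewrite linearN /= !trmx_mul mulNmx mulmxN trmx_inv sE.
by rewrite -!mulmxA (mulmxA C^T) -sAC !mulmxA.
Qed.

Lemma PJ_minus_mul n (p q : 'M[R]_(n + n)) :
  PJ_minus p -> PJ_minus q -> PJ_minus (p *m q).
Proof.
move=> [sp p0] [sq q0]; split; first exact: Sp_mul.
by rewrite -[p]submxK -[q]submxK p0 q0 mulmx_block !mxsimp block_mxKur.
Qed.

Lemma PJ_plus_mul n (p q : 'M[R]_(n + n)) :
  PJ_plus p -> PJ_plus q -> PJ_plus (p *m q).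
Proof.
move=> [sp p0] [sq q0]; split; first exact: Sp_mul.
by rewrite -[p]submxK -[q]submxK p0 q0 mulmx_block !mxsimp block_mxKdl.
Qed.

Lemma block_unit n (a b c d : 'M[R]_n) : block_mx a b c d \in unitmx ->
  c = 0 \/ b = 0 -> a \in unitmx /\ d \in unitmx.
Proof.
by rewrite unitmxE => u [] z; move: u; rewrite z ?det_ublock ?det_lblock
  unitrM -!unitmxE => /andP.
Qed.

Lemma PJ_minus_unit n (p : 'M[R]_(n + n)) : PJ_minus p ->
  ulsubmx p \in unitmx /\ drsubmx p \in unitmx.
Proof.
move=> [/Sp_unit]; rewrite -{1}[p]submxK => u p0.
by apply: (block_unit u); right.
Qed.

Lemma PJ_plus_unit n (p : 'M[R]_(n + n)) : PJ_plus p ->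
  ulsubmx p \in unitmx /\ drsubmx p \in unitmx.
Proof.
move=> [/Sp_unit]; rewrite -{1}[p]submxK => u p0.
by apply: (block_unit u); left.
Qed.

Lemma PJ_minus_inv n (p : 'M[R]_(n + n)) : PJ_minus p -> PJ_minus (invmx p).
Proof.
move=> pP; have [u1 _] := PJ_minus_unit pP; have [sp p0] := pP.
split; first exact: Sp_inv.
have := mulmxV (Sp_unit sp); rewrite -{1}[p]submxK -[invmx p]submxK p0.
rewrite scalar_mx_block mulmx_block !mxsimp block_mxKur.
by move=> /eq_block_mx[_ h _ _]; rewrite -[LHS](mulKmx u1) h mulmx0.
Qed.

Lemma PJ_plus_inv n (p : 'M[R]_(n + n)) : PJ_plus p -> PJ_plus (invmx p).
Proof.
move=> pP; have [_ u1] := PJ_plus_unit pP; have [sp p0] := pP.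
split; first exact: Sp_inv.
have := mulmxV (Sp_unit sp); rewrite -{1}[p]submxK -[invmx p]submxK p0.
rewrite scalar_mx_block mulmx_block !mxsimp block_mxKdl.
by move=> /eq_block_mx[_ _ h _]; rewrite -[LHS](mulKmx u1) h mulmx0.
Qed.

Lemma PJ_plus_dg n (k : 'M[R]_n) : k \in unitmx -> PJ_plus (dg k).
Proof. by move=> uk; split; [exact: Sp_dg | rewrite /dg block_mxKdl]. Qed.

Lemma PJ_plus_frame0 n (q : 'M[R]_(n + n)) : PJ_plus q ->
  q *m @frame0 R n = @frame0 R n *m ulsubmx q.
Proof.
by move=> [_ q0]; rewrite -{1}[q]submxK q0 /frame0 mul_block_col mul_col_mx !mxsimp.
Qed.

(* The orbits of a group [P] acting on frames are the fibres of any invariant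
   [f] for which the frames with a given value of [f] have a common normal
   form. *)
Lemma dotPJ_orbitP n (P : set 'M[R]_(n + n)) (f : 'M[R]_(n + n, n) -> nat)
    (Phi : nat -> 'M[R]_(n + n, n)) g0 x M :
  (forall p, P p -> Sp p) -> (forall p q, P p -> P q -> P (p *m q)) ->
  (forall p, P p -> P (invmx p)) ->
  (forall p N, P p -> f (p *m N) = f N) ->
  (forall N h, h \in unitmx -> f (N *m h) = f N) ->
  (forall N, lag_frame N -> exists p h,
    [/\ P p, h \in unitmx & p *m N *m h = Phi (f N)]) ->
  Sp g0 -> repr_by x M ->
  dotPJ [set p *m g0 | p in P] x <-> f M = f (g0 *m @frame0 R n).
Proof.
move=> PS PM PV fP fh form sg0 xM; split.
  move=> [_ [_ [p Pp <-] [q qP <-]] [_ xg]].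
  have [u1 _] := PJ_plus_unit qP.
  have [h uh ->] := (repr_eqP xg xM).1 erefl.
  by rewrite fh // -!mulmxA PJ_plus_frame0 // (fP _ _ Pp) mulmxA fh.
move=> fE; have [p [h [Pp uh pE]]] := form _ (repr_lag xM).
have lg0 := lag_mul sg0 (@lag_frame0 R n).
have [p' [h' [Pp' uh' pE']]] := form _ lg0.
have sp := PS _ Pp; have sp' := PS _ Pp'.
have uk : h' *m invmx h \in unitmx by rewrite unitmx_mul unitmx_inv uh'.
have gE : (invmx p *m p' *m g0 *m dg (h' *m invmx h)) *m @frame0 R n = M.
  rewrite -(mulmxA _ (dg _)) dg1_frame0 !mulmxA.
  have -> : invmx p *m p' *m g0 *m @frame0 R n *m h' =
      invmx p *m (p' *m (g0 *m @frame0 R n) *m h') by rewrite !mulmxA.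
  by rewrite pE' -fE -pE !mulmxA mulmxK // mulVmx ?mul1mx // (Sp_unit sp).
exists (invmx p *m p' *m g0 *m dg (h' *m invmx h)).
  exists (invmx p *m p' *m g0); first by exists (invmx p *m p') => //; apply: PM => //; exact: PV.
  by exists (dg (h' *m invmx h)) => //; exact: PJ_plus_dg.
split; last by rewrite gE.
by apply: Sp_mul; [apply: Sp_mul => //; apply: Sp_mul => //; exact: Sp_inv | exact: Sp_dg].
Qed.

Lemma dotPJ_minusP n g0 x (M : 'M[R]_(n + n, n)) : Sp g0 -> repr_by x M ->
  dotPJ [set p *m g0 | p in @PJ_minus R n] x <->
  \rank (usubmx M) = \rank (usubmx (g0 *m @frame0 R n)).
Proof.
apply: (@dotPJ_orbitP n _ (fun M => \rank (usubmx M))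
  (fun r => col_mx (pid_mx r) (copid_mx r))).
- by move=> p [].
- exact: PJ_minus_mul.
- exact: PJ_minus_inv.
- move=> p N pP; have [u1 _] := PJ_minus_unit pP; have [_ p0] := pP.
  rewrite -{1}[p]submxK p0 -{1}[N]vsubmxK mul_block_col !mxsimp col_mxKu.
  by rewrite (eqmxMfull _ _) ?row_full_unit.
- by move=> N h uh; rewrite -mul_usub_mx mxrankMfree ?row_free_unit.
- exact: PJ_minus_form.
Qed.

Lemma Sp_J n : Sp (Jmx R n).
Proof.
by apply: Sp_block; rewrite ?linearN /= !mxsimp // add0r.
Qed.

(** [Jmx] exchanges the two blocks up to sign and conjugates P_J^- into P_J^+, which reduces the
    normal form to [PJ_minus_form]. *)
Lemma dotPJ_plusP n g0 x (M : 'M[R]_(n + n, n)) : Sp g0 -> repr_by x M ->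
  dotPJ [set p *m g0 | p in @PJ_plus R n] x <->
  \rank (dsubmx M) = \rank (dsubmx (g0 *m @frame0 R n)).
Proof.
apply: (@dotPJ_orbitP n _ (fun M => \rank (dsubmx M))
  (fun r => invmx (Jmx R n) *m col_mx (pid_mx r) (copid_mx r))).
- by move=> p [].
- exact: PJ_plus_mul.
- exact: PJ_plus_inv.
- move=> p N pP; have [_ u1] := PJ_plus_unit pP; have [_ p0] := pP.
  rewrite -{1}[p]submxK p0 -{1}[N]vsubmxK mul_block_col !mxsimp col_mxKd.
  by rewrite (eqmxMfull _ _) ?row_full_unit.
- by move=> N h uh; rewrite -mul_dsub_mx mxrankMfree ?row_free_unit.
- move=> N lN; have sJ := @Sp_J n; have uJ := Sp_unit sJ.
  have [p [h [pP uh pE]]] := PJ_minus_form (lag_mul sJ lN).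
  exists (invmx (Jmx R n) *m p *m Jmx R n), h; split=> //.
    have [sp p0] := pP; split.
      by apply: Sp_mul => //; apply: Sp_mul => //; exact: Sp_inv.
    have -> : invmx (Jmx R n) = - Jmx R n.
      by rewrite -[LHS]mulmx1 -(JmxK R n) mulKmx.
    rewrite -[p]submxK p0 /Jmx opp_block_mx !mulmx_block !mxsimp.
    by rewrite block_mxKdl.
  transitivity (invmx (Jmx R n) *m (p *m (Jmx R n *m N) *m h)).
    by rewrite !mulmxA.
  rewrite pE; congr (_ *m _).
  have -> : \rank (usubmx (Jmx R n *m N)) = \rank (dsubmx N).
    by rewrite -[N in LHS]vsubmxK /Jmx mul_block_col !mxsimp col_mxKu.
  by [].
Qed.

Lemma nfC_block a b r : (r <= a)%N ->
  nfC R (a + b) a r = block_mx (pid_mx r) 0 0 1%:M.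
Proof.
move=> ra; apply/matrixP => i j; rewrite !mxE.
case: splitP => k kE; rewrite !mxE; case: splitP => l lE; rewrite !mxE;
  rewrite -val_eqE /= kE lE.
- by rewrite (leqNgt a) ltn_ord orbF.
- by rewrite (_ : (_ == _) = false) //; apply/eqP; have := ltn_ord k; lia.
- by rewrite (_ : (_ == _) = false) //; apply/eqP; have := ltn_ord l; lia.
- by rewrite eqn_add2l leq_addr orbT andbT.
Qed.

Lemma rank_nfC n a r : (r <= a)%N -> (a <= n)%N ->
  \rank (nfC R n a r) = (r + (n - a))%N.
Proof.
move=> ra /subnKC; set b := (n - a)%N => nE; rewrite -nE nfC_block //.
by rewrite rank_diag_block_mx rank_pid_mx // mxrank1.
Qed.

Lemma pidE n r (i j : 'I_n) :
  (pid_mx r : 'M[R]_n) i j = ((i == j) && (i < r)%N)%:R.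
Proof. by rewrite mxE. Qed.

Lemma pid_nfC n a r : (r <= a)%N ->
  (pid_mx a : 'M[R]_n)^T *m nfC R n a r = pid_mx r.
Proof.
move=> ra; apply/matrixP => i j; rewrite tr_pid_mx mxE (bigD1 i) //= !pidE eqxx /=.
rewrite big1 ?addr0 => [|k /negbTE ki]; last by rewrite pidE eq_sym ki mul0r.
by rewrite mxE -natrM; congr (_%:R); case: (_ == _) => //=; lia.
Qed.

Lemma psd_pid n r : pos_semidef (pid_mx r : 'M[R]_n).
Proof.
have <- : (pid_mx r : 'M[R]_n)^T *m (pid_mx r : 'M[R]_n) = pid_mx r.
  rewrite tr_pid_mx mul_pid_mx; apply/matrixP => i j; rewrite !pidE.
  by congr (_%:R); have := ltn_ord i; case: (_ == _) => //=; lia.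
exact: psd_gram.
Qed.

Lemma lag_nf n a r : (r <= a)%N -> (a <= n)%N ->
  lag_frame (col_mx (pid_mx a : 'M[R]_n) (nfC R n a r)).
Proof.
move=> ra an; apply/lag_frameP; split.
  by rewrite pid_nfC // -[LHS]tr_pid_mx -(pid_nfC n ra) trmx_mul trmxK.
move=> u Au Cu; apply/matrixP => i j; rewrite ord1 [RHS]mxE.
have [ia|ai] := ltnP i a.
  have /matrixP/(_ i 0) := Au; rewrite !mxE (bigD1 i) //= pidE eqxx ia mul1r.
  by rewrite big1 ?addr0 // => k /negbTE ki; rewrite pidE eq_sym ki mul0r.
have /matrixP/(_ i 0) := Cu; rewrite !mxE (bigD1 i) //= mxE eqxx ai orbT mul1r.
by rewrite big1 ?addr0 // => k /negbTE ki; rewrite mxE eq_sym ki mul0r.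
Qed.

Lemma diag_conj n (D : 'M[R]_n) (d : 'rV[R]_n) :
  (forall i j, i != j -> D i j = 0) -> (forall i, d 0 i ^+ 2 = 1) ->
  diag_mx d *m D *m diag_mx d = D.
Proof.
move=> D0 d1; apply/matrixP => i j; rewrite mul_mx_diag mul_diag_mx !mxE.
have [->|ij] := eqVneq i j; first by rewrite mulrAC -expr2 d1 mul1r.
by rewrite D0 // mulr0 mul0r.
Qed.

(** The symmetric block left by [levi_form] is semidefinite here, and a block diagonal change brings
    it to [pid_mx r]; comparing ranks of C gives r = rank A + rank C - n. *)
Lemma psd_levi_form n (A C : 'M[R]_n) :
  lag_frame (col_mx A C) -> pos_semidef (A^T *m C) ->
  (n <= \rank A + \rank C)%N /\ exists g h, [/\ 0 < \det g, h \in unitmx &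
    dg g *m col_mx A C *m h =
    col_mx (pid_mx (\rank A)) (nfC R n (\rank A) (\rank A + \rank C - n))].
Proof.
move rcE : (\rank C) => c.
move: A C (rank_leq_row A) rcE => A C; move rE : (\rank A) => a.
move=> an rcE lM pM.
suff [g [h [r [ug uh ra gE]]]] : exists g h r, [/\ g \in unitmx, h \in unitmx, (r <= a)%N &
    dg g *m col_mx A C *m h = col_mx (pid_mx a) (nfC R n a r)].
  have cE : c = (r + (n - a))%N.
    rewrite -(rank_nfC ra an) -rcE.
    move: gE; rewrite dg_mul_col mul_col_mx => /eq_col_mx[_ <-].
    by rewrite rank_dg // unitmx_inv unitmx_tr.
  have rE' : r = (a + c - n)%N by lia.
  split; first lia; rewrite -rE'.
  have [g0|g0] := ltP 0 (\det g); first by exists g, h.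
  have n0 : (0 < n)%N by case: (n) g g0 {gE ug} => // g; rewrite det_mx00 ler10.
  (* If det g < 0, a sign change of the first coordinate on both sides corrects the determinant and
     leaves the diagonal blocks of the normal form as they are. *)
  pose i0 := Ordinal n0; pose d : 'rV[R]_n := \row_i (if i == i0 then -1 else 1).
  have d1 i : d 0 i ^+ 2 = 1 by rewrite mxE; case: ifP => _; rewrite ?sqrrN expr1n.
  have D1 : diag_mx d *m diag_mx d = 1%:M.
    by rewrite -[X in X *m _]mulmx1 diag_conj // => i j ij; rewrite mxE (negbTE ij).
  have [uD _] := mulmx1_unit D1.
  exists (diag_mx d *m g), (h *m diag_mx d); split.
  - rewrite det_mulmx det_diag (bigD1 i0) //= mxE eqxx big1 ?mulr1.
      by rewrite mulN1r oppr_gt0 lt_neqAle g0 andbT -unitfE -unitmxE.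
    by move=> i /negbTE ii; rewrite mxE ii.
  - by rewrite unitmx_mul uh.
  rewrite -dg_mul // !mulmxA -(mulmxA _ (dg g)) -(mulmxA _ _ h) gE.
  rewrite dg_mul_col mul_col_mx tr_diag_mx.
  have -> : invmx (diag_mx d) = diag_mx d.
    by rewrite -[LHS]mulmx1 -D1 mulKmx.
  by rewrite !diag_conj // => i j; rewrite mxE -?val_eqE => /negbTE ->.
move: an => /subnKC; set b := (n - a)%N => nE.
move: A C rE rcE lM pM; clearbody b; rewrite -{}nE => A C rE rcE lM pM.
have [L [h [S [uL uh sS NF]]]] := levi_form lM rE.
move: (NF); rewrite dg_mul_col mul_col_mx => /eq_col_mx[NF1 NF2].
have pS : pos_semidef S.
  have := psd_congr h pM.
  have -> : h^T *m (A^T *m C) *m h = block_mx S 0 0 0.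
    transitivity ((L *m A *m h)^T *m (invmx L^T *m C *m h)); last first.
      by rewrite NF1 NF2 tr_block_mx mulmx_block !mxsimp.
    by rewrite !trmx_mul !mulmxA mulmxK ?unitmx_tr.
  move/(psd_congr (col_mx 1%:M 0 : 'M[R]_(a + b, a))).
  by rewrite tr_col_mx mul_row_block !mxsimp mul_row_col !mxsimp.
have [N [r [uN ra NE]]] := psd_normal_form pS.
pose N' : 'M[R]_(a + b) := block_mx N 0 0 1%:M.
have uN' : N' \in unitmx by rewrite unitmxE det_ublock det1 mulr1 -unitmxE.
pose N'' : 'M[R]_(a + b) := block_mx (invmx N) 0 0 1%:M.
have N''E : N'' = invmx N'.
  rewrite -[RHS]mul1mx; have <- : N'' *m N' = 1%:M.
    by rewrite mulmx_block !mxsimp mulVmx // -scalar_mx_block.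
  by rewrite mulmxK.
exists (N'' *m L), (h *m N'), r; split=> //.
- by rewrite unitmx_mul uL N''E unitmx_inv uN'.
- by rewrite unitmx_mul uh.
rewrite -dg_mul ?N''E ?unitmx_inv // !mulmxA -(mulmxA _ (dg L)) -(mulmxA _ _ h) NF.
rewrite dg_mul_col mul_col_mx -N''E -trmx_inv N''E invmxK -N''E nfC_block //.
rewrite /N'' /N' tr_block_mx !mulmx_block !mxsimp mulVmx // NE pid_mx_block.
by [].
Qed.

End Orbits.

(** * Chevalley generators, words in the Weyl group, the torus *)

Section Generators.
Variable R : realType.

Lemma expmx_nil m (A : 'M[R]_m) : A *m A = 0 -> expmx A = 1%:M + A.
Proof.
move=> A2; rewrite /expmx; apply: cvg_lim; first exact: norm_hausdorff.
apply: cvg_near_cst; exists 2%N => // k /= k2.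
rewrite /series /= (big_cat_nat (n := 2)) //=.
rewrite big_ltn // big_ltn // big_geq // addr0 expr0 expr1.
rewrite -[1`!]/1%N -[0`!]/1%N !invr1 !scale1r.
rewrite big_nat_cond big1 ?addr0 // => i /andP[/andP[i2 _] _].
have -> : i = (2 + (i - 2))%N by lia.
by rewrite exprD expr2 -[A * A]/(A *m A) A2 mul0r scaler0.
Qed.

Variable n : nat.
Implicit Types i j : 'I_n.

Definition Umx i : 'M[R]_n := \matrix_(k, l) ((k == i :> nat) && (l == i.+1 :> nat))%:R.

Lemma Umx2 i : Umx i *m Umx i = 0.
Proof.
apply/matrixP => k l; rewrite !mxE big1 // => p _; rewrite !mxE -natrM.
by case: eqP => //=; case: eqP => //=; case: eqP => //=; lia.
Qed.

Lemma munit_block (a b : nat) (x y : bool) : (a < n)%N -> (b < n)%N ->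
  munit R n (if x then n + a else a) (if y then n + b else b) =
  let E : 'M[R]_n := \matrix_(k, l) ((k == a :> nat) && (l == b :> nat))%:R in
  block_mx (if ~~ x && ~~ y then E else 0) (if ~~ x && y then E else 0)
           (if x && ~~ y then E else 0) (if x && y then E else 0).
Proof.
move=> an bn /=; apply/matrixP => k l; rewrite !mxE.
case: splitP => k' /= ->; rewrite !mxE; case: splitP => l' /= ->;
  have := ltn_ord k'; have := ltn_ord l'; case: x; case: y; rewrite /= !mxE => h1 h2.
all: try by rewrite (_ : (_ && _) = false) //; lia.
all: by congr (_%:R); lia.
Qed.

Lemma chev_e_block i : chev_e R i =
  if (i.+1 < n)%N then block_mx (Umx i) 0 0 (- (Umx i)^T)
  else block_mx 0 (delta_mx i i) 0 0.
Proof.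
rewrite /chev_e; case: ifP => ni.
  rewrite (munit_block false false) // (munit_block true true) //=.
  rewrite opp_block_mx add_block_mx !subr0 !add0r; congr block_mx.
  by apply/matrixP => k l; rewrite !mxE andbC.
rewrite (munit_block false true) //=; congr block_mx.
by apply/matrixP => k l; rewrite !mxE.
Qed.

Lemma chev_e2 i : chev_e R i *m chev_e R i = 0.
Proof.
rewrite chev_e_block; case: ifP => _; rewrite mulmx_block !mxsimp.
  by rewrite -trmx_mul Umx2 trmx0 block_mx0.
by rewrite block_mx0.
Qed.

Lemma xgenE i a : xgen i a = 1%:M + a *: chev_e R i.
Proof.
by rewrite /xgen expmx_nil // -scalemxAl -scalemxAr chev_e2 !scaler0.
Qed.

Lemma ygenE i a : ygen i a = 1%:M + a *: chev_f R i.
Proof.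
rewrite /ygen expmx_nil // /chev_f -scalemxAl -scalemxAr -trmx_mul chev_e2.
by rewrite trmx0 !scaler0.
Qed.

Lemma xgen_block i a : xgen i a =
  if (i.+1 < n)%N then block_mx (1%:M + a *: Umx i) 0 0 (1%:M - a *: (Umx i)^T)
  else upp (a *: delta_mx i i).
Proof.
rewrite xgenE chev_e_block; case: ifP => _; rewrite scale_block_mx scalar_mx_block.
  by rewrite add_block_mx !scaler0 !addr0 scalerN.
by rewrite add_block_mx !scaler0 !addr0 add0r.
Qed.

Lemma ygen_block i a : ygen i a =
  if (i.+1 < n)%N then block_mx (1%:M + a *: (Umx i)^T) 0 0 (1%:M - a *: Umx i)
  else low (a *: delta_mx i i).
Proof.
rewrite ygenE /chev_f chev_e_block; case: ifP => _; rewrite tr_block_mx !trmx0.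
  rewrite linearN /= trmxK scale_block_mx scalar_mx_block.
  by rewrite add_block_mx !scaler0 !addr0 scalerN.
rewrite trmx_delta scale_block_mx scalar_mx_block.
by rewrite add_block_mx !scaler0 !addr0 add0r.
Qed.

Lemma Umx_inv i a : (1%:M + a *: Umx i) *m (1%:M - a *: Umx i) = 1%:M.
Proof.
rewrite mulmxDl mul1mx mulmxBr mulmx1 -scalemxAl -scalemxAr Umx2 !scaler0 subr0.
by rewrite subrK.
Qed.

Lemma Umx_invN i a : (1%:M - a *: Umx i) *m (1%:M + a *: Umx i) = 1%:M.
Proof. by have := Umx_inv i (- a); rewrite !scaleNr opprK. Qed.

Lemma Sp_xgen i (a : R) : Sp (xgen i a).
Proof.
rewrite xgen_block; case: ifP => _.
  apply: Sp_block; rewrite !mxsimp //.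
  transitivity (((1%:M - a *: Umx i) *m (1%:M + a *: Umx i))^T).
    by rewrite trmx_mul trmxB trmx1 trmxZ.
  by rewrite Umx_invN trmx1.
by apply: Sp_upp; rewrite trmxZ trmx_delta.
Qed.

Lemma Sp_ygen i (a : R) : Sp (ygen i a).
Proof.
rewrite ygen_block; case: ifP => _.
  apply: Sp_block; rewrite !mxsimp // trmxD trmx1 trmxZ trmxK.
  exact: Umx_inv.
by apply: Sp_low; rewrite trmxZ trmx_delta.
Qed.

Lemma Sp_sdot i : Sp (sdot R i).
Proof.
by apply: Sp_mul; [apply: Sp_mul; [exact: Sp_xgen | exact: Sp_ygen] | exact: Sp_xgen].
Qed.

Lemma word_dot_cons i s : word_dot R (i :: s) = sdot R i *m word_dot R s.
Proof. by rewrite /word_dot big_cons. Qed.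

Lemma Sp_word (s : seq 'I_n) : Sp (word_dot R s).
Proof.
elim: s => [|i s IHs]; first by rewrite /word_dot big_nil; exact: Sp1.
by rewrite word_dot_cons; apply: Sp_mul => //; exact: Sp_sdot.
Qed.

(** * Rows in the order e_1, ..., e_n, e_2n, ..., e_(n+1) *)

Section Rows.
Variable m : nat.
Implicit Types M : 'M[R]_(n + n, m).

(** The sum has one term, or none if [p] is out of range, so that rows can be indexed by natural
    numbers. *)
Definition rowat M (p : nat) l : R := \sum_(k < n + n | k == p :> nat) M k l.

Lemma rowat_ord M (k : 'I_(n + n)) l : rowat M k l = M k l.
Proof. exact: big_pred1_eq. Qed.

Lemma rowatD M N p l : rowat (M + N) p l = rowat M p l + rowat N p l.
Proof. by rewrite -big_split; apply: eq_bigr => k _; rewrite mxE. Qed.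

Lemma rowatZ c M p l : rowat (c *: M) p l = c * rowat M p l.
Proof. by rewrite mulr_sumr; apply: eq_bigr => k _; rewrite mxE. Qed.

Lemma rowatN M p l : rowat (- M) p l = - rowat M p l.
Proof. by rewrite -scaleN1r rowatZ mulN1r. Qed.

Lemma rowat_munit M a b p l : (a < n + n)%N ->
  rowat (munit R n a b *m M) p l = (p == a)%:R * rowat M b l.
Proof.
move=> an; have mE k : (munit R n a b *m M) k l = (k == a :> nat)%:R * rowat M b l.
  rewrite mxE mulr_sumr [RHS]big_mkcond; apply: eq_bigr => k' _; rewrite mxE.
  by case: (_ == a); case: (_ == b); rewrite /= ?mul1r ?mul0r.
rewrite /rowat (eq_bigr _ (fun k _ => mE k)).
have [->|pa] := eqVneq p a.
  by rewrite (big_pred1 (Ordinal an)) //= eqxx.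
by rewrite big1 ?mul0r // => k /eqP ->; rewrite (negbTE pa) mul0r.
Qed.

(** Passes from positions to row indices and back, being an involution. *)
Definition pos p : nat := if (p < n)%N then p else (n + (n + n - 1 - p))%N.

Lemma pos_lt p : (p < n + n)%N -> (pos p < n + n)%N.
Proof. by rewrite /pos; case: ifP; lia. Qed.

Lemma posK p : (p < n + n)%N -> pos (pos p) = p.
Proof.
move=> h; have [pn|np] := ltnP p n; first by rewrite /pos pn pn.
have -> : pos p = (n + (n + n - 1 - p))%N by rewrite /pos ltnNge np.
by rewrite /pos; case: ifP; lia.
Qed.

(** The positions [p] where x_i adds the row at [p.+1] to the row at [p]; the two coincide for the
    last generator. *)
Definition inJ (i p : nat) := (p == i) || (p == n + n - 2 - i)%N.

Variable d : nat -> R.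
Hypothesis d2 : forall k : nat, d k * d k = 1.

(** The alternating sign in the second half cancels the minus sign in [chev_e]; truncated
    subtraction makes the exponent zero in the first half. *)
Definition sgnpos p : R :=
  d (if (p < n)%N then p else n + n - 1 - p)%N * (-1) ^+ (p - n).

(* The entry of M in column l and the row at position p, with the sign making
   the generators of the pinning [eps] add positive multiples of rows. *)
Definition tl M p l := sgnpos p * rowat M (pos p) l.

(** The twist that gives a generator positive coefficients after conjugation by the signs [d]. *)
Definition eps (i : nat) := if (i.+1 < n)%N then d i * d i.+1 else 1.

Lemma tl_x i a M p l : (p < n + n)%N ->
  tl (xgen i (eps i * a) *m M) p l = tl M p l + (inJ i p)%:R * a * tl M p.+1 l.
Proof.
move=> pn; have iN := ltn_ord i.
rewrite xgenE mulmxDl mul1mx -scalemxAl /tl rowatD rowatZ mulrDr; congr (_ + _).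
rewrite /chev_e /eps; case: ifP => i1.
  rewrite mulmxBl rowatD rowatN !rowat_munit; try lia.
  rewrite /inJ; have [pE|pi] := eqVneq p i.
    rewrite /pos /sgnpos pE iN i1 eqxx; have -> : (i == (n + i.+1)%N :> nat) = false by lia.
    have -> : (i - n = 0)%N by lia. have -> : (i.+1 - n = 0)%N by lia.
    rewrite mul0r subr0 !expr0 !mulr1 !mul1r.
    have := d2 i; move: (d i) (d i.+1) => x y x2.
    by rewrite -!mulrA mulrA mulrA x2 mul1r !mulrA [y * a]mulrC.
  have -> : (pos p == i) = false by rewrite /pos; case: ifP; lia.
  rewrite mul0r sub0r /=; have [pE|pi'] := eqVneq p (n + n - 2 - i)%N; last first.
    have -> : (pos p == n + i.+1)%N = false by rewrite /pos; case: ifP; lia.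
    by rewrite !mul0r oppr0 !mulr0.
  rewrite {1}/pos /sgnpos; have -> : (p < n)%N = false by lia.
  have -> : (p.+1 < n)%N = false by lia.
  have -> : (n + (n + n - 1 - p) == n + i.+1)%N by lia.
  have -> : (n + n - 1 - p = i.+1)%N by lia.
  have -> : (n + n - 1 - p.+1 = i)%N by lia.
  have -> : pos p.+1 = (n + i)%N by rewrite /pos; case: ifP; lia.
  have -> : (p.+1 - n = (p - n).+1)%N by lia.
  rewrite exprS; have := d2 i.+1; move: (d i) (d i.+1) => x y y2.
  move: (rowat _ _ _) (_ ^+ _) => r s.
  have -> : y * s * (x * y * a * - (1 * r)) = - ((y * y) * (s * x * a * r)) by ring.
  by rewrite y2 -[true%:R]/(1 : R); ring.
rewrite rowat_munit; last by lia.
rewrite /inJ; have -> : (n + n - 2 - i = i)%N by lia.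
rewrite orbb; have [pE|pi] := eqVneq p i.
  rewrite /pos /sgnpos pE iN eqxx.
  have -> : (i.+1 < n)%N = false by lia.
  have -> : (n + n - 1 - i.+1 = i)%N by lia.
  have -> : (i - n = 0)%N by lia. have -> : (i.+1 - n = 0)%N by lia.
  ring.
have -> : (pos p == i) = false by rewrite /pos; case: ifP; lia.
by rewrite !mul0r !mulr0.
Qed.

Lemma tl_y i a M p l : (p < n + n)%N ->
  tl (ygen i (eps i * a) *m M) p l =
  tl M p l + ((0 < p)%N && inJ i p.-1)%:R * a * tl M p.-1 l.
Proof.
move=> pn; have iN := ltn_ord i.
rewrite ygenE mulmxDl mul1mx -scalemxAl /tl rowatD rowatZ mulrDr; congr (_ + _).
have tr_munit x y : (munit R n x y)^T = munit R n y x.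
  by apply/matrixP => k k'; rewrite !mxE andbC.
rewrite /chev_f /chev_e /eps; case: ifP => i1.
  rewrite trmxB !tr_munit mulmxBl rowatD rowatN !rowat_munit; try lia.
  rewrite /inJ; have [pE|pi] := eqVneq p i.+1.
    rewrite /pos /sgnpos pE /= iN i1 !eqxx.
    have -> : (i.+1 == (n + i)%N :> nat) = false by lia.
    have -> : (i - n = 0)%N by lia. have -> : (i.+1 - n = 0)%N by lia.
    rewrite mul0r subr0 !expr0 !mulr1 !mul1r.
    have := d2 i.+1; move: (d i) (d i.+1) (rowat _ _ _) => x y r y2.
    have -> : y * (x * y * a * r) = (y * y) * (a * (x * r)) by ring.
    by rewrite y2 mul1r.
  have -> : (pos p == i.+1) = false by rewrite /pos; case: ifP; lia.
  have -> : ((0 < p)%N && ((p.-1 == i) || (p.-1 == n + n - 2 - i)%N)) =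
      (p == n + n - 1 - i)%N by lia.
  rewrite mul0r sub0r; have [pE|pi'] := eqVneq p (n + n - 1 - i)%N; last first.
    have -> : (pos p == n + i)%N = false by rewrite /pos; case: ifP; lia.
    by rewrite !mul0r oppr0 !mulr0.
  rewrite {1}/pos /sgnpos; have -> : (p < n)%N = false by lia.
  have -> : (p.-1 < n)%N = false by lia.
  have -> : (n + (n + n - 1 - p) == n + i)%N by lia.
  have -> : (n + n - 1 - p = i)%N by lia.
  have -> : (n + n - 1 - p.-1 = i.+1)%N by lia.
  have -> : pos p.-1 = (n + i.+1)%N by rewrite /pos; case: ifP; lia.
  have -> : (p - n = (p.-1 - n).+1)%N by lia.
  rewrite exprS; have := d2 i; move: (d i) (d i.+1) => x y y2.
  move: (rowat _ _ _) (_ ^+ _) => r s.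
  have -> : x * (-1 * s) * (x * y * a * - (1 * r)) = ((x * x) * (s * y * a * r)) by ring.
  by rewrite y2 -[true%:R]/(1 : R); ring.
rewrite tr_munit rowat_munit; last by lia.
rewrite /inJ; have -> : (n + n - 2 - i = i)%N by lia.
rewrite orbb; have [pE|pi] := eqVneq p i.+1.
  rewrite /pos /sgnpos pE /= iN eqxx.
  have -> : (i.+1 < n)%N = false by lia.
  have -> : (n + n - 1 - i.+1 = i)%N by lia.
  have -> : (n + i == n + i)%N by [].
  have -> : (i - n = 0)%N by lia. have -> : (i.+1 - n = 0)%N by lia.
  ring.
have -> : (pos p == n + i)%N = false by rewrite /pos; case: ifP; lia.
have -> : (0 < p)%N && (p.-1 == i) = false by lia.
by rewrite !mul0r !mulr0.
Qed.

End Rows.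

Implicit Types s : seq 'I_n.

Section WordRows.
Variable m : nat.
Implicit Types M : 'M[R]_(n + n, m).

Lemma refl_inJ (i p : nat) : (i < n)%N -> (p < n + n)%N -> refl n i p =
  if inJ i p then p.+1 else if (0 < p)%N && inJ i p.-1 then p.-1 else p.
Proof.
rewrite /refl /inJ => iN pn.
have [->//|h1] := eqVneq p i; have [->|h2] := eqVneq p i.+1.
  have -> : (i.+1 == n + n - 2 - i)%N = false by lia.
  by rewrite /= eqxx.
have [->|h3] := eqVneq p (n + n - 1 - i)%N.
  have -> : (n + n - 1 - i == n + n - 2 - i)%N = false by lia.
  have -> : ((n + n - 1 - i).-1 == n + n - 2 - i)%N by lia.
  have -> : (0 < n + n - 1 - i)%N by lia.
  by rewrite orbT /=; lia.
have [->|h4] := eqVneq p (n + n - 2 - i)%N; first by rewrite /=; lia.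
have -> : (p.-1 == n + n - 2 - i)%N = false by lia.
case: p pn h1 h2 h3 h4 => [|p] //= pn h1 h2 h3 h4.
by have -> : (p == i) = false by lia.
Qed.

Let one (k : nat) : R := 1.
Let one2 k : one k * one k = 1. Proof. exact: mulr1. Qed.
Notation tl1 := (tl one).

Lemma eps_one i : eps one i = 1.
Proof. by rewrite /eps /one mulr1; case: ifP. Qed.

Lemma tl_sdot i M p l : (p < n + n)%N ->
  tl1 (sdot R i *m M) p l = (if inJ i p then -1 else 1) * tl1 M (refl n i p) l.
Proof.
move=> pn; have iN := ltn_ord i; rewrite refl_inJ // /sdot -!mulmxA.
have xE N q : (q < n + n)%N ->
    tl1 (xgen i (-1) *m N) q l = tl1 N q l - (inJ i q)%:R * tl1 N q.+1 l.
  move=> qn; have := @tl_x m one one2 i (-1) N q l qn.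
  by rewrite eps_one mul1r => ->; rewrite mulrN1 mulNr.
have yE N q : (q < n + n)%N ->
    tl1 (ygen i 1 *m N) q l =
    tl1 N q l + ((0 < q)%N && inJ i q.-1)%:R * tl1 N q.-1 l.
  move=> qn; have := @tl_y m one one2 i 1 N q l qn.
  by rewrite eps_one mul1r => ->; rewrite mulr1.
move: (xgen i (-1)) (ygen i 1) xE yE => X Y xE yE.
have [pJ|pJ] := boolP (inJ i p).
  have h : [/\ (p.+1 < n + n)%N, inJ i p.+1 = false & (0 < p)%N && inJ i p.-1 = false].
    by move: pJ; rewrite /inJ => pJ; split; lia.
  case: h => h1 h2 h3; have p1 : (p.-1 < n + n)%N by lia.
  rewrite (xE _ _ pn) (yE _ _ pn) (yE _ _ h1) (xE _ _ pn) (xE _ _ h1) (xE _ _ p1).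
  by rewrite /= pJ h2 h3 -[true%:R]/(1 : R) -[false%:R]/(0 : R); ring.
have [pJ'|pJ'] := boolP ((0 < p)%N && inJ i p.-1).
  have [p0 pJ2] := andP pJ'; have p1 : (p.-1 < n + n)%N by lia.
  have h : (0 < p.-1)%N && inJ i p.-2 = false.
    by move: pJ2; rewrite /inJ => ?; lia.
  rewrite (xE _ _ pn) (yE _ _ pn) (xE _ _ pn) (xE _ _ p1).
  rewrite pJ' (negbTE pJ) pJ2 prednK // -[true%:R]/(1 : R).
  by rewrite -[false%:R]/(0 : R); ring.
rewrite (xE _ _ pn) (negbTE pJ) mul0r subr0 (yE _ _ pn) (negbTE pJ') mul0r addr0.
by rewrite (xE _ _ pn) (negbTE pJ) mul0r subr0 mul1r.
Qed.

Lemma tl_word s M p l : (p < n + n)%N -> exists2 c : R, c ^+ 2 = 1 &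
  tl1 (word_dot R s *m M) p l = c * tl1 M (state s p) l.
Proof.
elim: s p => [|i s IHs] p pn.
  by exists 1; rewrite ?expr1n // /word_dot big_nil mul1mx mul1r.
have [c c1 cE] := IHs (refl n i p) (refl_lt (ltn_ord i) pn).
exists ((if inJ i p then -1 else 1) * c).
  by rewrite exprMn c1; case: ifP => _; rewrite ?sqrrN ?expr1n mulr1.
by rewrite word_dot_cons -mulmxA tl_sdot // cE mulrA.
Qed.

End WordRows.

Lemma pos_inj p q : (p < n + n)%N -> (q < n + n)%N -> pos p = pos q -> p = q.
Proof. by move=> pn qn h; rewrite -(posK pn) h posK. Qed.

Lemma word_dotE s (k l : 'I_(n + n)) : exists2 c : R, c ^+ 2 = 1 &
  word_dot R s k l = c * (l == pos (state s (pos k)) :> nat)%:R.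
Proof.
have kn := pos_lt (ltn_ord k).
have [c c1] := tl_word s 1%:M l kn; rewrite mulmx1 /tl posK // rowat_ord.
set q := state s (pos k); have qn : (q < n + n)%N by exact: state_lt.
have -> : rowat 1%:M (pos q) l = (l == pos q :> nat)%:R :> R.
  have := rowat_ord (1%:M : 'M[R]_(n + n)) (Ordinal (pos_lt qn)) l.
  by rewrite /= => ->; rewrite mxE eq_sym -val_eqE.
set t := sgnpos _ _; set u := sgnpos _ _ => cE.
have sq p : sgnpos (fun=> 1 : R) p ^+ 2 = 1.
  by rewrite /sgnpos mul1r -exprM mulnC exprM sqrrN expr1n expr1n.
have t1 : t ^+ 2 = 1 by exact: sq.
have u1 : u ^+ 2 = 1 by exact: sq.
clearbody t u.
exists (t * c * u); first by rewrite !exprMn t1 u1 c1 !mulr1.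
by rewrite -!mulrA -cE mulrA -expr2 t1 mul1r.
Qed.

Definition state_ord (s : seq 'I_n) (k : 'I_(n + n)) : 'I_(n + n) :=
  Ordinal (pos_lt (state_lt s (pos_lt (ltn_ord k)))).

Lemma state_ord_inj s : injective (state_ord s).
Proof.
move=> k l /(congr1 val) /= /pos_inj; rewrite !state_lt ?pos_lt // => /(_ isT isT).
by move=> /state_inj; rewrite !pos_lt // => /(_ isT isT) /pos_inj h; exact/val_inj/h.
Qed.

Lemma word_dot_val s (k l : 'I_(n + n)) : word_dot R s k l != 0 -> l = state_ord s k.
Proof.
have [c _ ->] := word_dotE s k l; case: (l =P pos (state s (pos k)) :> nat) => [h _|_].
  exact: val_inj.
by rewrite mulr0 eqxx.
Qed.

Lemma word_dot_sqr s (k : 'I_(n + n)) : word_dot R s k (state_ord s k) ^+ 2 = 1.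
Proof.
by have [c c1 ->] := word_dotE s k (state_ord s k); rewrite /= eqxx mulr1.
Qed.

Lemma word_dot_conj s (D : 'M[R]_(n + n)) (k l : 'I_(n + n)) :
  (word_dot R s *m D *m (word_dot R s)^T) k l =
  word_dot R s k (state_ord s k) * D (state_ord s k) (state_ord s l) *
  word_dot R s l (state_ord s l).
Proof.
rewrite mxE (bigD1 (state_ord s l)) //= big1 ?addr0 => [|j jl].
  rewrite !mxE (bigD1 (state_ord s k)) //= big1 ?addr0 // => j jk.
  have [->|/word_dot_val jE] := eqVneq (word_dot R s k j) 0; first by rewrite mul0r.
  by rewrite jE eqxx in jk.
rewrite [X in _ * X]mxE; have [->|/word_dot_val jE] := eqVneq (word_dot R s l j) 0.
  by rewrite mulr0.
by rewrite jE eqxx in jl.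
Qed.

Lemma word_dot_trK s : word_dot R s *m (word_dot R s)^T = 1%:M.
Proof.
apply/matrixP => k l; rewrite -[X in X *m _]mulmx1 word_dot_conj mxE.
rewrite (inj_eq (@state_ord_inj s)) mxE; have [->|_] := eqVneq k l.
  by rewrite mulr1 -expr2 word_dot_sqr.
by rewrite mulr0 mul0r.
Qed.

Lemma word_dot_inv s : invmx (word_dot R s) = (word_dot R s)^T.
Proof.
have [u _] := mulmx1_unit (word_dot_trK s).
by rewrite -[LHS]mulmx1 -(word_dot_trK s) mulKmx.
Qed.

(** * Cosets of the torus *)

Lemma diag_sp_mx (a : 'rV[R]_n) :
  diag_sp a = diag_mx (row_mx a (\row_i (a 0 i)^-1)).
Proof. by rewrite diag_mx_row. Qed.

(** Seen as the diagonal symplectic matrices, the torus is visibly stable under products and under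
    conjugation by words. *)
Lemma torus_diag (t : 'M[R]_(n + n)) :
  torus t <-> Sp t /\ forall k l, k != l -> t k l = 0.
Proof.
split=> [[a a0 ->]|[St t0]].
  split; last first.
    by move=> k l kl; rewrite diag_sp_mx mxE (negbTE kl) mulr0n.
  rewrite /diag_sp; have -> : diag_mx (\row_i (a 0 i)^-1) = invmx (diag_mx a)^T.
    have h : diag_mx a *m diag_mx (\row_i (a 0 i)^-1) = 1%:M.
      rewrite mulmx_diag -[1%:M]diag_const_mx; congr diag_mx.
      by apply/rowP => i; rewrite !mxE mulfV.
    have [u _] := mulmx1_unit h.
    by rewrite tr_diag_mx -[RHS]mulmx1 -h mulKmx.
  apply: Sp_dg; rewrite unitmxE det_diag unitfE; apply/prodf_neq0 => i _; exact: a0.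
have [ut h1 _ _] := St.
have dE (k : 'I_n) : t (lshift n k) (lshift n k) * t (rshift n k) (rshift n k) = 1.
  have /matrixP/(_ k k) := h1; rewrite !mxE eqxx (bigD1 k) //= !mxE.
  rewrite big1 ?addr0 => [|j jk]; last first.
    by rewrite !mxE t0 ?mul0r // -val_eqE /= val_eqE.
  rewrite [X in _ - X]big1 ?subr0 // => j _; rewrite !mxE t0 ?mul0r //.
  by rewrite -val_eqE /=; have := ltn_ord k; lia.
exists (\row_i t (lshift n i) (lshift n i)).
  move=> i; rewrite mxE; apply/eqP => z; move: (dE i); rewrite z mul0r.
  by move/eqP; rewrite eq_sym oner_eq0.
rewrite diag_sp_mx; apply/matrixP => k l; rewrite !mxE.
have [->|kl] := eqVneq k l; last by rewrite t0 // mulr0n.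
rewrite mulr1n; case: splitP => j jE; rewrite !mxE.
  by have -> : l = lshift n j by exact: val_inj.
have -> : l = rshift n j by exact: val_inj.
by rewrite -[LHS]mul1r -{1}(mulVf (x := t (lshift n j) (lshift n j))) -?mulrA ?dE ?mulr1 //;
  apply/eqP => z; move: (dE j); rewrite z mul0r => /eqP; rewrite eq_sym oner_eq0.
Qed.

Lemma torus_mul (t u : 'M[R]_(n + n)) : torus t -> torus u -> torus (t *m u).
Proof.
move=> /torus_diag[St t0] /torus_diag[Su u0]; apply/torus_diag; split.
  exact: Sp_mul.
move=> k l kl; rewrite mxE big1 // => j _; have [->|jk] := eqVneq j k.
  by rewrite u0 ?mulr0.
by rewrite t0 ?mul0r // eq_sym.
Qed.

Lemma torus_inv (t : 'M[R]_(n + n)) : torus t -> torus (invmx t).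
Proof.
move=> tT; have /torus_diag[St _] := tT; have [a a0 tE] := tT.
suff -> : invmx t = diag_sp (\row_i (a 0 i)^-1).
  by exists (\row_i (a 0 i)^-1) => // i; rewrite mxE invr_eq0.
rewrite -[LHS]mulmx1; have <- : t *m diag_sp (\row_i (a 0 i)^-1) = 1%:M.
  rewrite tE !diag_sp_mx mulmx_diag -[1%:M]diag_const_mx; congr diag_mx.
  apply/rowP => i; rewrite !mxE; case: splitP => j _; rewrite !mxE ?mulfV //.
  by rewrite invr_eq0.
by rewrite mulKmx ?(Sp_unit St).
Qed.

Lemma torus1 : torus (1%:M : 'M[R]_(n + n)).
Proof.
by apply/torus_diag; split=> [|k l kl]; [exact: Sp1 | rewrite mxE (negbTE kl)].
Qed.

Lemma word_torus s t : torus t -> torus (word_dot R s *m t *m (word_dot R s)^T).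
Proof.
move=> /torus_diag[St t0]; apply/torus_diag; split.
  rewrite -word_dot_inv; apply: Sp_mul; last exact/Sp_inv/Sp_word.
  by apply: Sp_mul => //; exact: Sp_word.
by move=> k l kl; rewrite word_dot_conj t0 ?mulr0 ?mul0r // (inj_eq (@state_ord_inj s)).
Qed.

Lemma word_torus' s t : torus t -> torus ((word_dot R s)^T *m t *m word_dot R s).
Proof.
move=> /torus_diag[St t0]; apply/torus_diag; split.
  rewrite -word_dot_inv; apply: Sp_mul; last exact: Sp_word.
  by apply: Sp_mul => //; exact/Sp_inv/Sp_word.
move=> k l; apply: contra_neqP => /eqP; rewrite mxE => h.
have [j] : exists j : 'I_(n + n), ((word_dot R s)^T *m t) k j * word_dot R s j l != 0.
  by apply/existsP; apply: contra_neqT h; rewrite negb_exists => /forallP h;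
     apply: big1 => j _; apply/eqP/negbNE/h.
rewrite mulf_eq0 negb_or mxE => /andP[h1 /word_dot_val lE].
have [p] : exists p : 'I_(n + n), (word_dot R s)^T k p * t p j != 0.
  by apply/existsP; apply: contra_neqT h1; rewrite negb_exists => /forallP h1;
     apply: big1 => p _; apply/eqP/negbNE/h1.
rewrite mulf_eq0 negb_or mxE => /andP[/word_dot_val kE tj].
by rewrite kE lE; congr state_ord; apply: contraNeq tj => pj; rewrite t0.
Qed.

Lemma word_normalizer s : normalizer_torus (word_dot R s).
Proof.
split; first exact: Sp_word.
rewrite word_dot_inv; apply/seteqP; split=> [_ [t tT <-]|t tT]; first exact: word_torus.
exists ((word_dot R s)^T *m t *m word_dot R s); first exact: word_torus'.
by rewrite !mulmxA word_dot_trK mul1mx -mulmxA word_dot_trK mulmx1.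
Qed.

Lemma weyl_word s : weyl (tcoset (word_dot R s)).
Proof. by exists (word_dot R s) => //; exact: word_normalizer. Qed.

Lemma tcoset_refl (g : 'M[R]_(n + n)) : tcoset g g.
Proof. by exists 1%:M; [exact: torus1 | rewrite mulmx1]. Qed.

(** The quotient of two signed permutation matrices is diagonal exactly when the permutations agree;
    this transfers the combinatorics of words to cosets. *)
Lemma state_coset s s' :
  tcoset (word_dot R s) (word_dot R s') <-> same_state s' s.
Proof.
have same_ord : same_state s' s <-> state_ord s' =1 state_ord s.
  split=> [h k|h r rn]; first by apply: val_inj; rewrite /= h // pos_lt.
  have := congr1 val (h (Ordinal (pos_lt rn))); rewrite /= posK //.
  by apply: pos_inj; exact: state_lt.
rewrite same_ord; split=> [[t /torus_diag[_ t0] tE] k|h].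
  have := word_dot_sqr s' k; rewrite -tE => /eqP; rewrite sqrf_eq1 mxE.
  have [/eqP|] := boolP (word_dot R s k (state_ord s' k) == 0).
    move=> z; rewrite big1 => [|j _]; first by rewrite eq_sym oner_eq0 eq_sym oppr_eq0 oner_eq0.
    have [->|jk] := eqVneq j (state_ord s' k); first by rewrite z mul0r.
    by rewrite t0 ?mulr0.
  by move=> /word_dot_val.
exists ((word_dot R s)^T *m word_dot R s'); last by rewrite mulmxA word_dot_trK mul1mx.
apply/torus_diag; split.
  by rewrite -word_dot_inv; apply: Sp_mul; [exact/Sp_inv/Sp_word | exact: Sp_word].
move=> k l; apply: contra_neqP => /eqP; rewrite mxE => z.
have [j] : exists j : 'I_(n + n), (word_dot R s)^T k j * word_dot R s' j l != 0.
  by apply/existsP; apply: contra_neqT z; rewrite negb_exists => /forallP z;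
     apply: big1 => j _; apply/eqP/negbNE/z.
by rewrite mulf_eq0 negb_or mxE => /andP[/word_dot_val -> /word_dot_val ->]; rewrite h.
Qed.

Lemma tcoset_eq (g h : 'M[R]_(n + n)) : tcoset g h -> tcoset g = tcoset h.
Proof.
move=> [t tT <-]; have /torus_diag[St _] := tT; have ut := Sp_unit St.
apply/seteqP; split=> [_ [u uT <-]|_ [u uT <-]].
  exists (invmx t *m u); first by apply: torus_mul => //; exact: torus_inv.
  by rewrite mulmxA mulmxK.
by exists (t *m u); [exact: torus_mul | rewrite mulmxA].
Qed.

Lemma reduced_word (w : set 'M[R]_(n + n)) s : weyl w -> reduced w s ->
  w = tcoset (word_dot R s) /\ red s.
Proof.
move=> [g _ <-] [ws min]; have wE := tcoset_eq ws; split=> // s' ss'.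
by apply: min; rewrite wE; exact/state_coset.
Qed.

Lemma red_reduced s : red s -> reduced (tcoset (word_dot R s)) s.
Proof.
move=> rs; split; first exact: tcoset_refl.
by move=> s' /state_coset/rs.
Qed.

Lemma wdot_word (w : set 'M[R]_(n + n)) : weyl w ->
  exists2 s, red s & wdot w = word_dot R s /\ wlength w = size s.
Proof.
move=> ww; rewrite /wdot /wlength.
have [[s rs]|no] := pselect (exists s, reduced w s).
  exists (xget [::] (reduced w)) => //.
  by have [] := reduced_word ww (xgetPex [::] (ex_intro _ s rs)).
(* Without an expression of [w], [xget] returns the empty word, both in [wdot] and in [wlength]. *)
exists [::]; first exact: red_nil.
by rewrite xgetPN // => s rs; apply: no; exists s.
Qed.

Lemma wlength_red s : red s -> wlength (tcoset (word_dot R s)) = size s.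
Proof.
move=> rs; have rw := red_reduced rs.
have [h1 h2] := xgetPex [::] (ex_intro _ s rw).
apply/eqP; rewrite eqn_leq; apply/andP; split; last by apply: rw.2.
by apply: h2; exact: tcoset_refl.
Qed.

End Generators.

(** * Coordinate Lagrangians of words and the ranks on Richardson pieces *)

Section WordFrames.
Variables (R : realType) (n : nat).
Implicit Types (i : 'I_n) (s : seq 'I_n) (S : pred 'I_n).
Local Notation msk S := (@msk R n S).

Lemma mskM S T : msk S *m msk T = msk (fun i => S i && T i).
Proof.
apply/matrixP => i j; rewrite msk_mul !mxE.
by case: (S i); rewrite ?mul1r ?mul0r //= andbF.
Qed.

Lemma msk_idem S : msk S *m msk S = msk S.
Proof. by rewrite mskM; apply/matrixP => i j; rewrite !mxE andbb. Qed.

Lemma rank_msk S : \rank (msk S) = #|S|.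
Proof.
pose B : 'M[R]_(#|S|, n) := rowsub (fun k : 'I_#|S| => enum_val k) 1%:M.
have BB : B *m B^T = 1%:M.
  apply/matrixP => k l; rewrite !mxE (bigD1 (enum_val k)) //= big1 => [|j jk].
    by rewrite !mxE eqxx mul1r addr0 eq_sym (inj_eq enum_val_inj).
  by rewrite !mxE eq_sym (negbTE jk) mul0r.
have BE : B^T *m B = msk S.
  apply/matrixP => k l; rewrite !mxE.
  have [Sk|Sk] := boolP (S k); last first.
    rewrite andbF big1 // => j _; rewrite !mxE; case: eqP => [jk|]; last by rewrite mul0r.
    by move: (enum_valP j) Sk; rewrite jk unfold_in => ->.
  have Sk' : k \in S by [].
  rewrite (bigD1 (enum_rank_in Sk' k)) //= big1 ?addr0 => [|j jk].
    by rewrite !mxE enum_rankK_in // eqxx mul1r andbT.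
  rewrite !mxE; case: eqP => [jE|]; last by rewrite mul0r.
  case/eqP: jk; apply: enum_val_inj; rewrite enum_rankK_in //.
apply/eqP; rewrite eqn_leq; apply/andP; split.
  by rewrite -BE (leq_trans (mxrankM_maxr _ _)) // rank_leq_row.
have e : B *m (B^T *m B) *m B^T = 1%:M by rewrite mulmxA BB mul1mx BB.
have <- : \rank (B *m (B^T *m B) *m B^T) = #|S| by rewrite e mxrank1.
rewrite BE; apply: leq_trans (mxrankM_maxl _ _) _; exact: mxrankM_maxr.
Qed.

(** The coordinate Lagrangian spanned by e_(n+i) for i in [S] and e_i for the other i. *)
Definition maskframe S : 'M[R]_(n + n, n) := col_mx (1%:M - msk S) (msk S).

Lemma det_Umx i (a : R) : \det (1%:M + a *: (Umx R i)^T) = 1.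
Proof.
rewrite det_trig.
  rewrite big1 // => k _; rewrite !mxE eqxx.
  have -> : (k == i :> nat) && (k == i.+1 :> nat) = false by lia.
  by rewrite mulr0 addr0.
apply/is_trig_mxP => k l kl; rewrite !mxE.
have -> : (l == i :> nat) && (k == i.+1 :> nat) = false by lia.
have -> : (k == l) = false by rewrite -val_eqE /=; lia.
by rewrite mulr0 addr0.
Qed.

Lemma det_Umx' i (a : R) : \det (1%:M + a *: Umx R i) = 1.
Proof. by rewrite -det_tr trmxD trmx1 trmxZ det_Umx. Qed.

Lemma word_dot1 i : word_dot R [:: i] = sdot R i.
Proof. by rewrite word_dot_cons /word_dot big_nil mulmx1. Qed.

Lemma flipped_cons i s (k l : 'I_n) : (l : nat) = refl n i k ->
  flipped (i :: s) k = flipped s l.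
Proof. by rewrite /flipped /= => ->. Qed.

Lemma pos_small p : (p < n)%N -> pos n p = p.
Proof. by rewrite /pos => ->. Qed.

Lemma pos_mirror p : (p < n)%N -> pos n (mirror n p) = (n + p)%N.
Proof. by rewrite /pos /mirror => pn; case: ifP; lia. Qed.

(** A quarter turn in the plane of the coordinates i and i + 1: it is orthogonal, so its inverse
    transpose, the second diagonal block, equals the first. *)
Lemma sdot_small i : (i.+1 < n)%N -> exists sg sg' : 'M[R]_n,
  [/\ sdot R i = block_mx sg 0 0 sg', \det sg = 1,
    forall k l, sg k l != 0 -> (l : nat) = refl n i k, sg = sg' &
    forall s, (sg *m msk (flipped s) = msk (flipped (i :: s)) *m sg)].
Proof.
move=> i1; pose sg := (1%:M - Umx R i) *m (1%:M + (Umx R i)^T) *m (1%:M - Umx R i).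
pose sg' := (1%:M + (Umx R i)^T) *m (1%:M - Umx R i) *m (1%:M + (Umx R i)^T).
have sE : sdot R i = block_mx sg 0 0 sg'.
  rewrite /sdot !xgen_block !ygen_block i1 !mulmx_block !mxsimp.
  by rewrite !scaleN1r !scale1r !opprK.
have UTU : Umx R i *m (Umx R i)^T *m Umx R i = Umx R i.
  apply/matrixP => k l; rewrite !mxE (bigD1 i) //= big1 => [|j /eqP ji].
    rewrite addr0 !mxE eqxx /= (bigD1 (Ordinal i1)) //= big1 => [|j /eqP ji].
      by rewrite !mxE !eqxx addr0 !andbT /= mulr1 -natrM mulnb.
    rewrite !mxE (_ : (j == i.+1 :> nat) = false) ?andbF ?mul0r //.
    by apply/eqP => h; apply: ji; exact: val_inj.
  rewrite mulrC !mxE (_ : (j == i :> nat) = false) ?mul0r //.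
  by apply/eqP => h; apply: ji; exact: val_inj.
have U2 := Umx2 R i.
have ssE : sg = sg'.
  rewrite /sg /sg'; move: U2 UTU; set U := Umx R i => U2 UTU.
  have U2' : U^T *m U^T = 0 by rewrite -trmx_mul U2 trmx0.
  have UTU' : U^T *m U *m U^T = U^T.
    by apply: trmx_inj; rewrite !trmx_mul !trmxK mulmxA.
  rewrite !(mulmxDl, mulmxDr, mulNmx, mulmxN, mul1mx, mulmx1) U2 U2' UTU UTU'.
  move: (U^T *m U) (U *m U^T) U^T => X Y V.
  by apply/matrixP => k l; rewrite !mxE; ring.
have sgE k l : sg k l != 0 -> (l : nat) = refl n i k.
  have <- : sdot R i (lshift n k) (lshift n l) = sg k l.
    by rewrite sE block_mxEul.
  rewrite -word_dot1 => /word_dot_val /(congr1 val) /= ->.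
  rewrite pos_small // pos_small // /refl; have := ltn_ord k.
  by do ?[case: ifP => ?]; lia.
have dsg : \det sg = 1.
  rewrite !det_mulmx -scaleN1r det_Umx' -[(Umx R i)^T]scale1r det_Umx.
  by rewrite !mulr1.
clearbody sg sg'; exists sg, sg'; split=> //.
move=> s; apply/matrixP => k l; rewrite msk_mul mxE (bigD1 l) //= !mxE eqxx /=.
rewrite big1 ?addr0 => [|j jl]; last by rewrite !mxE (negbTE jl) mulr0.
have [->|/sgE h] := eqVneq (sg k l) 0; first by rewrite mul0r mulr0.
by rewrite (flipped_cons s h) mulrC.
Qed.

(** The determinant 1 says that the extremal vectors carry no sign. The quarter turns have
    determinant 1, and in a reduced word the last reflection only meets an unflipped row, where it
    sends e_n to e_(2n) without sign. *)
Lemma word_frame s : red s -> exists2 h, \det h = 1 &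
  word_dot R s *m @frame0 R n = maskframe (flipped s) *m h.
Proof.
elim: s => [|i s IHs] rs.
  exists 1%:M; rewrite ?det1 // /word_dot big_nil mul1mx mulmx1 /maskframe.
  have -> : msk (fun i => @flipped n [::] i) = 0.
    apply/matrixP => k l; rewrite !mxE /flipped /= leqNgt ltn_ord.
    by rewrite andbF.
  by rewrite subr0.
have asc := red_asc rs; have [h dh hE] := IHs (red_tail rs).
have iN := ltn_ord i; rewrite word_dot_cons -mulmxA hE mulmxA.
have [i1|i1] := ltnP i.+1 n.
  have [sg [sg' [-> dsg _ <- mE]]] := sdot_small i1.
  exists (sg *m h); first by rewrite det_mulmx dsg dh mulr1.
  rewrite [RHS]mulmxA; congr (_ *m _).
  rewrite /maskframe mul_block_col mul_col_mx !mxsimp.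
  by rewrite mulmxBr mulmx1 mulmxBl mul1mx mE.
exists h => //; congr (_ *m _).
have i1E : (i.+1 < n)%N = false by lia.
rewrite /sdot !xgen_block !ygen_block i1E scale1r scaleN1r -!mulmxA /maskframe.
set m := msk (flipped s); set E := delta_mx i i.
(* The ascent at n - 1 compares the image of n - 1 with its own mirror image, so this image is below
   n. *)
have iF : flipped s i = false.
  move: asc; have -> : i.+1 = mirror n i by rewrite /mirror; lia.
  by rewrite state_mirror ?/flipped ?/mirror; lia.
have Em : E *m m = 0.
  apply/matrixP => k l; rewrite !mxE big1 // => j _; rewrite !mxE.
  have [->|_] := eqVneq j i; last by rewrite andbF mul0r.
  by rewrite iF andbF mulr0.
have EE : E *m E = E by rewrite mul_delta_mx.
have mS : msk (flipped (i :: s)) = m + E.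
  apply/matrixP => k l; rewrite !mxE.
  have [kE|ki] := eqVneq k i.
    rewrite kE iF andbF add0r eq_sym andbC /flipped /=.
    have -> : refl n i i = mirror n i by rewrite /refl /mirror eqxx; lia.
    rewrite state_mirror; last lia.
    have -> // : (n <= mirror n (state s i))%N.
    by move: iF; rewrite /flipped /mirror; lia.
  rewrite addr0 (@flipped_cons i s k k) //.
  by rewrite /refl; move: ki; rewrite -val_eqE /= => ki; have := ltn_ord k;
     do ?[case: ifP => ?]; lia.
rewrite upp_mul_col low_mul_col upp_mul_col mS.
rewrite !(mulNmx, mulmxN, mulmxDr, mulmxBr, mulmx1, mulmx0, Em, EE, oppr0, addr0, add0r, subr0).
by congr col_mx; [rewrite opprD addrA | rewrite addrC].
Qed.

Lemma card_flipped s : #|[pred i : 'I_n | flipped s i]| = nflip s.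
Proof.
rewrite /nflip -sum1_card -sum1_count big_mkcond /= [RHS]big_mkcond /=.
have -> : iota 0 n = index_iota 0 n by rewrite /index_iota subn0.
by rewrite big_mkord.
Qed.

Lemma det1_unit (h : 'M[R]_n) : \det h = 1 -> h \in unitmx.
Proof. by rewrite unitmxE => ->; exact: unitr1. Qed.

Lemma word_ranks s : red s ->
  \rank (usubmx (word_dot R s *m @frame0 R n)) = (n - nflip s)%N /\
  \rank (dsubmx (word_dot R s *m @frame0 R n)) = nflip s.
Proof.
move=> /word_frame[h dh ->]; have uh := det1_unit dh.
rewrite /maskframe mul_col_mx col_mxKu col_mxKd !mxrankMfree ?row_free_unit //.
rewrite mskC !rank_msk -[X in (n - X)%N]card_flipped -card_flipped; split=> //.
have := cardC [pred i : 'I_n | flipped s i]; rewrite card_ord => nE.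
by rewrite -[X in (X - _)%N]nE addKn; apply: eq_card.
Qed.

Lemma nflip_le s : (nflip s <= n)%N.
Proof. by rewrite -card_flipped -[X in (_ <= X)%N](card_ord n) max_card. Qed.

Lemma richardsonP (v w : set 'M[R]_(n + n)) sv sw x M :
  wdot v = word_dot R sv -> red sv -> wdot w = word_dot R sw -> red sw ->
  repr_by x M ->
  richardson v w x <->
  \rank (usubmx M) = (n - nflip sv)%N /\ \rank (dsubmx M) = nflip sw.
Proof.
move=> vE rv wE rw xM; rewrite /richardson vE wE.
have [h1 _] := word_ranks rv; have [_ h2] := word_ranks rw.
have e1 := dotPJ_minusP (Sp_word R sv) xM; rewrite h1 in e1.
have e2 := dotPJ_plusP (Sp_word R sw) xM; rewrite h2 in e2.
by split=> [[/e1 ? /e2 ?]|[/e1 ? /e2 ?]].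
Qed.

(** [bruhat] is witnessed by some reduced words and [wdot] defined by others; their numbers of flips
    agree because they represent the same element. *)
Lemma bruhat_words (v w : set 'M[R]_(n + n)) : weyl v -> weyl w -> bruhat v w ->
  exists sv sw, [/\ wdot v = word_dot R sv, red sv, wdot w = word_dot R sw, red sw
    & (nflip sv <= nflip sw)%N].
Proof.
move=> wv ww [s [s' [rv rw ss']]].
have [vE rs] := reduced_word wv rv; have [wE rs'] := reduced_word ww rw.
have nE (u : set 'M[R]_(n + n)) t : weyl u -> reduced u t -> exists st, [/\ wdot u = word_dot R st, red st
    & nflip st = nflip t].
  move=> wu ru; have ru' := xgetPex [::] (ex_intro _ t ru).
  exists (xget [::] (reduced u)); split=> //.
    by have [] := reduced_word wu ru'.
  apply: eq_nflip; apply/(@state_coset R n).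
  by have [uE _] := reduced_word wu ru; rewrite -uE; have [] := ru'.
have [sv [h1 h2 h3]] := nE _ _ wv rv; have [sw [h4 h5 h6]] := nE _ _ ww rw.
by exists sv, sw; split=> //; rewrite h3 h6; exact: nflip_subseq.
Qed.

Lemma bruhat_ex j k : (j <= k)%N -> (k <= n)%N ->
  exists v w : set 'M[R]_(n + n), [/\ weyl v, weyl w, bruhat v w &
    exists sv sw, [/\ wdot v = word_dot R sv, red sv, wdot w = word_dot R sw, red sw
    & nflip sv = j /\ nflip sw = k]].
Proof.
move=> jk kn; have [s [s' [rs rs' ss' sj sk]]] := red_pair_ex jk kn.
exists (tcoset (word_dot R s)), (tcoset (word_dot R s')).
have wdE (t : seq 'I_n) : red t -> exists st, [/\ wdot (tcoset (word_dot R t)) = word_dot R st, red st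
    & nflip st = nflip t].
  move=> rt; have ru := red_reduced R rt; have wu := weyl_word R t.
  have ru' := xgetPex [::] (ex_intro _ t ru).
  exists (xget [::] (reduced (tcoset (word_dot R t)))); split=> //.
    by have [] := reduced_word wu ru'.
  by apply: eq_nflip; apply/(@state_coset R n); have [] := ru'.
split; [exact: weyl_word | exact: weyl_word | | ].
  by exists s, s'; split=> //; exact: red_reduced.
have [sv [h1 h2 h3]] := wdE _ rs; have [sw [h4 h5 h6]] := wdE _ rs'.
by exists sv, sw; split=> //; rewrite h3 h6.
Qed.

End WordFrames.

(** * Continuity of matrix functions, entry by entry *)

Section EntrywiseContinuity.
Variables (R : realType) (T : topologicalType) (x : T).

Definition ctsr (f : T -> R) := f y @[y --> x] --> f x.

(** Entrywise continuity at the fixed point [x], stable under all matrix operations;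
    [ctsmx_continuous] returns to the topology of matrices. *)
Definition ctsmx m n (f : T -> 'M[R]_(m, n)) :=
  forall i j, ctsr (fun y => f y i j).

Lemma ctsr_cst c : ctsr (fun=> c). Proof. exact: cvg_cst. Qed.

Lemma ctsrD f g : ctsr f -> ctsr g -> ctsr (fun y => f y + g y).
Proof. exact: cvgD. Qed.

Lemma ctsrM f g : ctsr f -> ctsr g -> ctsr (fun y => f y * g y).
Proof. exact: cvgM. Qed.

Lemma ctsrN f : ctsr f -> ctsr (fun y => - f y).
Proof. exact: cvgN. Qed.

Lemma ctsrV f : f x != 0 -> ctsr f -> ctsr (fun y => (f y)^-1).
Proof. exact: cvgV. Qed.

Lemma ctsr_sum I (r : seq I) (P : pred I) (F : I -> T -> R) :
  (forall i, ctsr (F i)) -> ctsr (fun y => \sum_(i <- r | P i) F i y).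
Proof.
move=> h; elim: r => [|i r IHr]; rewrite /ctsr.
  by under eq_cvg do rewrite big_nil; rewrite big_nil; exact: cvg_cst.
under eq_cvg do rewrite big_cons; rewrite big_cons.
by case: (P i) => //; apply: cvgD => //; exact: h.
Qed.

Lemma ctsr_prod I (r : seq I) (P : pred I) (F : I -> T -> R) :
  (forall i, ctsr (F i)) -> ctsr (fun y => \prod_(i <- r | P i) F i y).
Proof.
move=> h; elim: r => [|i r IHr]; rewrite /ctsr.
  by under eq_cvg do rewrite big_nil; rewrite big_nil; exact: cvg_cst.
under eq_cvg do rewrite big_cons; rewrite big_cons.
by case: (P i) => //; apply: cvgM => //; exact: h.
Qed.

Lemma eq_ctsr f g : f =1 g -> ctsr f -> ctsr g.
Proof. by move=> /funext ->. Qed.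

Lemma eq_ctsmx m n (f g : T -> 'M[R]_(m, n)) : f =1 g -> ctsmx f -> ctsmx g.
Proof. by move=> /funext ->. Qed.

Lemma ctsmx_cst m n (A : 'M[R]_(m, n)) : ctsmx (fun=> A).
Proof. by move=> i j; exact: ctsr_cst. Qed.

Lemma ctsmxD m n (f g : T -> 'M[R]_(m, n)) :
  ctsmx f -> ctsmx g -> ctsmx (fun y => f y + g y).
Proof.
move=> cf cg i j; apply: (@eq_ctsr (fun y => f y i j + g y i j)).
  by move=> y; rewrite mxE.
exact: ctsrD.
Qed.

Lemma ctsmxN m n (f : T -> 'M[R]_(m, n)) : ctsmx f -> ctsmx (fun y => - f y).
Proof.
move=> cf i j; apply: (@eq_ctsr (fun y => - f y i j)); first by move=> y; rewrite mxE.
exact: ctsrN.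
Qed.

Lemma ctsmxB m n (f g : T -> 'M[R]_(m, n)) :
  ctsmx f -> ctsmx g -> ctsmx (fun y => f y - g y).
Proof. by move=> cf cg; apply: ctsmxD => //; exact: ctsmxN. Qed.

Lemma ctsmxZ m n (a : T -> R) (f : T -> 'M[R]_(m, n)) :
  ctsr a -> ctsmx f -> ctsmx (fun y => a y *: f y).
Proof.
move=> ca cf i j; apply: (@eq_ctsr (fun y => a y * f y i j)).
  by move=> y; rewrite mxE.
exact: ctsrM.
Qed.

Lemma ctsmxM m n p (f : T -> 'M[R]_(m, n)) (g : T -> 'M[R]_(n, p)) :
  ctsmx f -> ctsmx g -> ctsmx (fun y => f y *m g y).
Proof.
move=> cf cg i j; apply: (@eq_ctsr (fun y => \sum_k f y i k * g y k j)).
  by move=> y; rewrite mxE.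
by apply: ctsr_sum => k; exact: ctsrM.
Qed.

Lemma ctsmx_tr m n (f : T -> 'M[R]_(m, n)) : ctsmx f -> ctsmx (fun y => (f y)^T).
Proof.
move=> cf i j; apply: (@eq_ctsr (fun y => f y j i)); first by move=> y; rewrite mxE.
exact: cf.
Qed.

Lemma ctsmx_col m1 m2 n (f : T -> 'M[R]_(m1, n)) (g : T -> 'M[R]_(m2, n)) :
  ctsmx f -> ctsmx g -> ctsmx (fun y => col_mx (f y) (g y)).
Proof.
move=> cf cg i j.
apply: (@eq_ctsr (fun y => match fintype.split i with inl k => f y k j | inr k => g y k j end)).
  by move=> y; rewrite mxE.
by case: fintype.split => k; [exact: cf | exact: cg].
Qed.

Lemma ctsmx_row m n1 n2 (f : T -> 'M[R]_(m, n1)) (g : T -> 'M[R]_(m, n2)) :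
  ctsmx f -> ctsmx g -> ctsmx (fun y => row_mx (f y) (g y)).
Proof.
move=> cf cg i j.
apply: (@eq_ctsr (fun y => match fintype.split j with inl k => f y i k | inr k => g y i k end)).
  by move=> y; rewrite mxE.
by case: fintype.split => k; [exact: cf | exact: cg].
Qed.

Lemma ctsmx_block m1 m2 n1 n2 (f : T -> 'M[R]_(m1, n1)) (g : T -> 'M[R]_(m1, n2))
    (h : T -> 'M[R]_(m2, n1)) (k : T -> 'M[R]_(m2, n2)) :
  ctsmx f -> ctsmx g -> ctsmx h -> ctsmx k ->
  ctsmx (fun y => block_mx (f y) (g y) (h y) (k y)).
Proof. by move=> *; apply: ctsmx_col; exact: ctsmx_row. Qed.

Lemma ctsmx_usub m1 m2 n (f : T -> 'M[R]_(m1 + m2, n)) :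
  ctsmx f -> ctsmx (fun y => usubmx (f y)).
Proof.
move=> cf i j; apply: (@eq_ctsr (fun y => f y (lshift m2 i) j)).
  by move=> y; rewrite mxE.
exact: cf.
Qed.

Lemma ctsmx_dsub m1 m2 n (f : T -> 'M[R]_(m1 + m2, n)) :
  ctsmx f -> ctsmx (fun y => dsubmx (f y)).
Proof.
move=> cf i j; apply: (@eq_ctsr (fun y => f y (rshift m1 i) j)).
  by move=> y; rewrite mxE.
exact: cf.
Qed.

Lemma ctsr_det n (f : T -> 'M[R]_n) : ctsmx f -> ctsr (fun y => \det (f y)).
Proof.
move=> cf; rewrite /determinant; apply: ctsr_sum => s; apply: ctsrM.
  exact: ctsr_cst.
by apply: ctsr_prod => i; exact: cf.
Qed.

Lemma ctsmx_adj n (f : T -> 'M[R]_n) : ctsmx f -> ctsmx (fun y => \adj (f y)).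
Proof.
move=> cf i j; apply: (@eq_ctsr (fun y => (-1) ^+ (j + i) * \det (row' j (col' i (f y))))).
  by move=> y; rewrite mxE.
apply: ctsrM; first exact: ctsr_cst.
apply: ctsr_det => k l; apply: (@eq_ctsr (fun y => f y (lift j k) (lift i l))).
  by move=> y; rewrite !mxE.
exact: cf.
Qed.

Lemma ctsmx_continuous m n (f : T -> 'M[R]_(m, n)) :
  ctsmx f -> f y @[y --> x] --> f x.
Proof.
move=> cf; apply/cvg_ballP => e e0.
have h i j : \forall y \near x, ball (f x i j) e (f y i j).
  by have /cvg_ballP/(_ e e0) := cf i j.
have {}h : \forall y \near x, forall i j, ball (f x i j) e (f y i j).
  have h1 : \forall y \near x, forall i : 'I_m, forall j, ball (f x i j) e (f y i j).
    apply: filter_forall => i; apply: filter_forall => j; exact: h.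
  exact: h1.
by apply: filterS h => y hy; split.
Qed.

Lemma ctsmx_invmx n (f : T -> 'M[R]_n) : (forall y, f y \in unitmx) ->
  ctsmx f -> ctsmx (fun y => invmx (f y)).
Proof.
move=> uf cf; apply: (@eq_ctsmx _ _ (fun y => (\det (f y))^-1 *: \adj (f y))).
  by move=> y; rewrite /invmx uf.
apply: ctsmxZ; last exact: ctsmx_adj.
by apply: ctsrV; [rewrite -unitfE -unitmxE | exact: ctsr_det].
Qed.

End EntrywiseContinuity.

Lemma ctsmx_id (R : realType) m n (M : 'M[R]_(m, n)) : ctsmx M id.
Proof. by move=> i j; exact: coord_continuous. Qed.

(** * Open sets, closed sets and continuous maps in terms of frames *)

Section LagrangianTopology.
Variables (R : realType) (n : nat).
Local Notation F := 'M[R]_(n + n, n).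
Local Notation L := (lagr R n).

(** Invariance under change of frame makes the preimage in the space of Lagrangian frames the trace
    of the open set [P]. *)
Lemma lagr_open (P : F -> Prop) :
  (forall M, P M -> \forall N \near M, P N) ->
  (forall M h, lag_frame M -> h \in unitmx -> P M -> P (M *m h)) ->
  open [set x : L | exists2 M, repr_by x M & P M].
Proof.
move=> oP hP.
have oP' : open [set M | P M] by rewrite openE => M; exact: oP.
rewrite /open /= /quotient_open.
rewrite (_ : _ @^-1` _ =
    (set_val : set_type (@lag_frame R n) -> F) @^-1` [set M | P M]).
  by exists [set M | P M].
apply/seteqP; split=> f /=.
  move=> [M xM PM].
  have xf : repr_by (\pi_(L) f)%qT (\val f) by exists f.
  have [h uh vE] := (repr_eqP xM xf).1 erefl.
  by rewrite set_valE vE; apply: hP => //; exact: repr_lag xM.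
by move=> Pf; exists (\val f) => //; exists f.
Qed.

Lemma lagr_closed (P : F -> Prop) :
  (forall M, ~ P M -> \forall N \near M, ~ P N) ->
  (forall M h, lag_frame M -> h \in unitmx -> P M -> P (M *m h)) ->
  closed [set x : L | exists2 M, repr_by x M & P M].
Proof.
move=> oP hP; rewrite -openC.
have -> : ~` [set x : L | exists2 M, repr_by x M & P M] =
    [set x : L | exists2 M, repr_by x M & ~ P M].
  apply/seteqP; split=> x /=.
    move=> no; have [M xM] := ex_repr x; exists M => // PM; apply: no.
    by exists M.
  move=> [M xM nPM] [N xN PN]; apply: nPM.
  have [h uh ->] := (repr_eqP xN xM).1 erefl; apply: hP => //.
  exact: repr_lag xN.
apply: lagr_open => // M h lM uh nPM PMh; apply: nPM.
by rewrite -[M](mulmxK uh); apply: hP; rewrite ?unitmx_inv //; exact: lag_mulr.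
Qed.

Lemma lagr_continuous_in (T : topologicalType) (f : T -> F) (g : T -> L) :
  (forall t, repr_by (g t) (f t)) -> (forall t, ctsmx t f) -> continuous g.
Proof.
move=> gf cf; pose k t : set_type (@lag_frame R n) :=
  exist _ (f t) (mem_set (repr_lag (gf t))).
have gE : g = (\pi_(L))%qT \o k.
  apply/funext => t; apply: (repr_inj (gf t)).
  by exists (k t).
have ck : continuous k.
  apply: continuous_comp_initial => t; apply: ctsmx_continuous; exact: cf.
rewrite gE => t; apply: continuous_comp; first exact: ck.
exact: pi_continuous.
Qed.

(** The neighbourhood of [x] is cut out on frames by [P] and by [phi] having values in the interior
    of the target; both conditions are open and unchanged by a change of frame. *)
Lemma lagr_continuous_out (Z : topologicalType) (phi : F -> Z) (P : F -> Prop)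
    (g : L -> Z) x :
  (forall M, P M -> \forall N \near M, P N) ->
  (forall M h, lag_frame M -> h \in unitmx -> P M -> P (M *m h)) ->
  (forall M, P M -> phi N @[N --> M] --> phi M) ->
  (forall y M, repr_by y M -> P M -> g y = phi M) ->
  (forall M, repr_by x M -> P M) ->
  g y @[y --> x] --> g x.
Proof.
move=> oP hP cphi gphi xP A nA.
have [M0 xM0] := ex_repr x; have PM0 := xP _ xM0.
have gE : g x = phi M0 by exact: gphi.
pose Q N := P N /\ A^° (phi N).
have oQ M : Q M -> \forall N \near M, Q N.
  move=> [PM AM]; have PN := oP _ PM.
  have := cphi _ PM (A^°) _; rewrite /= => /(_ (open_nbhs_nbhs _)) h.
  apply: filterS2 PN (h _); last by split => //; exact: open_interior.
  by move=> N PN AN; split.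
pose W : set L := [set y | exists2 M, repr_by y M & Q M].
have phiM M h : lag_frame M -> h \in unitmx -> P M -> phi (M *m h) = phi M.
  move=> lM uh PM; have [y yM] := repr_ex lM.
  rewrite -(gphi y M) // -(gphi y (M *m h)) //; first exact: repr_mulr.
  exact: hP.
have oW : open W.
  apply: lagr_open => // M h lM uh [PM AM]; split; first exact: hP.
  by rewrite phiM.
have Wx : W x by exists M0 => //; split=> //; rewrite -gE.
rewrite nbhs_filterE /=; apply: filterS (open_nbhs_nbhs (conj oW Wx)).
move=> y [M yM [PM AM]] /=; rewrite (gphi _ _ yM PM).
exact: interior_subset AM.
Qed.

Lemma curve_closure (A : set L) (c : R -> L) : continuous c ->
  (forall d, 0 < d -> exists2 t, `|t| < d & A (c t)) -> closure A (c 0).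
Proof.
move=> cc h B nB; have /nbhs_ballP[d /= d0 dB] := cc 0 B nB.
have [t td At] := h d d0; exists (c t); split=> //.
by apply: dB; rewrite /ball /= sub0r normrN.
Qed.

Lemma connected_curve (Y : set L) (c : R -> L) a b : continuous c ->
  (forall t, Y (c t)) -> connected_component Y (c a) (c b).
Proof.
move=> cc Yc; exists (range c); last by exists b.
split; [by exists a | by move=> _ [t _ <-] | ].
apply: connected_continuous_connected; last exact: continuous_subspaceT.
by apply/connected_intervalP => ? ? _ _ z _.
Qed.

End LagrangianTopology.

(** * The nonnegative part: closure, Levi orbits and connected components *)

Section NonnegativePart.
Variables (R : realType) (n : nat).
Local Notation F := 'M[R]_(n + n, n).
Local Notation L := (lagr R n).
Implicit Types (M N : F) (x y : L).

Definition gram M : 'M[R]_n := (usubmx M)^T *m dsubmx M.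

Lemma gram_col (A C : 'M[R]_n) : gram (col_mx A C) = A^T *m C.
Proof. by rewrite /gram col_mxKu col_mxKd. Qed.

Lemma gram_mulr M h : gram (M *m h) = h^T *m gram M *m h.
Proof. by rewrite /gram -mul_usub_mx -mul_dsub_mx trmx_mul !mulmxA. Qed.

Lemma gram_sym M : lag_frame M -> (gram M)^T = gram M.
Proof. by move=> [_ sM]; rewrite /gram trmx_mul trmxK sM. Qed.

Lemma lagr_nnegP x M : repr_by x M ->
  @lagr_nneg R n x <-> pos_semidef (gram M).
Proof.
move=> xM; split=> [[A [C [pAC xAC]]]|pM].
  have [h uh ->] := (repr_eqP xAC xM).1 erefl.
  by rewrite gram_mulr gram_col; exact: psd_congr.
by exists (usubmx M), (dsubmx M); split=> //; rewrite vsubmxK.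
Qed.

Lemma lagr_posP x M : repr_by x M -> @lagr_pos R n x <-> pos_def (gram M).
Proof.
move=> xM; split=> [[C pC xC]|pM].
  have [h uh ->] := (repr_eqP xC xM).1 erefl.
  by rewrite gram_mulr gram_col trmx1 mul1mx; apply/pos_def_congr_unit.
have uA : usubmx M \in unitmx.
  have := pos_def_unit pM; rewrite unitmxE det_mulmx unitrM det_tr -unitmxE.
  by case/andP.
have ME : M *m invmx (usubmx M) = col_mx 1%:M (dsubmx M *m invmx (usubmx M)).
  by rewrite -{1}[M]vsubmxK mul_col_mx mulmxV.
exists (dsubmx M *m invmx (usubmx M)); last first.
  by rewrite -ME; apply: repr_mulr => //; rewrite unitmx_inv.
have uV : invmx (usubmx M) \in unitmx by rewrite unitmx_inv.
have := (pos_def_congr_unit (gram M) uV).2 pM.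
by rewrite -gram_mulr ME gram_col trmx1 mul1mx.
Qed.

Lemma ctsmx_gram (T : topologicalType) (t : T) (f : T -> F) :
  ctsmx t f -> ctsmx t (fun z => gram (f z)).
Proof.
move=> cf; apply: ctsmxM; last exact: ctsmx_dsub.
by apply: ctsmx_tr; exact: ctsmx_usub.
Qed.

Lemma ctsr_qf (T : topologicalType) (t : T) (f : T -> 'M[R]_n) u :
  ctsmx t f -> ctsr t (fun z => qf (f z) u).
Proof.
move=> cf; rewrite /qf; apply: (@ctsmxM R T t _ _ _ (fun z => u^T *m f z) (fun=> u)).
  by apply: ctsmxM => //; exact: ctsmx_cst.
exact: ctsmx_cst.
Qed.

Lemma near_gt0 (T : topologicalType) (t : T) (f : T -> R) :
  ctsr t f -> 0 < f t -> \forall y \near t, 0 < f y.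
Proof.
move=> cf f0; have /cvgrPdist_lt/(_ _ f0) := cf; apply: filterS => y.
by rewrite ltr_distlC subrr => /andP[].
Qed.

Lemma lagr_nneg_closed : closed (@lagr_nneg R n).
Proof.
rewrite (_ : @lagr_nneg R n = [set x | exists2 M, repr_by x M &
    forall u, 0 <= qf (gram M) u]); last first.
  apply/seteqP; split=> x /=.
    have [M xM] := ex_repr x => /(lagr_nnegP xM) pM; exists M => // u.
    exact: psd_qf.
  move=> [M xM pM]; apply/(lagr_nnegP xM); split; last by move=> u; exact: pM.
  exact/gram_sym/(repr_lag xM).
apply: lagr_closed => [M|M h lM uh pM u]; last by rewrite gram_mulr qf_congr.
move=> /existsNP[u /negP]; rewrite -ltNge -oppr_gt0 => h.
have c : ctsr M (fun N => - qf (gram N) u).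
  by apply: ctsrN; apply: ctsr_qf; apply: ctsmx_gram; exact: ctsmx_id.
apply: filterS (near_gt0 c h) => N hN /(_ u).
by rewrite oppr_gt0 in hN; rewrite leNgt hN.
Qed.

(** * The curve [A + t C; C + t (A + t C)] enters the positive part *)

Definition pushM M (t : R) : F :=
  col_mx (usubmx M + t *: dsubmx M)
         (dsubmx M + t *: (usubmx M + t *: dsubmx M)).

Lemma pushME M t : pushM M t = low t%:M *m (upp t%:M *m M).
Proof.
rewrite -[M in RHS]vsubmxK upp_mul_col low_mul_col !mul_scalar_mx /pushM.
by congr col_mx; rewrite addrC.
Qed.

Lemma push_lag M t : lag_frame M -> lag_frame (pushM M t).
Proof.
move=> lM; rewrite pushME; apply: lag_mul; last apply: lag_mul => //.
  by apply: Sp_low; rewrite tr_scalar_mx.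
by apply: Sp_upp; rewrite tr_scalar_mx.
Qed.

Lemma pushM0 M : pushM M 0 = M.
Proof. by rewrite /pushM !scale0r !addr0 vsubmxK. Qed.

Lemma ctsmx_push M (t : R) : ctsmx t (pushM M).
Proof.
have c1 : ctsmx t (fun t => usubmx M + t *: dsubmx M).
  apply: ctsmxD; first exact: ctsmx_cst.
  by apply: ctsmxZ; [exact: cvg_id | exact: ctsmx_cst].
apply: ctsmx_col => //; apply: ctsmxD; first exact: ctsmx_cst.
by apply: ctsmxZ => //; exact: cvg_id.
Qed.

(** If (A + t C) u = 0 then u^T A^T C u = - t |C u|^2, so semidefiniteness gives C u = 0, then A u =
    0, and the frame is injective. *)
Lemma push_unit M t : lag_frame M -> pos_semidef (gram M) -> 0 < t ->
  usubmx M + t *: dsubmx M \in unitmx.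
Proof.
move=> lM pM t0; apply: inj_unitmx => u /eqP.
rewrite mulmxDl addr_eq0 -scalemxAl => /eqP Au.
have := psd_qf u pM; rewrite /gram /qf -!mulmxA mulmxA -trmx_mul Au.
rewrite -scaleNr trmxZ -scalemxAl scalemxE mulNr oppr_ge0 pmulr_rle0 // => h.
have Cu : dsubmx M *m u = 0.
  by apply: nsq_eq0; apply/eqP; rewrite eq_le h nsq_ge0.
move: lM; rewrite -[M]vsubmxK => /lag_frameP[_ iM]; apply: iM => //.
by rewrite Au Cu scaler0 oppr0.
Qed.

(** The terms added are t times Gram matrices, and the last one is definite as soon as A + t C is
    invertible. *)
Lemma gram_push M t : gram (pushM M t) =
  gram M + t *: ((dsubmx M)^T *m dsubmx M) +
  t *: ((usubmx M + t *: dsubmx M)^T *m (usubmx M + t *: dsubmx M)).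
Proof.
rewrite /pushM gram_col mulmxDr -scalemxAr; congr (_ + _).
by rewrite trmxD mulmxDl trmxZ -scalemxAl.
Qed.

Lemma push_pos M t : lag_frame M -> pos_semidef (gram M) -> 0 < t ->
  pos_def (gram (pushM M t)).
Proof.
move=> lM pM t0; rewrite gram_push; apply: psd_pos_defD.
  by apply: psdD => //; apply: psdZ; [exact: ltW | exact: psd_gram].
apply: pos_defZ => //; have uA := push_unit lM pM t0.
rewrite -[X in X *m _]mulmx1; exact/(pos_def_congr_unit _ uA)/pos_def1.
Qed.

Lemma lagr_pos_sub : @lagr_pos R n `<=` @lagr_nneg R n.
Proof.
move=> x; have [M xM] := ex_repr x => /(lagr_posP xM)/pos_def_psd.
by move/(lagr_nnegP xM).
Qed.

Lemma closure_lagr_pos : closure (@lagr_pos R n) = @lagr_nneg R n.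
Proof.
apply/seteqP; split.
  rewrite [X in _ `<=` X]((closure_id _).1 lagr_nneg_closed).
  exact: closureS lagr_pos_sub.
move=> x; have [M xM] := ex_repr x => /(lagr_nnegP xM) pM.
have lM := repr_lag xM.
pose c t := mkl (push_lag t lM).
have cM t : repr_by (c t) (pushM M t) by exact: repr_mkl.
have -> : x = c 0 by apply: (repr_inj xM); have := cM 0; rewrite pushM0.
apply: curve_closure.
  by apply: (lagr_continuous_in cM) => t; exact: ctsmx_push.
move=> d d0; exists (d / 2).
  by rewrite gtr0_norm ?divr_gt0 // ltr_pdivrMr // ltr_pMr // ltr1n.
by apply/(lagr_posP (cM _)); apply: push_pos => //; rewrite divr_gt0.
Qed.

(** * Orbits of the Levi subgroup *)

Lemma det_gt0_unit m (g : 'M[R]_m) : 0 < \det g -> g \in unitmx.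
Proof. by move=> h; rewrite unitmxE unitfE gt_eqF. Qed.

Lemma gram_dg g M : g \in unitmx -> gram (dg g *m M) = gram M.
Proof.
move=> ug; rewrite -[M]vsubmxK dg_mul_col !gram_col trmx_mul -mulmxA.
by rewrite mulKVmx ?unitmx_tr.
Qed.

Lemma ranks_dg g M : g \in unitmx ->
  \rank (usubmx (dg g *m M)) = \rank (usubmx M) /\
  \rank (dsubmx (dg g *m M)) = \rank (dsubmx M).
Proof.
move=> ug; rewrite -{1 3}[M]vsubmxK dg_mul_col col_mxKu col_mxKd.
by rewrite !(eqmxMfull _ _) ?row_full_unit ?unitmx_inv ?unitmx_tr.
Qed.

Lemma ranks_mulr M h : h \in unitmx ->
  \rank (usubmx (M *m h)) = \rank (usubmx M) /\
  \rank (dsubmx (M *m h)) = \rank (dsubmx M).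
Proof.
by move=> uh; rewrite -mul_usub_mx -mul_dsub_mx !mxrankMfree ?row_free_unit.
Qed.

Lemma LJ0_orbitP x y M N : repr_by x M -> repr_by y N ->
  @lagr_nneg R n x -> (LJ0_orbit x y <->
  [/\ @lagr_nneg R n y, \rank (usubmx N) = \rank (usubmx M) &
      \rank (dsubmx N) = \rank (dsubmx M)]).
Proof.
move=> xM yN xP; have pM := (lagr_nnegP xM).1 xP.
split=> [[l [M' [[g dg0 ->] xM' yM']]]|[yP rA rC]].
  have ug := det_gt0_unit dg0; rewrite -/(dg g) in yM'.
  have [h uh ME] := (repr_eqP xM' xM).1 erefl.
  have [k uk NE] := (repr_eqP yM' yN).1 erefl.
  have [r1 r2] := ranks_dg M' ug.
  have [r3 r4] := ranks_mulr (dg g *m M') uk.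
  have [r5 r6] := ranks_mulr M' uh.
  rewrite NE ME r3 r4 r1 r2 r5 r6; split=> //.
  by apply/(lagr_nnegP yM'); rewrite gram_dg //; exact/(lagr_nnegP xM').
have pN := (lagr_nnegP yN).1 yP.
have lM := repr_lag xM; have lN := repr_lag yN.
have nf K : lag_frame K -> pos_semidef (gram K) -> exists g h,
    [/\ 0 < \det g, h \in unitmx & dg g *m K *m h =
      col_mx (pid_mx (\rank (usubmx K))) (nfC R n (\rank (usubmx K))
        (\rank (usubmx K) + \rank (dsubmx K) - n))].
  move=> lK pK; rewrite -{1}[K]vsubmxK in lK.
  have [_ [g [h [g0 uh E]]]] := psd_levi_form lK pK.
  by exists g, h; rewrite vsubmxK in E.
have [g1 [h1 [g10 uh1 E1]]] := nf _ lM pM.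
have [g2 [h2 [g20 uh2 E2]]] := nf _ lN pN.
have ug1 := det_gt0_unit g10; have ug2 := det_gt0_unit g20.
exists (dg (invmx g2 *m g1)), (M *m (h1 *m invmx h2)); split.
- by exists (invmx g2 *m g1) => //; rewrite det_mulmx det_inv mulr_gt0 // invr_gt0.
- by apply: repr_mulr => //; rewrite unitmx_mul uh1 unitmx_inv.
- have -> : dg (invmx g2 *m g1) *m (M *m (h1 *m invmx h2)) = N => //.
  rewrite -dg_mul ?unitmx_inv //.
  transitivity (dg (invmx g2) *m (dg g1 *m M *m h1) *m invmx h2).
    by rewrite !mulmxA.
  rewrite E1 -rA -rC -E2 !mulmxA mulmxK // dg_mul ?unitmx_inv // mulVmx //.
  by rewrite /dg trmx1 invmx1 -scalar_mx_block mul1mx.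
Qed.

Lemma LJ0_orbit_richardson v w sv sw x :
  wdot v = word_dot R sv -> red sv -> wdot w = word_dot R sw -> red sw ->
  @lagr_nneg R n x -> richardson v w x ->
  LJ0_orbit x = @lagr_nneg R n `&` richardson v w.
Proof.
move=> vE rv wE rw xP; have [M xM] := ex_repr x.
move=> /(richardsonP vE rv wE rw xM)[r1 r2].
apply/seteqP; split=> y; have [N yN] := ex_repr y.
  move=> /(LJ0_orbitP xM yN xP)[yP e1 e2]; split=> //.
  by apply/(richardsonP vE rv wE rw yN); rewrite e1 e2.
move=> [yP /(richardsonP vE rv wE rw yN)[e1 e2]].
by apply/(LJ0_orbitP xM yN xP); rewrite e1 e2.
Qed.

Lemma nneg_richardson_ex v w sv sw :
  wdot v = word_dot R sv -> red sv -> wdot w = word_dot R sw -> red sw ->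
  (nflip sv <= nflip sw)%N ->
  exists2 x, @lagr_nneg R n x & richardson v w x.
Proof.
move=> vE rv wE rw le; have wn := nflip_le sw; have vn := nflip_le sv.
(* The normal form with parameters a and r has ranks a and r + n - a, which have to be n - nflip sv
   and nflip sw. *)
pose a := (n - nflip sv)%N; pose r := (nflip sw - nflip sv)%N.
have ra : (r <= a)%N by rewrite /r /a; lia.
have an : (a <= n)%N by rewrite /a; lia.
have lM := lag_nf R ra an; have [x xM] := repr_ex lM; exists x.
  by apply/(lagr_nnegP xM); rewrite gram_col pid_nfC //; exact: psd_pid.
apply/(richardsonP vE rv wE rw xM); rewrite col_mxKu col_mxKd.
by rewrite rank_pid_mx // rank_nfC // /r /a; split=> //; lia.
Qed.

Lemma richardson_ranks x M : repr_by x M -> @lagr_nneg R n x ->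
  (n <= \rank (usubmx M) + \rank (dsubmx M))%N.
Proof.
move=> xM /(lagr_nnegP xM) pM; have lM := repr_lag xM.
by rewrite -{1}[M]vsubmxK in lM; have [] := psd_levi_form lM pM.
Qed.

Lemma LJ0_orbits : [set LJ0_orbit x | x in @lagr_nneg R n] =
  [set X | exists v w : set 'M[R]_(n + n),
    [/\ weyl v, weyl w, bruhat v w & X = @lagr_nneg R n `&` richardson v w]].
Proof.
apply/seteqP; split=> X /=.
  move=> [x xP <-]; have [M xM] := ex_repr x; have ge := richardson_ranks xM xP.
  have le1 := rank_leq_row (usubmx M); have le2 := rank_leq_row (dsubmx M).
  (* The inequality n <= rank A + rank C is what v <= w requires of the two numbers of flips. *)
  have jk : (n - \rank (usubmx M) <= \rank (dsubmx M))%N by lia.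
  have [v [w [wv ww vw [sv [sw [vE rv wE rw [e1 e2]]]]]]] := bruhat_ex R jk le2.
  exists v, w; split=> //; apply: (LJ0_orbit_richardson vE rv wE rw xP).
  by apply/(richardsonP vE rv wE rw xM); rewrite e1 e2; split=> //; lia.
move=> [v [w [wv ww vw ->]]].
have [sv [sw [vE rv wE rw le]]] := bruhat_words wv ww vw.
have [x xP xR] := nneg_richardson_ex vE rv wE rw le.
by exists x => //; exact: (LJ0_orbit_richardson vE rv wE rw xP xR).
Qed.

(** * Each piece is a connected component of its Richardson variety *)

(** The row vectors killed by A^T and those killed by C^T meet in 0 only, as the frame is injective,
    and all are killed by A^T C; count dimensions. *)
Lemma gram_rank_le M : lag_frame M ->
  (\rank (gram M) + n <= \rank (usubmx M) + \rank (dsubmx M))%N.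
Proof.
move=> lM; have sM := gram_sym lM.
move: lM sM; rewrite /gram; set A := usubmx M; set C := dsubmx M => lM sM.
have [sAC iM] : A^T *m C = C^T *m A /\ forall u : 'cV[R]_n, A *m u = 0 -> C *m u = 0 -> u = 0.
  by apply/lag_frameP; rewrite vsubmxK.
have kA : (kermx A^T <= kermx (A^T *m C))%MS.
  by apply/sub_kermxP; rewrite mulmxA mulmx_ker mul0mx.
have kC : (kermx C^T <= kermx (A^T *m C))%MS.
  by apply/sub_kermxP; rewrite sAC mulmxA mulmx_ker mul0mx.
have cap0 : (kermx A^T :&: kermx C^T)%MS = 0.
  apply/eqP; rewrite -submx0; apply/rV_subP => u; rewrite sub_capmx submx0.
  move=> /andP[/sub_kermxP uA /sub_kermxP uC]; apply/eqP/trmx_inj.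
  rewrite trmx0; apply: iM; apply: trmx_inj; rewrite trmx_mul trmxK trmx0 //.
have := mxrankS (_ : (kermx A^T + kermx C^T <= kermx (A^T *m C))%MS).
rewrite addsmx_sub kA kC => /(_ isT).
rewrite mxrank_disjoint_sum // !mxrank_ker !mxrank_tr.
have := rank_leq_row A; have := rank_leq_row C; have := rank_leq_row (A^T *m C).
lia.
Qed.

(* If V^t Q V is positive definite of size at least rank Q, then Q vanishes on
   a complement of the range of V. *)
Lemma psd_of_minor m r (Q : 'M[R]_m) (V : 'M[R]_(m, r)) : Q^T = Q ->
  (\rank Q <= r)%N -> pos_def (V^T *m Q *m V) -> pos_semidef Q.
Proof.
move=> sQ rQ pV; split=> // u; rewrite -/(qf Q u).
have uP := pos_def_unit pV; set P := _ *m V in pV uP.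
have rP : \rank P = r by apply/eqP; rewrite -[_ == _]/(row_free P) row_free_unit.
have sub : (Q <= V^T *m Q)%MS.
  have h : (V^T *m Q <= Q)%MS by exact: submxMl.
  have h1 : (\rank (V^T *m Q) <= \rank Q)%N by exact: mxrankS.
  have h2 : (r <= \rank (V^T *m Q))%N 
    by have := mxrankM_maxl (V^T *m Q) V; rewrite -/P rP.
  by rewrite -(mxrank_leqif_sup h).2 eqn_leq h1 (leq_trans rQ).
have /submxP[Y YE] := sub.
pose a := invmx P *m (V^T *m Q *m u); pose z := u - V *m a.
have Qz : Q *m z = 0.
  rewrite YE -mulmxA /z mulmxBr (mulmxA (V^T *m Q)) -/P /a mulKVmx //.
  by rewrite subrr mulmx0.
have -> : u = V *m a + z by rewrite /z addrC subrK.
rewrite qf_bilin // -(mulmxA z^T).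
have -> : z^T *m (Q *m (V *m a)) = (Q *m z)^T *m (V *m a).
  by rewrite trmx_mul sQ mulmxA.
rewrite Qz trmx0 mul0mx [X in X *+ 2]mxE mul0rn addr0.
have -> : qf Q z = 0 by rewrite /qf -mulmxA Qz mulmx0 mxE.
by rewrite addr0 -qf_congr; apply: psd_qf; exact: pos_def_psd.
Qed.

(** Sylvester's criterion turns definiteness into finitely many strict inequalities on continuous
    functions. *)
Lemma near_pos_def (T : topologicalType) (t : T) r (f : T -> 'M[R]_r) :
  ctsmx t f -> (forall z, (f z)^T = f z) -> pos_def (f t) ->
  \forall z \near t, pos_def (f z).
Proof.
move=> cf sf pf.
have h : \forall z \near t, forall S : {ffun 'I_r -> bool}, 0 < pminor S (f z).
  apply: filter_forall => S; apply: near_gt0; last exact: (sylvester (sf t)).1.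
  apply: ctsr_det; apply: ctsmxD; first exact: ctsmx_cst.
  by apply: ctsmxM => //; exact: ctsmx_cst.
apply: filterS h => z hz; apply/(sylvester (sf z)) => S.
have := hz [ffun i => S i]; rewrite /pminor (@eq_plu R r _ S) // => i.
by rewrite ffunE.
Qed.

Lemma pid_minor a r : (r <= a)%N ->
  exists V : 'M[R]_(a, r), V^T *m pid_mx r *m V = 1%:M.
Proof.
move=> ra; exists (pid_mx r); rewrite tr_pid_mx !mul_pid_mx.
have -> : minn a (minn (minn a (minn r r)) r) = r by lia.
by rewrite pid_mx_1.
Qed.

Lemma nneg_open_in_stratum ra rc : exists2 O : set L, open O &
  forall x M, repr_by x M -> \rank (usubmx M) = ra -> \rank (dsubmx M) = rc ->
    O x <-> @lagr_nneg R n x.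
Proof.
pose r := (ra + rc - n)%N.
(* Matrices near a frame need not be Lagrangian, so the form is symmetrised before definiteness is
   imposed on it. *)
pose symg M : 'M[R]_n := 2^-1 *: (gram M + (gram M)^T).
have symgE M : lag_frame M -> symg M = gram M.
  move=> lM; rewrite /symg gram_sym //; apply/matrixP => i j; rewrite !mxE.
  by field.
have symgS M : (symg M)^T = symg M by rewrite /symg trmxZ trmxD trmxK addrC.
pose P M := exists V : 'M[R]_(n, r), pos_def (V^T *m symg M *m V).
exists [set x | exists2 M, repr_by x M & P M].
  apply: lagr_open => [M [V pV]|M h lM uh [V pV]]; last first.
    exists (invmx h *m V); rewrite symgE ?gram_mulr; last exact: lag_mulr.
    rewrite -[X in pos_def X](_ : V^T *m symg M *m V = _) // symgE //.
    by rewrite -congr_mul mulKVmx.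
  have c : ctsmx M (fun N => V^T *m symg N *m V).
    apply: ctsmxM; last exact: ctsmx_cst.
    apply: ctsmxM; first exact: ctsmx_cst.
    apply: ctsmxZ; first exact: ctsr_cst.
    by apply: ctsmxD; [|apply: ctsmx_tr]; apply: ctsmx_gram; exact: ctsmx_id.
  have := near_pos_def c _ pV; move=> /(_ _) h; apply: filterS (h _).
    by move=> N pN; exists V.
  by move=> N; rewrite !trmx_mul trmxK symgS mulmxA.
move=> x M xM rA rC; have lM := repr_lag xM; split.
  move=> [N xN [V pV]]; apply/(lagr_nnegP xN); have lN := repr_lag xN.
  rewrite symgE // in pV; apply: psd_of_minor pV; first exact: gram_sym.
  have := gram_rank_le lN.
  have [h uh NE] := (repr_eqP xM xN).1 erefl.
  by have := ranks_mulr M uh; rewrite -NE rA rC /r => -[-> ->]; lia.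
move=> /(lagr_nnegP xM) pM; exists M => //.
rewrite -[M]vsubmxK in lM; have [ge [g [h [g0 uh E]]]] := psd_levi_form lM pM.
rewrite vsubmxK rA rC in ge E lM.
have ug := det_gt0_unit g0.
have gE : h^T *m gram M *m h = pid_mx r.
  rewrite -(gram_dg M ug) -gram_mulr E gram_col pid_nfC //.
  by have := rank_leq_row (dsubmx M); rewrite rC; lia.
have rn : (r <= n)%N.
  by have := rank_leq_row (dsubmx M); have := rank_leq_row (usubmx M); rewrite rA rC /r; lia.
have [V VE] := pid_minor rn.
exists (h *m V); rewrite symgE // congr_mul gE VE; exact: pos_def1.
Qed.

(** The curve is defined on the whole line because [connected_curve] uses the range of such a
    curve. *)
Definition gl_curve m (A : 'M[R]_m) := exists c : R -> 'M[R]_m,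
  [/\ forall t : R, ctsmx t c, c 0 = 1%:M, c 1 = A & forall t, 0 < \det (c t)].

Lemma gl_curve_mul m (A B : 'M[R]_m) : gl_curve A -> gl_curve B -> gl_curve (A *m B).
Proof.
move=> [c [c1 c2 c3 c4]] [d [d1 d2 d3 d4]]; exists (fun t => c t *m d t).
split; rewrite ?c2 ?d2 ?mulmx1 ?c3 ?d3 // => t; first exact: ctsmxM.
by rewrite det_mulmx mulr_gt0.
Qed.

Lemma gl_curve_inv m (A : 'M[R]_m) : gl_curve A -> gl_curve (invmx A).
Proof.
move=> [c [c1 c2 c3 c4]]; exists (fun t => invmx (c t)).
split; rewrite ?c2 ?c3 ?invmx1 // => t; last by rewrite det_inv invr_gt0.
by apply: ctsmx_invmx => // z; exact: det_gt0_unit.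
Qed.

Lemma ctsr_id (t : R) : ctsr t id. Proof. exact: cvg_id. Qed.

Lemma gl_curve_upp m p (b : 'M[R]_(m, p)) : gl_curve (block_mx 1%:M b 0 1%:M).
Proof.
exists (fun t => block_mx 1%:M (t *: b) 0 1%:M); split.
- move=> t; apply: ctsmx_block; try exact: ctsmx_cst.
  by apply: ctsmxZ; [exact: ctsr_id | exact: ctsmx_cst].
- by rewrite scale0r -scalar_mx_block.
- by rewrite scale1r.
- by move=> t; rewrite det_ublock !det1 mulr1.
Qed.

Lemma gl_curve_low m p (b : 'M[R]_(p, m)) : gl_curve (block_mx 1%:M 0 b 1%:M).
Proof.
exists (fun t => block_mx 1%:M 0 (t *: b) 1%:M); split.
- move=> t; apply: ctsmx_block; try exact: ctsmx_cst.
  by apply: ctsmxZ; [exact: ctsr_id | exact: ctsmx_cst].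
- by rewrite scale0r -scalar_mx_block.
- by rewrite scale1r.
- by move=> t; rewrite det_lblock !det1 mulr1.
Qed.

Lemma gl_curve_diag m p (A : 'M[R]_m) (B : 'M[R]_p) :
  gl_curve A -> gl_curve B -> gl_curve (block_mx A 0 0 B).
Proof.
move=> [c [c1 c2 c3 c4]] [d [d1 d2 d3 d4]].
exists (fun t => block_mx (c t) 0 0 (d t)); split.
- by move=> t; apply: ctsmx_block => //; exact: ctsmx_cst.
- by rewrite c2 d2 -scalar_mx_block.
- by rewrite c3 d3.
- by move=> t; rewrite det_ublock mulr_gt0.
Qed.

Lemma gl_curve1 m : gl_curve (1%:M : 'M[R]_m).
Proof.
by exists (fun=> 1%:M); split=> // t; [exact: ctsmx_cst | rewrite det1].
Qed.

Lemma gl_curve_scalar (a : 'M[R]_1) : 0 < a 0 0 -> gl_curve a.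
Proof.
move=> a0; exists (fun t => (expR (t * ln (a 0 0)))%:M); split.
- move=> t i j; apply: (@eq_ctsr R R t (fun z => expR (z * ln (a 0 0)))).
    by move=> z; rewrite mxE !ord1 mulr1n.
  have c : ctsr t (fun z : R => z * ln (a 0 0)).
    by apply: ctsrM; [exact: ctsr_id | exact: ctsr_cst].
  exact: (continuous_comp c (@continuous_expR R _)).
- by rewrite mul0r expR0.
- by rewrite mul1r lnK // [RHS]mx11_scalar.
- by move=> t; rewrite det_scalar1 expR_gt0.
Qed.

(** Elimination by unipotent matrices, each joined to the identity by scaling its off-diagonal
    block. A nonzero entry under the corner lets the corner be made 1, after which the smaller block
    has the determinant of [A]. *)
Lemma gl_plus_curve m (A : 'M[R]_m) : 0 < \det A -> gl_curve A.
Proof.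
elim: m A => [|m IHm] A.
  by move=> _; rewrite [A](_ : A = 1%:M); [exact: gl_curve1 | apply/matrixP => -[]].
move: A; rewrite -[m.+1]/(1 + m)%N => A.
have divl (E B : 'M[R]_(1 + m)) : gl_curve E -> \det E = 1 -> gl_curve (E *m B) -> gl_curve B.
  move=> cE dE cEB; have uE : E \in unitmx by exact: det1_unit.
  by rewrite -[B](mulKmx uE); apply: gl_curve_mul => //; exact: gl_curve_inv.
have main (B : 'M[R]_(1 + m)) : 0 < \det B -> dlsubmx B != 0 -> gl_curve B.
  rewrite -{1 3}[B]submxK; set a := ulsubmx B; set b := ursubmx B.
  set c := dlsubmx B; set D := drsubmx B => dB c0.
  clearbody a b c D.
  have [i ci] : exists i, c i 0 != 0.
    apply/existsP; apply: contraNT c0; rewrite negb_exists => /forallP h.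
    by apply/eqP/matrixP => i j; rewrite ord1 [RHS]mxE; apply/eqP/negbNE/h.
  (* Chosen so that the new corner [a + r *m c] is 1. *)
  pose r : 'rV[R]_m := ((1 - a 0 0) / c i 0) *: delta_mx 0 i.
  have rc : a + r *m c = 1%:M.
    apply/matrixP => k l; rewrite !ord1 /r -scalemxAl -rowE !mxE divfK //.
    by rewrite addrC subrK.
  apply: (divl (block_mx 1%:M r 0 1%:M)); first exact: gl_curve_upp.
    by rewrite det_ublock !det1 mulr1.
  have dE1 : \det (block_mx 1%:M r 0 1%:M *m block_mx a b c D) = \det (block_mx a b c D).
    by rewrite det_mulmx det_ublock !det1 !mul1r.
  move: dE1; rewrite mulmx_block !mxsimp rc; set b' := b + _ => dE1.
  apply: (divl (block_mx 1%:M 0 (- c) 1%:M)); first exact: gl_curve_low.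
    by rewrite det_lblock !det1 mulr1.
  have dE2 : \det (block_mx 1%:M 0 (- c) 1%:M *m block_mx 1%:M b' c D) = \det (block_mx a b c D).
    by rewrite det_mulmx det_lblock !det1 !mul1r dE1.
  move: dE2; rewrite mulmx_block !mxsimp addNr; set D' := _ + D => dE2.
  rewrite det_ublock det1 mul1r in dE2.
  have -> : block_mx 1%:M b' 0 D' = block_mx 1%:M 0 0 D' *m block_mx 1%:M b' 0 1%:M.
    by rewrite mulmx_block !mxsimp.
  apply: gl_curve_mul; last exact: gl_curve_upp.
  by apply: gl_curve_diag; [exact: gl_curve1 | apply: IHm; rewrite dE2].
move=> dA; have [c0|/main] := eqVneq (dlsubmx A) 0; last exact.
case: m A IHm divl main dA c0 => [|m] A IHm divl main dA c0.
  have -> : A = block_mx (ulsubmx A) 0 0 1%:M.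
    by rewrite -{1}[A]submxK; congr block_mx; apply/matrixP; (try by case=> [[]]); move=> k; case=> [[]].
  apply: gl_curve_diag; last exact: gl_curve1.
  apply: gl_curve_scalar; move: dA; rewrite -[A]submxK c0 det_ublock.
  by rewrite [\det (drsubmx _)]det_mx00 mulr1 {1}(mx11_scalar (ulsubmx A)) det_scalar1 block_mxKul.
(* Below the corner the column is zero, so the corner is not, as det A > 0; adding the first row to
   the second copies it below. *)
pose e : 'cV[R]_(m.+1) := delta_mx 0 0.
apply: (divl (block_mx 1%:M 0 e 1%:M)); first exact: gl_curve_low.
  by rewrite det_lblock !det1 mulr1.
apply: main; first by rewrite det_mulmx det_lblock !det1 !mul1r.
rewrite -[A]submxK c0 mulmx_block !mxsimp block_mxKdl.
move: dA; rewrite -{1}[A]submxK c0 det_ublock (mx11_scalar (ulsubmx A)) det_scalar1.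
set a := ulsubmx A 0 0 => dA; apply/eqP => /matrixP/(_ 0 0).
rewrite mul_mx_scalar !mxE !eqxx mulr1 => a0.
by move: dA; rewrite a0 mul0r ltxx.
Qed.

Lemma richardson_component (v w : set 'M[R]_(n + n)) :
  weyl v -> weyl w -> bruhat v w ->
  is_component (@lagr_nneg R n `&` richardson v w) (richardson v w).
Proof.
move=> wv ww vw.
have [sv [sw [vE rv wE rw le]]] := bruhat_words wv ww vw.
have [x0 x0P x0R] := nneg_richardson_ex vE rv wE rw le.
exists x0 => //; have [M xM] := ex_repr x0; have lM := repr_lag xM.
have [r1 r2] := (richardsonP vE rv wE rw xM).1 x0R.
apply/seteqP; split.
  rewrite -(LJ0_orbit_richardson vE rv wE rw x0P x0R) => y [l [M' [[g g0 ->] xM' yM']]].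
  have lM' := repr_lag xM'.
  have [c [c1 c2 c3 c4]] := gl_plus_curve g0.
  have uc t := det_gt0_unit (c4 t).
  pose f t := mkl (lag_mul (Sp_dg (uc t)) lM').
  have fM t : repr_by (f t) (dg (c t) *m M') by exact: repr_mkl.
  have f0 : f 0 = x0.
    apply: repr_inj xM'; have := fM 0; rewrite c2.
    by rewrite /dg trmx1 invmx1 -scalar_mx_block mul1mx.
  have f1 : f 1 = y by apply: repr_inj yM'; have := fM 1; rewrite c3.
  rewrite -f0 -f1; apply: connected_curve.
    apply: (@lagr_continuous_in R n R _ f fM) => t.
    apply: ctsmxM; last exact: ctsmx_cst.
    apply: ctsmx_block => //; try exact: ctsmx_cst.
    apply: ctsmx_invmx; last exact: ctsmx_tr.
    by move=> z; rewrite unitmx_tr.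
  move=> t; apply/(richardsonP vE rv wE rw (fM t)).
  have [-> ->] := ranks_dg M' (uc t).
  have [h uh E] := (repr_eqP xM xM').1 erefl.
  by rewrite E; have [-> ->] := ranks_mulr M uh.
have [U openU UP] := nneg_open_in_stratum (n - nflip sv)%N (nflip sw).
have UE y : richardson v w y -> U y <-> @lagr_nneg R n y.
  have [N yN] := ex_repr y => /(richardsonP vE rv wE rw yN)[e1 e2].
  exact: UP yN e1 e2.
set CC := connected_component _ _.
have CCR : CC `<=` richardson v w by exact: connected_component_sub.
(* On the component, where both ranks are fixed, nonnegativity is closed and, by the choice of [U],
   open; as it holds at [x0], it holds throughout. *)
have : CC `&` @lagr_nneg R n = CC.
  apply: (@component_connected _ (richardson v w) x0).
  - by exists x0; split=> //; exact: connected_component_refl.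
  - exists U => //; apply/seteqP; split=> y [yC h]; split=> //.
      by apply/UE => //; exact: CCR.
    by apply/UE => //; exact: CCR.
  - by exists (@lagr_nneg R n) => //; exact: lagr_nneg_closed.
move=> CCE y yC; split; last exact: CCR.
by move: yC; rewrite -CCE => -[].
Qed.

End NonnegativePart.

Lemma ctsr_squeeze (R : realType) (T : topologicalType) (t : T) (f g : T -> R) :
  ctsr t g -> (forall z, `|f z| <= g z) -> f t = 0 -> g t = 0 -> ctsr t f.
Proof.
move=> cg fg f0 g0; apply/cvgrPdist_lt => e e0.
have /cvgrPdist_lt/(_ e e0) := cg; apply: filterS => z.
rewrite f0 g0 !sub0r !normrN; apply: le_lt_trans.
exact: le_trans (fg z) (ler_norm _).
Qed.

(** * Rescaling along rays between two norms *)

Section RadialRescaling.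
Variables (R : realType) (d : nat).
Local Notation V := 'rV[R]_d.
Implicit Types (N e : V -> R) (v : V).

(** What rescaling along rays needs of a norm; the bound by [K] makes [N] vanish at 0 only and
    controls the rescaling near 0. *)
Definition gauge N := [/\ forall v, ctsr v N, forall v, 0 <= N v,
  forall a v, 0 <= a -> N (a *: v) = a * N v &
  exists K, forall v k, `|v 0 k| <= K * N v].

(** Moves [v] along its ray to where [e] takes the value [N v]; exchanging [N] and [e] inverts
    it. *)
Definition regauge N e v : V := (N v / e v) *: v.

Lemma gauge0 N : gauge N -> N 0 = 0.
Proof. by move=> [_ _ h _]; have := h 0 0 (lexx 0); rewrite scale0r mul0r. Qed.

Lemma gauge_neq0 N v : gauge N -> v != 0 -> N v != 0.
Proof.
move=> [_ _ _ [K hK]]; apply: contraNneq => h; apply/eqP/rowP => k.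
by apply/eqP; rewrite mxE -normr_le0; have := hK v k; rewrite h mulr0.
Qed.

Lemma regauge_gauge N e v : gauge N -> gauge e -> e (regauge N e v) = N v.
Proof.
move=> gN ge; rewrite /regauge; have [->|v0] := eqVneq v 0.
  by rewrite scaler0 !gauge0.
case: (gN) (ge) => _ N0 _ _ [_ e0 eZ _].
by rewrite eZ ?divr_ge0 // divfK //; exact: gauge_neq0.
Qed.

Lemma regaugeK N e v : gauge N -> gauge e -> regauge e N (regauge N e v) = v.
Proof.
move=> gN ge; rewrite /regauge -/(regauge N e v) regauge_gauge //.
have [->|v0] := eqVneq v 0; first by rewrite /regauge !scaler0.
case: (gN) (ge) => _ N0 NZ _ [_ e0 _ _].
have nN := gauge_neq0 gN v0; have ne := gauge_neq0 ge v0.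
rewrite {1}/regauge NZ ?divr_ge0 // scalerA.
by rewrite (_ : _ / _ * _ = 1) ?scale1r //; field; rewrite nN ne.
Qed.

Lemma ctsmx_regauge N e v : gauge N -> gauge e -> ctsmx v (regauge N e).
Proof.
move=> gN ge; case: (gN) (ge) => cN N0 _ _ [ce e0 _ [K hK]].
have [->|v0] := eqVneq v 0; last first.
  apply: ctsmxZ; last exact: ctsmx_id.
  by apply: ctsrM => //; apply: ctsrV => //; exact: gauge_neq0.
(* At the origin each entry is bounded by (N u / e u) K e u = K N u, which tends to 0. *)
move=> i k; have c : ctsr (0 : V) (fun z : V => K * N z) by apply: ctsrM; [exact: ctsr_cst|].
apply: (ctsr_squeeze c) => [u||]; last 2 first.
- by rewrite /regauge scaler0 mxE.
- by rewrite gauge0 // mulr0.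
rewrite /regauge (ord1 i) scalemxE normrM ger0_norm ?divr_ge0 // -mulrA (mulrC K).
have [->|u0] := eqVneq u 0; first by rewrite mxE normr0 gauge0 // !mul0r.
rewrite ler_wpM2l // mulrC ler_pdivrMr //.
by rewrite lt0r e0 gauge_neq0.
Qed.

Definition enorm v : R := Num.sqrt (\sum_i v 0 i ^+ 2).

Lemma sumsq_ge0 v : 0 <= \sum_i v 0 i ^+ 2.
Proof. by apply: sumr_ge0 => i _; exact: sqr_ge0. Qed.

Lemma enorm_gauge : gauge enorm.
Proof.
split=> [v|v|a v a0|].
- apply: (@continuous_comp _ _ _ (fun v : V => \sum_i v 0 i ^+ 2) Num.sqrt v).
    have : ctsr v (fun v : V => \sum_i v 0 i ^+ 2).
      apply: ctsr_sum => i; have c : ctsr v (fun v : V => v 0 i) by exact: ctsmx_id.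
      exact: (ctsrM c c).
    exact.
  exact: sqrt_continuous.
- exact: sqrtr_ge0.
- rewrite -{2}(ger0_norm a0) -sqrtr_sqr /enorm -sqrtrM ?sqr_ge0 // mulr_sumr.
  by congr Num.sqrt; apply: eq_bigr => i _; rewrite mxE exprMn.
- exists 1 => v k; rewrite mul1r -sqrtr_sqr; apply: ler_wsqrtr.
  by rewrite (bigD1 k) //= lerDl; apply: sumr_ge0 => i _; exact: sqr_ge0.
Qed.

Lemma enorm_le1 v : closed_ball_eucl v <-> enorm v <= 1.
Proof.
rewrite /closed_ball_eucl /= /enorm -[X in _ <-> _ <= X]sqrtr1.
by rewrite ler_sqrt // ?ltr01.
Qed.

Lemma enorm_eq1 v : enorm v = 1 <-> \sum_i v 0 i ^+ 2 = 1.
Proof.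
split=> [h|h]; last by rewrite /enorm h sqrtr1.
by rewrite -(sqr_sqrtr (sumsq_ge0 v)) -/(enorm v) h expr1n.
Qed.

End RadialRescaling.

(** * The numerical radius as a norm on symmetric matrices *)

Section NumericalRadius.
Variables (R : realType) (n : nat).
Implicit Types (X Y : 'M[R]_n) (u v : 'cV[R]_n).

(** For symmetric X, nrad X <= 1 says that 1 - X and 1 + X are semidefinite, without recourse to
    eigenvalues. *)
Definition nrad X : R := sup [set `|qf X u| | u in [set u | nsq u <= 1]].

Lemma abs_entry_le1 u i : nsq u <= 1 -> `|u i 0| <= 1.
Proof.
move=> h; rewrite -(@ler_pXn2r _ 2) ?nnegrE ?normr_ge0 ?ler01 // expr1n.
rewrite real_normK ?num_real //; apply: le_trans h; rewrite nsqE (bigD1 i) //=.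
by rewrite lerDl; apply: sumr_ge0 => j _; exact: sqr_ge0.
Qed.

Lemma qfE X u : qf X u = \sum_i \sum_j u j 0 * X j i * u i 0.
Proof.
rewrite /qf mxE; apply: eq_bigr => i _; rewrite mxE mulr_suml.
by apply: eq_bigr => j _; rewrite mxE.
Qed.

Lemma abs_qf_le X u : nsq u <= 1 -> `|qf X u| <= \sum_i \sum_j `|X j i|.
Proof.
move=> h; rewrite qfE; apply: le_trans (ler_norm_sum _ _ _) _.
apply: ler_sum => i _; apply: le_trans (ler_norm_sum _ _ _) _.
apply: ler_sum => j _; rewrite !normrM -[leRHS]mulr1 -[X in _ <= X * _]mul1r.
by rewrite ler_pM ?mulr_ge0 // ?ler_pM //; exact: abs_entry_le1.
Qed.

Lemma nrad_has_sup X : has_sup [set `|qf X u| | u in [set u | nsq u <= 1]].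
Proof.
split; last by exists (\sum_i \sum_j `|X j i|) => _ [u h <-]; exact: abs_qf_le.
by exists `|qf X 0|; exists 0 => //=; rewrite /nsq mulmx0 mxE ler01.
Qed.

Lemma nrad_le X c : (forall u, nsq u <= 1 -> `|qf X u| <= c) -> nrad X <= c.
Proof.
move=> h; apply: ge_sup; first by have [] := nrad_has_sup X.
by move=> _ [u u1 <-]; exact: h.
Qed.

Lemma nsqZ a u : nsq (a *: u) = a ^+ 2 * nsq u.
Proof. by rewrite -!qf1 qf_scale. Qed.

Lemma le_nrad X u : `|qf X u| <= nrad X * nsq u.
Proof.
have [->|u0] := eqVneq u 0.
  by rewrite /qf /nsq !mulmx0 !mxE normr0 mulr0.
have n0 := nsq_gt0 u0; rewrite -ler_pdivrMr //.
have -> : `|qf X u| / nsq u = `|qf X ((Num.sqrt (nsq u))^-1 *: u)|.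
  rewrite qf_scale normrM exprVn sqr_sqrtr ?ltW // gtr0_norm ?invr_gt0 //.
  by rewrite mulrC.
apply: sup_ubound; first by have [] := nrad_has_sup X.
exists ((Num.sqrt (nsq u))^-1 *: u) => //=.
by rewrite nsqZ exprVn sqr_sqrtr ?nsq_ge0 // mulVf // gt_eqF.
Qed.

Lemma nrad_ge0 X : 0 <= nrad X.
Proof.
apply: le_trans (normr_ge0 (qf X 0)) _; apply: sup_ubound.
  by have [] := nrad_has_sup X.
by exists 0 => //=; rewrite /nsq mulmx0 mxE ler01.
Qed.

Lemma nrad_triangle X Y : nrad (X + Y) <= nrad X + nrad Y.
Proof.
apply: nrad_le => u h; rewrite qfD; apply: le_trans (ler_normD _ _) _.
by rewrite lerD // (le_trans (le_nrad _ _)) // ler_piMr // nrad_ge0.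
Qed.

Lemma nradN X : nrad (- X) = nrad X.
Proof.
have h Y : nrad (- Y) <= nrad Y.
  apply: nrad_le => u h; rewrite qfN normrN (le_trans (le_nrad _ _)) //.
  by rewrite ler_piMr // nrad_ge0.
by apply/le_anti; rewrite h /= -{1}[X]opprK h.
Qed.

Lemma nradZ a X : 0 <= a -> nrad (a *: X) = a * nrad X.
Proof.
move=> a0.
have h b Y : 0 <= b -> nrad (b *: Y) <= b * nrad Y.
  move=> b0; apply: nrad_le => u h; rewrite qfZ normrM ger0_norm // ler_wpM2l //.
  by rewrite (le_trans (le_nrad _ _)) // ler_piMr // nrad_ge0.
apply/le_anti; rewrite h //=; have [->|an0] := eqVneq a 0.
  by rewrite mul0r nrad_ge0.
have ap : 0 < a by rewrite lt0r an0.
rewrite -ler_pdivlMl //; apply: le_trans (h _ _ _); last by rewrite invr_ge0.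
by rewrite scalerA mulVf // scale1r.
Qed.

Lemma nrad_le_sum X : nrad X <= \sum_i \sum_j `|X j i|.
Proof. by apply: nrad_le => u; exact: abs_qf_le. Qed.

(** By the triangle inequality two values differ by at most [nrad] of the difference, hence by at
    most the sum of its absolute entries. *)
Lemma ctsr_nrad (T : topologicalType) (t : T) (f : T -> 'M[R]_n) :
  ctsmx t f -> ctsr t (fun z => nrad (f z)).
Proof.
move=> cf.
have c : ctsr t (fun z => \sum_i \sum_j `|f t j i - f z j i|).
  apply: ctsr_sum => i; apply: ctsr_sum => j; apply: cvg_norm.
  by apply: cvgB; [exact: cvg_cst | exact: cf].
apply/cvgrPdist_lt => e e0.
have /cvgrPdist_lt/(_ e e0) := c; apply: filterS => z.
rewrite [X in X - _]big1 => [|i _]; last first.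
  by rewrite big1 // => j _; rewrite subrr normr0.
rewrite sub0r normrN; apply: le_lt_trans; apply: le_trans (ler_norm _).
rewrite (_ : \sum_i _ = \sum_i \sum_j `|(f t - f z) j i|); last first.
  by apply: eq_bigr => i _; apply: eq_bigr => j _; rewrite !mxE.
apply: le_trans (nrad_le_sum _); rewrite ler_norml.
have := nrad_triangle (f t - f z) (f z); rewrite subrK => h1.
have := nrad_triangle (f z - f t) (f t); rewrite subrK -[nrad (f z - f t)]nradN opprB => h2.
by apply/andP; split; lra.
Qed.

(** Polarisation at e_i + e_j, of square norm 2: its value minus X_ii and X_jj is 2 X_ij, which is
    therefore at most 4 nrad X in absolute value. *)
Lemma entry_le_nrad X i j : X^T = X -> `|X i j| <= 2 * nrad X.
Proof.
move=> sX; pose e k : 'cV[R]_n := delta_mx k 0.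
have eE k l : ((e k)^T *m X *m e l) 0 0 = X k l.
  by rewrite /e trmx_delta -rowE -colE !mxE.
have ne k : nsq (e k) = 1.
  by rewrite /nsq /e trmx_delta mul_delta_mx mxE !eqxx.
have hi k : `|X k k| <= nrad X.
  by have := le_nrad X (e k); rewrite ne mulr1 /qf eE.
have [->|ij] := eqVneq i j.
  by apply: le_trans (hi j) _; have := nrad_ge0 X; lra.
have := le_nrad X (e i + e j); rewrite qf_bilin // /qf !eE.
have -> : nsq (e i + e j) = 2.
  rewrite -qf1 qf_bilin ?trmx1 // mulmx1 !qf1 !ne /e trmx_delta.
  by rewrite mul_delta_mx_cond eq_sym (negbTE ij) mulr0n mxE mul0rn addr0.
have -> : X j i = X i j by rewrite -{1}sX mxE.
have := hi i; have := hi j; rewrite !ler_norml mulr2n.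
by move=> /andP[a1 a2] /andP[b1 b2] /andP[c1 c2]; apply/andP; split; lra.
Qed.

Lemma nrad_le1 X : X^T = X ->
  nrad X <= 1 <-> pos_semidef (1%:M - X) /\ pos_semidef (1%:M + X).
Proof.
move=> sX; split=> [h|[[_ h1] [_ h2]]].
  have h' u := le_trans (le_nrad X u) (ler_piMl (nsq_ge0 u) h).
  split; (split; first by rewrite ?trmxB ?trmxD trmx1 sX) => u; rewrite -/(qf _ u).
    by rewrite qfD qfN qf1 subr_ge0 (le_trans (ler_norm _)).
  by rewrite qfD qf1 -lerBlDr sub0r (le_trans _ (h' u)) // -normrN ler_norm.
apply: nrad_le => u u1; rewrite ler_norml; apply/andP; split.
  have := h2 u; rewrite -/(qf _ u) qfD qf1; lra.
have := h1 u; rewrite -/(qf _ u) qfD qfN qf1; lra.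
Qed.

Lemma nrad_lt1 X : X^T = X ->
  nrad X < 1 <-> pos_def (1%:M - X) /\ pos_def (1%:M + X).
Proof.
move=> sX; split=> [h|[h1 h2]].
  have h' u : u != 0 -> `|qf X u| < nsq u.
    move=> u0; apply: le_lt_trans (le_nrad X u) _.
    by rewrite gtr_pMl // nsq_gt0.
  split; (split; first by rewrite ?trmxB ?trmxD trmx1 sX) => u u0; rewrite -/(qf _ u).
    by rewrite qfD qfN qf1 subr_gt0 (le_lt_trans (ler_norm _)) // h'.
  rewrite qfD qf1 -ltrBlDr sub0r (le_lt_trans _ (h' u u0)) //.
  by rewrite -normrN ler_norm.
have sZ (t : R) : (t *: X)^T = t *: X by rewrite trmxZ sX.
have cZ (s : R) : ctsmx s (fun t : R => t *: X).
  by apply: ctsmxZ; [exact: cvg_id | exact: ctsmx_cst].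
(* Definiteness is open, so 1 - t X and 1 + t X are still definite for some t > 1; then t nrad X <=
   1, which gives the strict bound. *)
have n1 : \forall t \near (1 : R), pos_def (1%:M - t *: X).
  apply: near_pos_def => [|t|]; rewrite ?scale1r //.
    by apply: ctsmxB => //; exact: ctsmx_cst.
  by rewrite trmxB trmx1 sZ.
have n2 : \forall t \near (1 : R), pos_def (1%:M + t *: X).
  apply: near_pos_def => [|t|]; rewrite ?scale1r //.
    by apply: ctsmxD => //; exact: ctsmx_cst.
  by rewrite trmxD trmx1 sZ.
have /nbhs_ballP[e /= e0 eP] :
    \forall t \near (1 : R), pos_def (1%:M - t *: X) /\ pos_def (1%:M + t *: X).
  by apply: filterS2 n1 n2.
have [] : pos_def (1%:M - (1 + e / 2) *: X) /\ pos_def (1%:M + (1 + e / 2) *: X).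
  apply: eP; rewrite /ball /= opprD addrA subrr sub0r normrN gtr0_norm ?divr_gt0 //.
  by rewrite ltr_pdivrMr // ltr_pMr // ltr1n.
move=> p1 p2; have e2 : 0 < e / 2 by rewrite divr_gt0.
have : nrad ((1 + e / 2) *: X) <= 1.
  by apply/(nrad_le1 (sZ _)); split; exact: pos_def_psd.
rewrite nradZ; last by rewrite ltW // ltr_wpDl.
have := nrad_ge0 X; nra.
Qed.

End NumericalRadius.

Lemma card_pairs n : #|[pred p : 'I_n * 'I_n | (p.2 <= p.1)%N]| = (n * n.+1 %/ 2)%N.
Proof.
rewrite -sum1_card -(pair_big_dep xpredT (fun j i : 'I_n => i <= j)%N (fun _ _ => 1%N)) /=.
rewrite (eq_bigr (fun j : 'I_n => j.+1)) => [|j _]; last first.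
  by rewrite (big_ord_narrow (ltn_ord j)) sum1_card card_ord.
rewrite -(big_mkord xpredT (fun j => j.+1)).
by have := bin2_sum n.+1; rewrite big_nat_recl // add0n bin2 -divn2 mulnC.
Qed.

(** [d] is left variable so that the sphere can use the successor [(n * n.+1 %/ 2 - 1).+1]; [c]
    numbers the unordered pairs and [b] picks one order of each. *)
Lemma sym_index n d : d = (n * n.+1 %/ 2)%N -> (0 < n)%N ->
  exists (b : 'I_d -> 'I_n * 'I_n) (c : 'I_n -> 'I_n -> 'I_d),
    [/\ forall i j, c i j = c j i, forall k, c (b k).1 (b k).2 = k &
        forall i j, b (c i j) = (i, j) \/ b (c i j) = (j, i)].
Proof.
move=> dE n0; pose A := [pred p : 'I_n * 'I_n | (p.2 <= p.1)%N].
have {dE} dE : d = #|A| by rewrite dE -card_pairs.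
subst d; have A0 : (Ordinal n0, Ordinal n0) \in A by rewrite inE /=.
pose o (i j : 'I_n) := if (j <= i)%N then (i, j) else (j, i).
have oA i j : o i j \in A by rewrite /o; case: leqP => h; rewrite inE //= ltnW.
exists enum_val, (fun i j => enum_rank_in A0 (o i j)); split=> [i j|k|i j].
- congr enum_rank_in; rewrite /o; case: ltngtP => // h.
  by have -> : i = j by exact: val_inj.
- rewrite /o; have := enum_valP k; rewrite inE => ->.
  by rewrite -surjective_pairing enum_valK_in.
- by rewrite enum_rankK_in // /o; case: leqP; [left|right].
Qed.

(** * The Cayley transform as a global chart of the nonnegative part *)

Section Cayley.
Variables (R : realType) (n : nat).
Local Notation F := 'M[R]_(n + n, n).
Local Notation L := (lagr R n).
Implicit Types (X : 'M[R]_n) (M : F) (x : L).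

(** For symmetric X the form A^T C of this frame is 1 - X^2, so definiteness becomes a bound on
    X. *)
Definition cayley_frame X : F := col_mx (1%:M + X) (1%:M - X).

Definition cayley M : 'M[R]_n :=
  (usubmx M - dsubmx M) *m invmx (usubmx M + dsubmx M).

Lemma gram_cayley X : X^T = X ->
  gram (cayley_frame X) = (1%:M + X) *m (1%:M - X).
Proof. by move=> sX; rewrite gram_col trmxD trmx1 sX. Qed.

Lemma cayley_comm X : (1%:M - X) *m (1%:M + X) = (1%:M + X) *m (1%:M - X).
Proof.
rewrite !(mulmxDl, mulmxDr) !mul1mx !mulmx1 !mulNmx !mulmxN.
by apply/matrixP => i j; rewrite !(addmxE, oppmxE); ring.
Qed.

Lemma cayley_lag X : X^T = X -> lag_frame (cayley_frame X).
Proof.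
move=> sX; apply/lag_frameP; split.
  by rewrite trmxB trmxD trmx1 sX cayley_comm.
move=> u; rewrite mulmxDl mulmxBl mul1mx => h1 h2.
have : u + u = 0 by rewrite -[RHS](addr0 0) -{1}h1 -h2 addrACA subrr addr0.
move=> uu; apply/matrixP => i j; have := congr1 (fun v : 'cV[R]_n => v i j) uu.
by rewrite !mxE; lra.
Qed.

(** Semidefiniteness of 1 - X^2 says |Xu| <= |u|; the squares of u + Xu and u - Xu being
    nonnegative, this bounds u^T X u by |u|^2. *)
Lemma nrad_psd X : X^T = X ->
  pos_semidef ((1%:M + X) *m (1%:M - X)) <-> nrad X <= 1.
Proof.
move=> sX; have sP : (1%:M + X)^T = 1%:M + X by rewrite trmxD trmx1 sX.
have sQ : (1%:M - X)^T = 1%:M - X by rewrite trmxB trmx1 sX.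
split=> [h|/(nrad_le1 sX)[pQ pP]].
  apply: nrad_le => u u1.
  have : 0 <= nsq u - nsq (X *m u).
    have := psd_qf u h; rewrite /qf -!mulmxA mulmxA -{1}sP -trmx_mul.
    rewrite !mulmxDl !mul1mx mulNmx trmxD !mulmxDl !mulmxDr !mulmxN.
    have -> : (X *m u)^T *m u = u^T *m (X *m u) by rewrite trmx_mul sX mulmxA.
    by rewrite !(addmxE, oppmxE) /nsq; set a := (_ *m (X *m u)) 0 0; set b := (u^T *m u) 0 0; set c := (_ *m (X *m u)) 0 0; lra.
  have h1 := nsq_ge0 (u - X *m u); have h2 := nsq_ge0 (u + X *m u).
  have hb Y v : nsq (v + Y *m v) = nsq v + qf Y v + qf Y^T v + nsq (Y *m v).
    rewrite /nsq /qf trmxD mulmxDl !mulmxDr !addmxE trmx_mul !mulmxA.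
    by ring.
  have sN : (- X)^T = - X by rewrite linearN /= sX.
  move: h1 h2; rewrite -mulNmx !hb sN sX !qfN mulNmx.
  have -> : nsq (- (X *m u)) = nsq (X *m u) by rewrite -scaleN1r nsqZ; ring.
  by rewrite ler_norml => h1 h2 h3; apply/andP; split; lra.
(* P = 1 + X and Q = 1 - X commute and add up to 2, so P Q P + Q P Q = 2 P Q. *)
have -> : (1%:M + X) *m (1%:M - X) = 2^-1 *:
    ((1%:M + X)^T *m (1%:M - X) *m (1%:M + X) + (1%:M - X)^T *m (1%:M + X) *m (1%:M - X)).
  rewrite sP sQ cayley_comm -mulmxDr.
  rewrite (_ : 1%:M + X + (1%:M - X) = 2%:M); last first.
    by apply/matrixP => i j; rewrite !mxE; ring.
  by rewrite mul_mx_scalar scalerA mulVf ?scale1r.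
by apply: psdZ => //; apply: psdD; exact: psd_congr.
Qed.

Lemma nrad_pd X : X^T = X ->
  pos_def ((1%:M + X) *m (1%:M - X)) <-> nrad X < 1.
Proof.
move=> sX; rewrite (nrad_lt1 sX); split=> [h|[pQ pP]].
  have /(nrad_psd sX)/(nrad_le1 sX)[pQ pP] := pos_def_psd h.
  have := pos_def_unit h; rewrite unitmx_mul => /andP[uP uQ].
  by split; exact: psd_unit_pos_def.
apply: psd_unit_pos_def; last first.
  by rewrite unitmx_mul; apply/andP; split; exact: pos_def_unit.
apply/(nrad_psd sX)/(nrad_le1 sX).
by split; exact: pos_def_psd.
Qed.

Lemma cayleyK X : cayley (cayley_frame X) = X.
Proof.
rewrite /cayley /cayley_frame col_mxKu col_mxKd.
have -> : 1%:M + X + (1%:M - X) = 2%:M :> 'M[R]_n.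
  by apply/matrixP => i j; rewrite !mxE; ring.
have -> : 1%:M + X - (1%:M - X) = 2 *: X :> 'M[R]_n.
  by apply/matrixP => i j; rewrite !mxE; ring.
by rewrite invmx_scalar mul_mx_scalar scalerA mulVf ?scale1r.
Qed.

Lemma cayley_mulr M h : h \in unitmx -> usubmx M + dsubmx M \in unitmx ->
  cayley (M *m h) = cayley M.
Proof.
move=> uh uM; rewrite /cayley -mul_usub_mx -mul_dsub_mx -mulmxBl -mulmxDl.
have -> : invmx ((usubmx M + dsubmx M) *m h) =
    invmx h *m invmx (usubmx M + dsubmx M).
  apply: (can_inj (mulKmx (_ : (usubmx M + dsubmx M) *m h \in unitmx))).
    by rewrite unitmx_mul uM.
  by rewrite mulmxV ?unitmx_mul ?uM // -mulmxA mulKVmx // mulmxV.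
by rewrite mulmxA mulmxK.
Qed.

Lemma cayley_unit x M : repr_by x M -> @lagr_nneg R n x ->
  usubmx M + dsubmx M \in unitmx.
Proof.
move=> xM /(lagr_nnegP xM) pM.
by have := push_unit (repr_lag xM) pM ltr01; rewrite scale1r.
Qed.

Lemma cayley_sym M : lag_frame M -> usubmx M + dsubmx M \in unitmx ->
  (cayley M)^T = cayley M.
Proof.
move=> [_ sM] uP; rewrite /cayley; set A := usubmx M in sM uP *.
set C := dsubmx M in sM uP *; set P := A + C.
have h : P^T *m (A - C) = (A - C)^T *m P.
  rewrite /P trmxD trmxB mulmxDl mulmxBl !mulmxBr !mulmxDr sM.
  by apply/matrixP => i j; rewrite !(addmxE, oppmxE); ring.
have uPT : P^T \in unitmx by rewrite unitmx_tr.
apply: (can_inj (mulKmx uPT)); rewrite trmx_mul trmx_inv mulKVmx //.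
by rewrite mulmxA h mulmxK.
Qed.

Lemma cayley_frameK x M : repr_by x M -> @lagr_nneg R n x ->
  repr_by x (cayley_frame (cayley M)).
Proof.
move=> xM xP; have uP := cayley_unit xM xP.
pose h := 2 *: invmx (usubmx M + dsubmx M).
have uh : h \in unitmx by rewrite unitmxZ ?unitmx_inv // unitfE pnatr_eq0.
rewrite (_ : cayley_frame _ = M *m h); first exact: repr_mulr.
rewrite -[M in RHS]vsubmxK mul_col_mx /cayley_frame /cayley.
move: uP; set A := usubmx M; set C := dsubmx M => uP.
rewrite -[1%:M](mulmxV uP) -mulmxDl -mulmxBl /h -!scalemxAr !scalemxAl.
congr col_mx; congr mulmx; apply/matrixP => i j.
  by rewrite !(addmxE, oppmxE, scalemxE); ring.
by rewrite !(addmxE, oppmxE, scalemxE); ring.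
Qed.

Section Chart.
Variables (d : nat) (b : 'I_d -> 'I_n * 'I_n) (c : 'I_n -> 'I_n -> 'I_d).
Hypothesis cC : forall i j, c i j = c j i.
Hypothesis bK : forall k, c (b k).1 (b k).2 = k.
Hypothesis cK : forall i j, b (c i j) = (i, j) \/ b (c i j) = (j, i).
Local Notation V := 'rV[R]_d.

Definition sym_mx (y : V) : 'M[R]_n := \matrix_(i, j) y 0 (c i j).

Definition sym_coord X : V := \row_k X (b k).1 (b k).2.

Lemma sym_mx_sym y : (sym_mx y)^T = sym_mx y.
Proof. by apply/matrixP => i j; rewrite !mxE cC. Qed.

Lemma sym_mxK y : sym_coord (sym_mx y) = y.
Proof. by apply/rowP => k; rewrite !mxE bK. Qed.

Lemma sym_coordK X : X^T = X -> sym_mx (sym_coord X) = X.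
Proof.
move=> sX; apply/matrixP => i j; rewrite !mxE.
by case: (cK i j) => -> //=; rewrite -[in RHS]sX mxE.
Qed.

Lemma nrad_gauge : gauge (fun y => nrad (sym_mx y)).
Proof.
split=> [y|y|a y a0|].
- apply: ctsr_nrad => i j; apply: (@eq_ctsr R V y (fun z : V => z 0 (c i j))).
    by move=> z; rewrite mxE.
  exact: ctsmx_id.
- exact: nrad_ge0.
- by rewrite -nradZ //; congr nrad; apply/matrixP => i j; rewrite !mxE.
- exists 2 => y k; rewrite -(bK k).
  by have := entry_le_nrad (b k).1 (b k).2 (sym_mx_sym y); rewrite mxE.
Qed.

Definition chart_pt (y : V) : L := mkl (cayley_lag (sym_mx_sym y)).

(** Any frame may be chosen: where A + C is invertible, [cayley] does not depend on it. *)
Definition chart (x : L) : V :=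
  sym_coord (cayley (xget 0 [set M | repr_by x M])).

Lemma chart_ptP y : repr_by (chart_pt y) (cayley_frame (sym_mx y)).
Proof. exact: repr_mkl. Qed.

Lemma chart_repr x M : repr_by x M -> usubmx M + dsubmx M \in unitmx ->
  chart x = sym_coord (cayley M).
Proof.
move=> xM uM; rewrite /chart; case: xgetP => [N _ /= xN|no]; last first.
  by case: (no M).
have [h uh ->] := (repr_eqP xM xN).1 erefl.
by rewrite cayley_mulr.
Qed.

Lemma chart_pt_unit y : usubmx (cayley_frame (sym_mx y)) +
  dsubmx (cayley_frame (sym_mx y)) \in unitmx.
Proof.
rewrite /cayley_frame col_mxKu col_mxKd.
have -> : 1%:M + sym_mx y + (1%:M - sym_mx y) = 2%:M :> 'M[R]_n.
  by apply/matrixP => i j; rewrite !mxE; ring.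
by rewrite unitmxE det_scalar unitrX // unitfE pnatr_eq0.
Qed.

Lemma chart_ptK y : chart (chart_pt y) = y.
Proof.
by rewrite (chart_repr (chart_ptP y) (chart_pt_unit y)) cayleyK sym_mxK.
Qed.

Lemma chartK x : @lagr_nneg R n x -> chart_pt (chart x) = x.
Proof.
move=> xP; have [M xM] := ex_repr x; have uM := cayley_unit xM xP.
apply: (repr_inj (chart_ptP _)); rewrite (chart_repr xM uM) sym_coordK.
  exact: cayley_frameK.
by apply: cayley_sym => //; exact: repr_lag xM.
Qed.

Lemma chart_nneg y : @lagr_nneg R n (chart_pt y) <-> nrad (sym_mx y) <= 1.
Proof.
rewrite (lagr_nnegP (chart_ptP y)) gram_cayley ?nrad_psd //; exact: sym_mx_sym.
Qed.

Lemma chart_pos y : @lagr_pos R n (chart_pt y) <-> nrad (sym_mx y) < 1.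
Proof.
rewrite (lagr_posP (chart_ptP y)) gram_cayley ?nrad_pd //; exact: sym_mx_sym.
Qed.

Lemma chart_pt_continuous : continuous chart_pt.
Proof.
apply: (lagr_continuous_in chart_ptP) => y.
have cS : ctsmx y sym_mx.
  move=> i j; apply: (@eq_ctsr R V y (fun z : V => z 0 (c i j))).
    by move=> z; rewrite mxE.
  exact: ctsmx_id.
apply: ctsmx_col; first by apply: ctsmxD => //; exact: ctsmx_cst.
by apply: ctsmxB => //; exact: ctsmx_cst.
Qed.

Lemma chart_continuous x : @lagr_nneg R n x -> chart y @[y --> x] --> chart x.
Proof.
move=> xP; pose P M := usubmx M + dsubmx M \in unitmx.
have cD M : ctsmx M (fun N : F => usubmx N + dsubmx N).
  by apply: ctsmxD; [apply: ctsmx_usub | apply: ctsmx_dsub]; exact: ctsmx_id.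
apply: (@lagr_continuous_out R n V (fun M => sym_coord (cayley M)) P).
- move=> M; rewrite /P unitmxE unitfE => PM.
  apply: filterS (cvgr_neq0 _ (ctsr_det (cD M)) PM) => N.
  by rewrite /P unitmxE unitfE.
- move=> M h _ uh; rewrite /P -mul_usub_mx -mul_dsub_mx -mulmxDl unitmx_mul.
  by move=> ->.
- move=> M PM; have dM : \det (usubmx M + dsubmx M) != 0.
    by rewrite -unitfE -unitmxE.
  (* Near [M] the inverse is the adjugate divided by the determinant, an expression continuous at
     [M]. *)
  pose f N : V := sym_coord ((usubmx N - dsubmx N) *m
    ((\det (usubmx N + dsubmx N))^-1 *: \adj (usubmx N + dsubmx N))).
  have fE N : P N -> sym_coord (cayley N) = f N.
    by move=> PN; rewrite /f /cayley /invmx -/(P N) PN.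
  have cf : ctsmx M f.
    move=> i k; pose g (N : F) : 'M[R]_n := (usubmx N - dsubmx N) *m
      ((\det (usubmx N + dsubmx N))^-1 *: \adj (usubmx N + dsubmx N)).
    apply: (@eq_ctsr R F M (fun N => g N (b k).1 (b k).2)).
      by move=> N; rewrite [RHS]mxE.
    apply: ctsmxM.
      by apply: ctsmxB; [apply: ctsmx_usub | apply: ctsmx_dsub]; exact: ctsmx_id.
    apply: ctsmxZ; last exact: ctsmx_adj.
    by apply: ctsrV => //; exact: ctsr_det.
  rewrite fE //; apply: cvg_trans (ctsmx_continuous cf).
  have h : \forall N \near M, f N = sym_coord (cayley N).
    apply: filterS (cvgr_neq0 _ (ctsr_det (cD M)) dM) => N hN.
    by rewrite fE // /P unitmxE unitfE.
  exact: near_eq_cvg h.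
- by move=> y M yM PM; rewrite (chart_repr yM PM).
- by move=> M xM; exact: cayley_unit xM xP.
Qed.

Let N (y : V) := nrad (sym_mx y).

(** Serves both the ball and the sphere: [P] is the condition <= 1 or = 1 on the norm, carried by
    rescaling from [nrad] to the Euclidean norm. *)
Lemma lagr_homeo (P : R -> Prop) (A : set L) : A `<=` @lagr_nneg R n ->
  (forall y, A (chart_pt y) <-> P (N y)) ->
  homeomorphic A [set y : V | P (enorm y)].
Proof.
move=> AP AN; have gN := nrad_gauge; have ge := enorm_gauge R d.
exists (fun x => regauge N (@enorm R d) (chart x)).
exists (fun y => chart_pt (regauge (@enorm R d) N y)); split.
- move=> x Ax /=; rewrite regauge_gauge //; apply/AN; rewrite chartK //.
  exact: AP.
- by move=> y /= Py; apply/AN; rewrite regauge_gauge.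
- split=> [x /AP xP|y _]; first by rewrite regaugeK // chartK.
  by rewrite chart_ptK regaugeK.
- apply: continuous_in_subspaceT => x /set_mem/AP xP.
  apply: (@continuous_comp _ _ _ chart (regauge N (@enorm R d))).
    exact: chart_continuous.
  by apply: ctsmx_continuous; exact: ctsmx_regauge.
- apply: continuous_subspaceT => y.
  apply: (@continuous_comp _ _ _ (regauge (@enorm R d) N) chart_pt).
    by apply: ctsmx_continuous; exact: ctsmx_regauge.
  exact: chart_pt_continuous.
Qed.

End Chart.

Lemma lagr_nneg_ball : (0 < n)%N ->
  homeomorphic (@lagr_nneg R n) (@closed_ball_eucl R (n * n.+1 %/ 2)).
Proof.
move=> n0; have [b [c [cC bK cK]]] := sym_index (erefl (n * n.+1 %/ 2)%N) n0.
rewrite (_ : @closed_ball_eucl R _ = [set y | enorm y <= 1]).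
  have := @lagr_homeo _ b c cC bK cK (fun t => t <= 1) (@lagr_nneg R n).
  by apply=> // y; exact: chart_nneg.
by apply/seteqP; split=> y /enorm_le1.
Qed.

Lemma lagr_boundary_sphere : (0 < n)%N ->
  homeomorphic (@lagr_nneg R n `\` @lagr_pos R n)
    (@sphere_eucl R (n * n.+1 %/ 2 - 1)).
Proof.
move=> n0; have d0 : (n * n.+1 %/ 2 - 1).+1 = (n * n.+1 %/ 2)%N.
  by rewrite subn1 prednK // divn_gt0 // -[2%N]/(1 * 2)%N leq_mul.
have [b [c [cC bK cK]]] := sym_index d0 n0.
rewrite (_ : @sphere_eucl R _ = [set y | enorm y = 1]).
  have := @lagr_homeo _ b c cC bK cK (fun t => t = 1)
    (@lagr_nneg R n `\` @lagr_pos R n).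
  apply=> [x [] //|y].
  split=> [[/chart_nneg h1 h2]|h].
    by apply/le_anti; rewrite h1 leNgt; apply/negP => h; apply: h2; apply/chart_pos.
  split; first by apply/chart_nneg; rewrite h.
  by move/chart_pos; rewrite h ltxx.
by apply/seteqP; split=> y /enorm_eq1.
Qed.

End Cayley.

(** * Nonnegativity of n x n minors under adjacent row operations *)

Section Minors.
Variables (R : realType) (n : nat).
Implicit Types (T : nat -> 'I_n -> R) (f : 'I_n -> nat).

Definition minor f T : R := \det (\matrix_(i, l) T (f i) l).

Definition incr f := (forall i j : 'I_n, (i < j)%N -> (f i < f j)%N) /\
  forall i, (f i < n + n)%N.

Definition addrow (q r : nat) (a : R) T : nat -> 'I_n -> R :=
  fun p l => T p l + (p == q)%:R * a * T r l.

Definition upd f (k : 'I_n) (r : nat) : 'I_n -> nat :=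
  fun i => if i == k then r else f i.

Definition tnn T := forall f, incr f -> 0 <= minor f T.

Definition adj (q r : nat) := r = q.+1 \/ q = r.+1.

Lemma incr_inj f i j : incr f -> f i = f j -> i = j.
Proof.
move=> [fi _] ij; apply: val_inj => /=.
have [h|h|//] := ltngtP i j; have := fi _ _ h; rewrite ij ltnn //.
Qed.

Lemma eq_minor f T T' : incr f ->
  (forall p l, (p < n + n)%N -> T p l = T' p l) -> minor f T = minor f T'.
Proof.
move=> [_ fb] h; congr (\det _); apply/matrixP => i l; rewrite !mxE; exact: h.
Qed.

Lemma eq_tnn T T' : (forall p l, (p < n + n)%N -> T p l = T' p l) ->
  tnn T -> tnn T'.
Proof. by move=> h tT f fi; rewrite -(eq_minor fi h); exact: tT. Qed.

Lemma minor_addrow0 f q r a T : (forall k, f k <> q) ->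
  minor f (addrow q r a T) = minor f T.
Proof.
move=> h; congr (\det _); apply/matrixP => i l; rewrite !mxE /addrow.
by case: eqP => [/h//|_]; rewrite !mul0r addr0.
Qed.

Lemma minor_addrow f q r a T k : incr f -> f k = q ->
  minor f (addrow q r a T) = minor f T + a * minor (upd f k r) T.
Proof.
move=> fi fk; rewrite -[X in X + _]mul1r; apply: (@determinant_multilinear _ _ _ _ _ k).
- apply/rowP => l; rewrite !mxE /addrow /upd fk !eqxx.
  by rewrite !mul1r.
- apply/matrixP => i l; rewrite !mxE /addrow.
  case: eqP => [h|_]; last by rewrite !mul0r addr0.
  by case/eqP: (neq_lift k i); exact: incr_inj fi (etrans fk (esym h)).
- apply/matrixP => i l; rewrite !mxE /addrow /upd eq_sym (negbTE (neq_lift k i)).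
  case: eqP => [h|_]; last by rewrite !mul0r addr0.
  by case/eqP: (neq_lift k i); exact: incr_inj fi (etrans fk (esym h)).
Qed.

Lemma minor_upd0 f k j r T : j != k -> f j = r -> minor (upd f k r) T = 0.
Proof.
move=> jk fj; apply: (@determinant_alternate _ _ _ j k) => // l.
by rewrite !mxE /upd eqxx (negbTE jk) fj.
Qed.

(** Nothing lies between the adjacent values [q] and [r], so replacing one by the other keeps the
    order. *)
Lemma upd_incr f k q r : incr f -> f k = q -> adj q r -> (r < n + n)%N ->
  (forall j, f j <> r) -> incr (upd f k r).
Proof.
move=> [fi fb] fk qr rn nr; split=> [i j ij|i]; rewrite /upd; last by case: ifP.
case: eqP => [ik|_]; case: eqP => [jk|_]; last exact: fi.
- by move: ij; rewrite ik jk ltnn.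
- have := fi _ _ ij; rewrite ik fk; have := nr j.
  by case: qr => ->; lia.
- have := fi _ _ ij; rewrite jk fk; have := nr i.
  by case: qr => ->; lia.
Qed.

(** By linearity in row [q] the term added is a multiple of the minor with [r] in place of [q],
    which vanishes if [r] already occurs and has increasing rows otherwise. *)
Lemma addrow_ge f q r a T : incr f -> tnn T -> adj q r -> (r < n + n)%N ->
  0 <= a -> minor f T <= minor f (addrow q r a T).
Proof.
move=> fi tT qr rn a0.
have [[k fk]|nk] := pselect (exists k, f k = q); last first.
  by rewrite minor_addrow0 // => k fk; apply: nk; exists k.
rewrite (minor_addrow _ _ _ fi fk) lerDl mulr_ge0 //.
have [[j fj]|nj] := pselect (exists j, f j = r).
  rewrite (minor_upd0 _ _ fj) //; apply/eqP => jk.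
  by case: qr; move: fj; rewrite jk fk => ->; lia.
by apply/tT/(upd_incr fi fk qr rn) => j fj; apply: nj; exists j.
Qed.

Lemma addrow_tnn q r a T : tnn T -> adj q r -> (r < n + n)%N -> 0 <= a ->
  tnn (addrow q r a T).
Proof.
by move=> tT qr rn a0 f fi; apply: le_trans (addrow_ge fi tT qr rn a0); exact: tT.
Qed.

(* If the positions occupied by f are those sent below n by g, then adding a
   multiple of row q to row q + 1 makes a minor positive whose positions are
   those sent below n by g composed with the transposition of q and q + 1. *)
Lemma addrow_pos g f q a T :
  (forall p p', (p < n + n)%N -> (p' < n + n)%N -> g p = g p' -> p = p') ->
  incr f -> tnn T -> (forall k, (g (f k) < n)%N) -> 0 < minor f T ->
  (g q < g q.+1)%N -> (q.+1 < n + n)%N -> 0 < a ->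
  exists2 f', incr f' /\ forall k, (g (tau q (f' k)) < n)%N &
    0 < minor f' (addrow q.+1 q a T).
Proof.
move=> gi fi tT gf fT gq qn a0; have [_ fb] := fi.
have adjq : adj q.+1 q by right.
have qn' : (q < n + n)%N by lia.
have stay f' : incr f' -> 0 < minor f' T -> 0 < minor f' (addrow q.+1 q a T).
  by move=> f'i h; apply: lt_le_trans h _; apply: addrow_ge => //; exact: ltW.
(* The n distinct values of [f] go below n under the injective [g], so they are all the positions
   that do. *)
have surj p : (p < n + n)%N -> (g p < n)%N -> exists k, f k = p.
  move=> pn gp; pose h k := Ordinal (gf k).
  have hi : injective h.
    by move=> i j /(congr1 val) /= /gi e; apply: (incr_inj fi); exact: e.
  have [k _ hk] : exists2 k, true & Ordinal gp = h k.
    have [h' hK h'K] := injF_bij hi.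
    by exists (h' (Ordinal gp)); rewrite ?h'K.
  by exists k; apply: gi => //; have /(congr1 val) := hk.
have [[k fk]|nA] := pselect (exists k, f k = q).
  have [[j fj]|nB] := pselect (exists j, f j = q.+1).
    exists f; last exact: stay.
    split=> // i; rewrite /tau; case: eqP => [_|_]; first by rewrite -fj.
    by case: eqP => _; [rewrite -fk | exact: gf].
  have ui : incr (upd f k q.+1).
    by apply: (upd_incr fi fk) => [|//|j fj]; [left | apply: nB; exists j].
  exists (upd f k q.+1); first split=> // i.
    rewrite /tau /upd; case: (i =P k) => [_|ik].
      have -> : (q.+1 == q) = false by lia.
      by rewrite eqxx -fk.
    case: eqP => [fiq|_]; first by case: ik; apply: (incr_inj fi); rewrite fiq.
    by case: eqP => [fiq|_]; [case: nB; exists i | exact: gf].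
  rewrite (@minor_addrow _ _ _ _ _ k) //; last by rewrite /upd eqxx.
  apply: ltr_wpDl; first exact: tT.
  rewrite mulr_gt0 // (_ : upd _ k q = f) //; apply/funext => i.
  by rewrite /upd; case: eqP => // ->.
have [[j fj]|nB] := pselect (exists j, f j = q.+1).
  (* Impossible: [g] sends [q] below the image of [q.+1], hence below n, so [q] would be a value of
     [f]. *)
  case: nA; apply: surj => //; apply: ltn_trans gq _; by rewrite -fj.
exists f; last exact: stay.
split=> // i; rewrite /tau; case: eqP => [h|_]; first by case: nA; exists i.
by case: eqP => [h|_]; [case: nB; exists i | exact: gf].
Qed.

Lemma minor_inj f T : 0 < minor f T ->
  forall u : 'cV[R]_n, (forall i, \sum_l T (f i) l * u l 0 = 0) -> u = 0.
Proof.
move=> h u Tu; apply: (@unit_inj _ _ _ (\matrix_(i, l) T (f i) l)).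
  by rewrite unitmxE unitfE gt_eqF.
apply/matrixP => i j; rewrite [RHS]mxE -[RHS](Tu i) !mxE ord1.
by apply: eq_bigr => l _; rewrite mxE.
Qed.

Definition low_rows (i : 'I_n) : nat := i.

Lemma low_rows_incr : incr low_rows.
Proof. by split=> // i; rewrite /low_rows; have := ltn_ord i; lia. Qed.

(** * Chevalley generators acting on rows *)

Variable d : nat -> R.
Hypothesis d2 : forall k, d k * d k = 1.
Implicit Type M : 'M[R]_(n + n, n).

Lemma tl_xE i a M p l : (p < n + n)%N ->
  tl d (xgen i (eps n d i * a) *m M) p l =
  if (i.+1 < n)%N
  then addrow (n + n - 2 - i) (n + n - 2 - i).+1 a (addrow i i.+1 a (tl d M)) p l
  else addrow i i.+1 a (tl d M) p l.
Proof.
move=> pn; rewrite tl_x // /inJ; have iN := ltn_ord i.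
case: ifP => i1; last first.
  have -> : (n + n - 2 - i = i)%N by lia.
  by rewrite orbb /addrow; case: eqP => [->|]; rewrite ?mul0r.
rewrite /addrow; have -> : ((n + n - 2 - i).+1 == i :> nat) = false by lia.
rewrite !mul0r addr0; case: (p =P i :> nat) => [->|_] /=.
  have -> : (i == n + n - 2 - i :> nat)%N = false by lia.
  by rewrite !mul0r addr0.
by rewrite !mul0r addr0; case: eqP => [->|]; rewrite ?mul0r.
Qed.

Lemma tl_yE i a M p l : (p < n + n)%N ->
  tl d (ygen i (eps n d i * a) *m M) p l =
  if (i.+1 < n)%N
  then addrow (n + n - 2 - i).+1 (n + n - 2 - i) a (addrow i.+1 i a (tl d M)) p l
  else addrow i.+1 i a (tl d M) p l.
Proof.
move=> pn; rewrite tl_y // /inJ; have iN := ltn_ord i.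
case: ifP => i1; last first.
  have -> : (n + n - 2 - i = i)%N by lia.
  have -> : ((0 < p)%N && ((p.-1 == i) || (p.-1 == i)))= (p == i.+1) by lia.
  by rewrite /addrow; case: eqP => [->|]; rewrite ?mul0r.
rewrite /addrow; have -> : ((n + n - 2 - i)%N == i.+1 :> nat) = false by lia.
rewrite !mul0r addr0; case: (p =P i.+1 :> nat) => [->|pi] /=.
  have -> : (i.+1 == (n + n - 2 - i).+1 :> nat)%N = false by lia.
  by rewrite eqxx !mul0r addr0.
have -> : ((0 < p)%N && ((p.-1 == i) || (p.-1 == n + n - 2 - i)%N)) =
  (p == (n + n - 2 - i).+1) by lia.
by rewrite !mul0r addr0; case: eqP => [->|]; rewrite ?mul0r.
Qed.

Lemma tnn_x i a M : 0 <= a -> tnn (tl d M) ->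
  tnn (tl d (xgen i (eps n d i * a) *m M)).
Proof.
move=> a0 tM; have iN := ltn_ord i.
pose T1 := addrow i i.+1 a (tl d M).
have t1 : tnn T1 by apply: addrow_tnn => //; [left | lia].
pose T2 := addrow (n + n - 2 - i) (n + n - 2 - i).+1 a T1.
have t2 : tnn T2 by apply: addrow_tnn => //; [left | lia].
apply: (@eq_tnn (if (i.+1 < n)%N then T2 else T1)); last by case: ifP.
by move=> p l pn; rewrite tl_xE //; case: ifP.
Qed.

Lemma y_tnn_ge i a M : 0 <= a -> tnn (tl d M) ->
  tnn (tl d (ygen i (eps n d i * a) *m M)) /\
  forall f, incr f -> minor f (tl d M) <=
    minor f (tl d (ygen i (eps n d i * a) *m M)).
Proof.
move=> a0 tM; have iN := ltn_ord i.
pose T1 := addrow i.+1 i a (tl d M).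
have i1 : adj i.+1 i by right.
have in1 : (i < n + n)%N by lia.
have t1 : tnn T1 by exact: addrow_tnn.
pose q := (n + n - 2 - i)%N; have q1 : adj q.+1 q by right.
have qn : (q < n + n)%N by rewrite /q; lia.
pose T2 := addrow q.+1 q a T1.
have t2 : tnn T2 by exact: addrow_tnn.
have E p l : (p < n + n)%N -> (if (i.+1 < n)%N then T2 else T1) p l =
    tl d (ygen i (eps n d i * a) *m M) p l.
  by move=> pn; rewrite tl_yE //; case: ifP.
split; first by apply: eq_tnn E _; case: ifP.
move=> f fi; rewrite -(eq_minor fi E).
have h1 : minor f (tl d M) <= minor f T1 by exact: addrow_ge.
by case: ifP => // _; apply: le_trans h1 _; exact: addrow_ge.
Qed.

(** A letter other than the last acts as two commuting transpositions and adds to two rows, so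
    [addrow_pos] is used twice; the mirror symmetry of [state] turns the ascent at [i] into the one
    needed at [q]. *)
Lemma y_pos (i : 'I_n) s a M f : 0 < a -> red (i :: s) -> tnn (tl d M) ->
  incr f -> (forall k, (state s (f k) < n)%N) -> 0 < minor f (tl d M) ->
  exists2 f', incr f' /\ forall k, (state (i :: s) (f' k) < n)%N &
    0 < minor f' (tl d (ygen i (eps n d i * a) *m M)).
Proof.
move=> a0 rs tM fi sf fM; have iN := ltn_ord i; have asc := red_asc rs.
have gi p p' : (p < n + n)%N -> (p' < n + n)%N -> state s p = state s p' -> p = p'.
  exact: state_inj.
have in1 : (i.+1 < n + n)%N by lia.
have [f1 [f1i sf1] f1M] := addrow_pos gi fi tM sf fM asc in1 a0.
have [i1|i1] := boolP (i.+1 < n)%N; last first.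
  have iE : i.+1 = n by lia.
  exists f1.
    by split=> // k; rewrite /= refl_tau_last //; have [_] := f1i.
  rewrite (@eq_minor _ _ (addrow i.+1 i a (tl d M))) //.
  by move=> p l pn; rewrite tl_yE // (negbTE i1).
pose q := (n + n - 2 - i)%N; pose g p := state s (tau i p).
have tau_lt p : (p < n + n)%N -> (tau i p < n + n)%N.
  by rewrite /tau; case: eqP => // _; case: eqP => //; lia.
have tauK p : tau i (tau i p) = p.
  have ne : (i.+1 == i :> nat) = false by lia.
  rewrite {2}/tau; case: eqP => [->|/eqP/negbTE h1]; first by rewrite /tau ne eqxx.
  case: eqP => [->|/eqP/negbTE h2]; first by rewrite /tau eqxx.
  by rewrite /tau h1 h2.
have gi1 p p' : (p < n + n)%N -> (p' < n + n)%N -> g p = g p' -> p = p'.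
  move=> pn pn' /gi h; rewrite -(tauK p) -(tauK p') h //; exact: tau_lt.
have gq : (g q < g q.+1)%N.
  rewrite /g /q /tau; have -> : (n + n - 2 - i == i :> nat)%N = false by lia.
  have -> : (n + n - 2 - i == i.+1 :> nat)%N = false by lia.
  have -> : ((n + n - 2 - i).+1 == i :> nat)%N = false by lia.
  have -> : ((n + n - 2 - i).+1 == i.+1 :> nat)%N = false by lia.
  have -> : (n + n - 2 - i = mirror n i.+1)%N by rewrite /mirror; lia.
  have -> : ((mirror n i.+1).+1 = mirror n i)%N by rewrite /mirror; lia.
  rewrite !state_mirror; try lia.
  have := @state_lt n s i.+1 in1; rewrite /mirror; lia.
have t1 : tnn (addrow i.+1 i a (tl d M)).
  by apply: addrow_tnn => //; [right | lia | exact: ltW].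
have qn : (q.+1 < n + n)%N by rewrite /q; lia.
have [f2 [f2i sf2] f2M] := addrow_pos gi1 f1i t1 sf1 f1M gq qn a0.
exists f2.
  split=> // k; have := sf2 k; rewrite /g /= refl_tau //; have [_] := f2i.
  by [].
rewrite (@eq_minor _ _ (addrow q.+1 q a (addrow i.+1 i a (tl d M)))) //.
by move=> p l pn; rewrite tl_yE // i1.
Qed.

Definition sign_mx : 'M[R]_n := diag_mx (\row_i d i).

(** The signs on the right cancel those of [tl]: the signed rows of this frame are those of the
    identity followed by zeros. *)
Definition signed_frame0 : 'M[R]_(n + n, n) := @frame0 R n *m sign_mx.

Lemma tl_frame0 p l : (p < n + n)%N -> tl d signed_frame0 p l = (p == l)%:R.
Proof.
move=> pn; rewrite /tl /signed_frame0 /frame0 mul_col_mx mul1mx mul0mx.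
have pp := pos_lt pn; rewrite (_ : pos n p = Ordinal pp :> nat) // rowat_ord.
have [h|h] := ltnP p n.
  have -> : Ordinal pp = lshift n (Ordinal h) by apply: val_inj; rewrite /= pos_small.
  rewrite col_mxEu /sign_mx !mxE /sgnpos h.
  have -> : (p - n = 0)%N by lia.
  have -> : (Ordinal h == l) = (p == l :> nat) by [].
  by rewrite expr0 mulr1 /=; case: eqP => _; rewrite ?mulr0n ?mulr0 // mulr1n d2.
have h' : (pos n p - n < n)%N by rewrite /pos; case: ifP; lia.
have -> : Ordinal pp = rshift n (Ordinal h').
  by apply: val_inj; rewrite /= /pos; case: ifP; lia.
rewrite col_mxEd mxE mulr0; have ln := ltn_ord l.
by have -> : (p == l :> nat) = false by lia.
Qed.

Lemma incr_low f (i : 'I_n) : incr f -> (i <= f i)%N.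
Proof.
move=> [fi _]; case: i => i; elim: i => // i IHi hi.
have hi' : (i < n)%N by exact: ltnW.
by apply: leq_ltn_trans (IHi hi') (fi (Ordinal hi') (Ordinal hi) _).
Qed.

Lemma minor_frame0 : minor low_rows (tl d signed_frame0) = 1.
Proof.
rewrite -(det1 R n); congr (\det _); apply/matrixP => i l; rewrite !mxE.
by rewrite tl_frame0 //; have := ltn_ord i; rewrite /low_rows; lia.
Qed.

Lemma tnn_frame0 : tnn (tl d signed_frame0).
Proof.
move=> f fi; have [/existsP[k kf]|/existsPn h] := boolP [exists k, f k != k :> nat].
  rewrite (_ : minor f _ = 0) // /minor.
  have [j jn] : exists j : 'I_n, (n <= f j)%N.
    apply/existsP; apply: contraT; rewrite negb_exists => /forallP h.
    have fn i : (f i < n)%N by have := h i; rewrite -ltnNge.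
    have fk : (k < f k)%N by rewrite ltn_neqAle eq_sym kf incr_low.
    (* An increasing [f] that exceeds the identity at [k] does so from [k] on, so its last value is
       at least n. *)
    have up (i : 'I_n) : (k <= i)%N -> (i < f i)%N.
      case: i => i; elim: i => [|i IHi] hi /= ki.
        have E : Ordinal hi = k by apply: val_inj => /=; lia.
        by rewrite E; lia.
      have [ik|ik] := leqP k i.
        have hi' : (i < n)%N by exact: ltnW.
        by apply: leq_ltn_trans (IHi hi' ik) (fi.1 (Ordinal hi') (Ordinal hi) _).
      have E : Ordinal hi = k by apply: val_inj => /=; lia.
      by have := congr1 val E; rewrite /= E; lia.
    have n1 : (n.-1 < n)%N by have := ltn_ord k; lia.
    have := up (Ordinal n1); have := fn (Ordinal n1) => /=; have := ltn_ord k; lia.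
  rewrite (expand_det_row _ j) big1 // => l _; rewrite mxE tl_frame0; last exact: fi.2.
  by have := ltn_ord l; case: eqP => [e|_]; rewrite ?mul0r //; lia.
rewrite (_ : f = low_rows) ?minor_frame0 //; apply/funext => i.
by have := h i; rewrite negbK => /eqP.
Qed.

End Minors.

(** * The positive and nonnegative parts of one pinning *)

Section PinningCells.
Variables (R : realType) (n : nat) (ep : 'I_n -> R).
Hypothesis ep1 : forall i, ep i = 1 \/ ep i = -1.
Hypothesis ep_last : forall i : 'I_n, i.+1 = n -> ep i = 1.
Local Notation F := 'M[R]_(n + n, n).
Local Notation L := (lagr R n).
Local Notation P := (eps_pinning ep).
Implicit Types (M : F) (x : L).

(* Signs with d i * d (i + 1) = ep i; conjugating by them turns the pinning
   into the standard one. *)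
Definition sgn_of (k : nat) : R := \prod_(j < n | (k <= j)%N) ep j.
Local Notation d := sgn_of.

Lemma ep2 i : ep i * ep i = 1.
Proof. by case: (ep1 i) => ->; ring. Qed.

Lemma sgn_of2 k : d k * d k = 1.
Proof. by rewrite /sgn_of -big_split big1 //= => j _; rewrite ep2. Qed.

Lemma sgn_ofS (i : 'I_n) : d i = ep i * d i.+1.
Proof.
rewrite /sgn_of (bigD1 i) //=; congr (_ * _); apply: eq_bigl => j.
by rewrite -val_eqE /=; lia.
Qed.

Lemma eps_sgn_of (i : 'I_n) : eps n d i = ep i.
Proof.
rewrite /eps; case: ifP => [_|h]; first by rewrite sgn_ofS -mulrA sgn_of2 mulr1.
by rewrite ep_last //; have := ltn_ord i; lia.
Qed.

Lemma rowat_eq M (k : 'I_(n + n)) p l : p = k :> nat -> rowat M p l = M k l.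
Proof. by move=> ->; exact: rowat_ord. Qed.

Local Notation M0 := (signed_frame0 n d).

Lemma unit_sign : sign_mx n d \in unitmx.
Proof.
rewrite unitmxE det_diag unitfE; apply/prodf_neq0 => i _; rewrite mxE.
by apply: contra_eqN (sgn_of2 i) => /eqP ->; rewrite mul0r eq_sym oner_eq0.
Qed.

Lemma dotPJ_frame (X : set 'M[R]_(n + n)) x : dotPJ X x ->
  exists2 g, X g & repr_by x (g *m M0).
Proof.
move=> [_ [g Xg [q Pq <-]] [_ xM]]; exists g => //.
rewrite -mulmxA PJ_plus_frame0 // in xM.
have uq : ulsubmx q \in unitmx.
  have := Sp_unit Pq.1; rewrite -{1}[q]submxK Pq.2 !unitmxE det_ublock unitrM.
  by case/andP.
have h : invmx (ulsubmx q) *m sign_mx n d \in unitmx.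
  by rewrite unitmx_mul unitmx_inv uq unit_sign.
have := repr_mulr h xM; rewrite /signed_frame0.
by rewrite -!mulmxA mulKVmx.
Qed.

Lemma frame_dotPJ (X : set 'M[R]_(n + n)) g x M h : X g -> Sp g ->
  h \in unitmx -> repr_by x M -> g *m @frame0 R n = M *m h -> dotPJ X x.
Proof.
move=> Xg Sg uh xM E; exists g; last by split=> //; rewrite E; exact: repr_mulr.
exists g => //; exists 1%:M; rewrite ?mulmx1 //; split; first exact: Sp1.
by rewrite (scalar_mx_block _ _ 1) block_mxKdl.
Qed.

(** * Stability under the nonnegative monoid *)

Lemma gram_levi (D E : 'M[R]_n) M : Sp (block_mx D 0 0 E) ->
  gram (block_mx D 0 0 E *m M) = gram M.
Proof.
case=> _; rewrite block_mxKul block_mxKdl block_mxKdr trmx0 mul0mx subr0 => DE _ _.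
rewrite -{1}[M]vsubmxK mul_block_col !mul0mx addr0 add0r gram_col trmx_mul.
by rewrite -mulmxA (mulmxA _ E) DE mul1mx.
Qed.

Lemma psd_delta i a : 0 <= a -> pos_semidef (a *: delta_mx i i : 'M[R]_n).
Proof.
move=> a0; apply: psdZ => //; have := psd_gram (delta_mx i i : 'M[R]_n).
by rewrite trmx_delta mul_delta_mx.
Qed.

(** Generators in the Levi subgroup do not change A^T C, and the last one adds a semidefinite term
    C^T (a E) C. *)
Lemma psd_x i a M : lag_frame M -> 0 < a -> pos_semidef (gram M) ->
  pos_semidef (gram (xgen i (ep i * a) *m M)).
Proof.
move=> lM a0 pM; have := Sp_xgen i (ep i * a); rewrite xgen_block.
case: ifP => [_ /gram_levi ->//|h _].
have iE : i.+1 = n by have := ltn_ord i; lia.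
have pS := psd_delta i (ltW a0).
rewrite ep_last // mul1r -{1}[M]vsubmxK upp_mul_col gram_col trmxD mulmxDl.
by rewrite trmx_mul pS.1; apply: psdD => //; exact: psd_congr.
Qed.

Lemma psd_y i a M : lag_frame M -> 0 < a -> pos_semidef (gram M) ->
  pos_semidef (gram (ygen i (ep i * a) *m M)).
Proof.
move=> lM a0 pM; have := Sp_ygen i (ep i * a); rewrite ygen_block.
case: ifP => [_ /gram_levi ->//|h _].
have iE : i.+1 = n by have := ltn_ord i; lia.
have pS := psd_delta i (ltW a0).
rewrite ep_last // mul1r -{1}[M]vsubmxK low_mul_col gram_col mulmxDr.
by rewrite mulmxA addrC; apply: psdD => //; exact: psd_congr.
Qed.

Lemma Sp_torus_pos t : @torus_pos R n t -> Sp t.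
Proof.
move=> [a a0 tE]; have /torus_diag[//] : torus t.
by exists a => // i; rewrite gt_eqF.
Qed.

Lemma G_nneg_Sp g : G_nneg P g -> Sp g.
Proof.
elim=> [|t|i a _|i a _|h k _ Sh _ Sk]; first exact: Sp1.
- exact: Sp_torus_pos.
- exact: Sp_xgen.
- exact: Sp_ygen.
- exact: Sp_mul.
Qed.

Lemma G_nneg_psd g : G_nneg P g -> forall M, lag_frame M ->
  pos_semidef (gram M) -> pos_semidef (gram (g *m M)).
Proof.
elim=> [|t tT|i a a0|i a a0|h k Gh ph Gk pk] M lM pM.
- by rewrite mul1mx.
- have := Sp_torus_pos tT; case: tT => a _ ->; rewrite /diag_sp => /gram_levi ->.
  exact: pM.
- exact: psd_x.
- exact: psd_y.
- rewrite -mulmxA; apply: ph; last exact: pk.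
  by apply: lag_mul => //; exact: G_nneg_Sp.
Qed.

Lemma tnn_torus t M : @torus_pos R n t -> tnn (tl d M) -> tnn (tl d (t *m M)).
Proof.
move=> [a a0 ->] tM f fi; have [_ fb] := fi.
pose b := row_mx a (\row_i (a 0 i)^-1).
have b0 k : 0 < b 0 k.
  rewrite mxE; case: fintype.split => j; first exact: a0.
  by rewrite mxE invr_gt0 a0.
have rowE p l (h : (pos n p < n + n)%N) :
    tl d (diag_sp a *m M) p l = b 0 (Ordinal h) * tl d M p l.
  rewrite /tl !(@rowat_eq _ (Ordinal h)) // diag_sp_mx.
  by rewrite mul_diag_mx mxE; ring.
pose c : 'rV[R]_n := \row_i b 0 (Ordinal (pos_lt (fb i))).
rewrite (_ : minor f _ = (\prod_i c 0 i) * minor f (tl d M)).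
  by apply: mulr_ge0; [apply: prodr_ge0 => i _; rewrite mxE ltW | exact: tM].
rewrite /minor -det_diag -det_mulmx; congr (\det _); apply/matrixP => i l.
rewrite [LHS]mxE (rowE _ _ (pos_lt (fb i))) mul_diag_mx [RHS]mxE [c 0 i]mxE.
by congr (_ * _); rewrite [RHS]mxE.
Qed.

Lemma G_nneg_tnn g : G_nneg P g -> forall M, tnn (tl d M) -> tnn (tl d (g *m M)).
Proof.
elim=> [|t tT|i a a0|i a a0|h k Gh ph Gk pk] M tM.
- by rewrite mul1mx.
- exact: tnn_torus.
- by rewrite /= -eps_sgn_of; apply: tnn_x => //; [exact: sgn_of2 | exact: ltW].
- rewrite /= -eps_sgn_of.
  by have [] := y_tnn_ge sgn_of2 i (ltW a0) tM.
- by rewrite -mulmxA; apply: ph; exact: pk.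
Qed.

Lemma lag_M0 : lag_frame M0.
Proof. by apply: lag_mulr; [exact: unit_sign | exact: lag_frame0]. Qed.

Lemma psd_M0 : pos_semidef (gram M0).
Proof.
rewrite gram_mulr; apply: psd_congr; rewrite gram_col mulmx0.
by split=> [|u]; rewrite ?trmx0 // mulmx0 mul0mx mxE.
Qed.

Lemma dotPJ_nneg x : dotPJ (G_nneg P) x -> @lagr_nneg R n x.
Proof.
move=> /dotPJ_frame[g Gg xM]; apply/(lagr_nnegP xM).
by apply: (G_nneg_psd Gg); [exact: lag_M0 | exact: psd_M0].
Qed.

Lemma pin_nneg_sub : lagr_pin_nneg P `<=` @lagr_nneg R n.
Proof.
rewrite [X in _ `<=` X]((closure_id _).1 (@lagr_nneg_closed R n)).
apply: closureS; exact: dotPJ_nneg.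
Qed.

(** * The open cell of a pinning *)

Lemma PJ_plus_x i a : @PJ_plus R n (xgen i a).
Proof.
split; first exact: Sp_xgen.
by rewrite xgen_block; case: ifP => _; rewrite /upp block_mxKdl.
Qed.

Lemma PJ_plus_M (g h : 'M[R]_(n + n)) : PJ_plus g -> PJ_plus h -> PJ_plus (g *m h).
Proof.
move=> [Sg g0] [Sh h0]; split; first exact: Sp_mul.
by rewrite -[g]submxK -[h]submxK g0 h0 mulmx_block block_mxKdl !mul0mx mulmx0 addr0.
Qed.

Lemma PJ_plus_1 : @PJ_plus R n 1%:M.
Proof. by split; [exact: Sp1 | rewrite (scalar_mx_block n n 1) block_mxKdl]. Qed.

(** T and U^+ lie in P_J^+, so they disappear in the quotient. *)
Lemma pin_pos_minus x : lagr_pin_pos P x -> dotPJ (U_minus P) x.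
Proof.
move=> [_ [_ [_ [u Uu [t tT <-]] [v Uv <-]] [q Pq <-]] xg].
exists (u *m t *m v *m q) => //; exists u => //; exists (t *m (v *m q)); last first.
  by rewrite !mulmxA.
have Pt : PJ_plus t.
  split; first exact: Sp_torus_pos.
  by have [a _ ->] := tT; rewrite /diag_sp block_mxKdl.
apply: PJ_plus_M => //; apply: PJ_plus_M => //.
have [s [_ _ ->]] := Uv; elim: s => [|c s IHs]; first by rewrite big_nil; exact: PJ_plus_1.
by rewrite big_cons; apply: PJ_plus_M => //; exact: PJ_plus_x.
Qed.

(** Along the word [f] follows the positions that [state] sends below n, where the minor stays
    positive, while the minor of the first n rows starts at 1 and never decreases. *)
Lemma y_product_minor s : red (unzip1 s) -> all (fun c => 0 < c.2) s ->
  let M := (\prod_(c <- s) ygen c.1 (ep c.1 * c.2)) *m M0 in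
  [/\ lag_frame M, pos_semidef (gram M), tnn (tl d M),
      1 <= minor (@low_rows n) (tl d M) &
      exists2 f, incr f /\ (forall k, (state (unzip1 s) (f k) < n)%N) &
        0 < minor f (tl d M)].
Proof.
elim: s => [|[i a] s IHs] rs.
  move=> _ /=; rewrite big_nil mul1mx; split.
  - exact: lag_M0.
  - exact: psd_M0.
  - by apply: tnn_frame0; exact: sgn_of2.
  - by rewrite minor_frame0 //; exact: sgn_of2.
  - exists (@low_rows n); last by rewrite minor_frame0 //; exact: sgn_of2.
    by split; [exact: low_rows_incr | move=> k; exact: ltn_ord].
move=> /andP[/= a0 sa]; have [|//|] := IHs.
  exact: red_tail rs.
move=> lM pM tM mM [f [fi sf] fM]; rewrite big_cons /= -[_ *m M0]mulmxA.
move: lM pM tM mM fM; set M := _ *m M0 => lM pM tM mM fM; clearbody M.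
have [t1 ge1] := y_tnn_ge sgn_of2 i (ltW a0) tM.
have [f' [fi' sf'] fM'] := y_pos sgn_of2 a0 rs tM fi sf fM.
rewrite eps_sgn_of in t1 ge1 fM'; split=> //.
- by apply: lag_mul => //; exact: Sp_ygen.
- exact: psd_y.
- by apply: le_trans mM (ge1 _ _); exact: low_rows_incr.
- by exists f'.
Qed.

Lemma longest_word (w : set 'M[R]_(n + n)) s : longest w -> reduced w s ->
  red s /\ forall i, (i < n)%N -> flipped s i.
Proof.
move=> [ww lw] rw; have [wE rs] := reduced_word ww rw.
split=> // i; apply: (longest_flipped rs) => s' rs'.
have := lw _ (weyl_word R s'); rewrite wE !wlength_red //.
Qed.

Lemma usub_inj M f : 0 < minor f (tl d M) ->
  (forall i, (f i < n)%N) -> usubmx M \in unitmx.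
Proof.
move=> h fn; apply: inj_unitmx => u Mu; apply: (minor_inj h) => i.
transitivity (sgnpos n d (f i) * (usubmx M *m u) (Ordinal (fn i)) 0).
  rewrite mxE mulr_sumr; apply: eq_bigr => l _; rewrite /tl mxE pos_small //.
  by rewrite (@rowat_eq _ (lshift n (Ordinal (fn i)))) //; ring.
by rewrite Mu mxE mulr0.
Qed.

Lemma dsub_inj M f : 0 < minor f (tl d M) ->
  (forall i, (n <= f i < n + n)%N) -> dsubmx M \in unitmx.
Proof.
move=> h fn; apply: inj_unitmx => u Mu; apply: (minor_inj h) => i.
have pn : (n + n - 1 - f i < n)%N by have := fn i; have := ltn_ord i; lia.
transitivity (sgnpos n d (f i) * (dsubmx M *m u) (Ordinal pn) 0).
  rewrite mxE mulr_sumr; apply: eq_bigr => l _; rewrite /tl mxE.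
  rewrite (@rowat_eq _ (rshift n (Ordinal pn))); first by ring.
  by rewrite /pos /=; have := fn i; case: ifP; lia.
by rewrite Mu mxE mulr0.
Qed.

Lemma U_minus_pos x : dotPJ (U_minus P) x -> @lagr_pos R n x.
Proof.
move=> /dotPJ_frame[_ [s [[w lw rw] sa ->]] xM].
have [rs fl] := longest_word lw rw.
have [_ pM tM mM [f [fi sf] fM]] := y_product_minor rs sa.
apply/(lagr_posP xM); apply: psd_unit_pos_def => //.
rewrite /gram unitmx_mul unitmx_tr; apply/andP; split.
  by apply: (@usub_inj _ (@low_rows n)); [exact: lt_le_trans ltr01 mM | exact: ltn_ord].
(* The longest word flips every position below n, so all values of [f] are at least n and its minor
   involves rows of C only. *)
apply: (dsub_inj fM) => i; rewrite (fi.2 i) andbT leqNgt; apply/negP => h.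
by have := fl _ h; rewrite /flipped leqNgt sf.
Qed.

(** * Signs of the entries of K for the point [1; K] *)

(** The factor (-1)^k comes from the reversed order of the rows of C in the list of positions. *)
Definition sg (k : nat) : R := d k * (-1) ^+ k.

Lemma sg2 k : sg k * sg k = 1.
Proof.
rewrite /sg mulrACA sgn_of2 mul1r -expr2; exact: sqrr_sign.
Qed.

Lemma sgS (i : 'I_n) : sg i.+1 = - (sg i * ep i).
Proof.
rewrite /sg sgn_ofS exprS; have := ep2 i.
move: (ep i) (d _) (_ ^+ _) => e y z e2.
by transitivity (- ((e * e) * y * z)); [rewrite e2; ring | ring].
Qed.

Definition khat (K : 'M[R]_n) (i j : 'I_n) : R := sg i * sg j * K i j.

(** Invariant of the products of y_i, which start at K = 0: an entry next to the diagonal is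
    required to be positive only once the diagonal entry of its row is. *)
Definition khat_pos (K : 'M[R]_n) := [/\ K^T = K, forall i j, 0 <= khat K i j &
  forall i j : 'I_n, j = i.+1 :> nat -> 0 < khat K i i -> 0 < khat K i j].

(** In the chart [1; K] the generators act by unipotent congruence, except the last, which changes
    one diagonal entry. *)
Lemma y_chart i b (K : 'M[R]_n) : exists2 h, h \in unitmx &
  ygen i b *m col_mx 1%:M K = col_mx (1%:M : 'M[R]_n)
    (if (i.+1 < n)%N then (1%:M - b *: Umx R i) *m K *m (1%:M - b *: Umx R i)^T
     else K + b *: delta_mx i i) *m h.
Proof.
rewrite ygen_block; case: ifP => h.
  have E := Umx_invN i b.
  have uP : 1%:M + b *: Umx R i \in unitmx by have [] := mulmx1_unit E.
  exists (1%:M + b *: (Umx R i)^T); first by rewrite -trmxZ -trmx1 -trmxD unitmx_tr.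
  rewrite mul_block_col mul_col_mx !mul0mx !mul1mx mulmx1 addr0 add0r.
  congr col_mx; rewrite -[RHS]mulmxA.
  rewrite (_ : _^T *m _ = 1%:M) ?mulmx1 //.
  have := congr1 trmx (Umx_inv i b).
  by rewrite trmx_mul [(1%:M + _ *: _)^T]trmxD [(_ *: _)^T in X in _ *m X]trmxZ !trmx1.
exists 1%:M; first exact: unitmx1.
by rewrite mulmx1 low_mul_col mulmx1 addrC.
Qed.

Lemma Umx_conj (i i1 : 'I_n) b K k l : i1 = i.+1 :> nat ->
  ((1%:M - b *: Umx R i) *m K *m (1%:M - b *: Umx R i)^T) k l =
  K k l - (k == i)%:R * b * K i1 l - (l == i)%:R * b * K k i1 +
  (k == i)%:R * (l == i)%:R * b ^+ 2 * K i1 i1.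
Proof.
move=> i1E.
have mulU (A : 'M[R]_n) k' l' : (Umx R i *m A) k' l' = (k' == i)%:R * A i1 l'.
  rewrite mxE (bigD1 i1) //= big1 ?addr0 => [|j ji]; rewrite !mxE.
    by rewrite i1E eqxx andbT.
  have -> : (j == i.+1 :> nat) = false by rewrite -i1E val_eqE (negbTE ji).
  by rewrite andbF mul0r.
have mulUT (A : 'M[R]_n) k' l' : (A *m (Umx R i)^T) k' l' = (l' == i)%:R * A k' i1.
  by rewrite -[A]trmxK -trmx_mul mxE mulU [A^T^T]trmxK mxE.
rewrite trmxB trmx1 trmxZ mulmxBr mulmx1 mulmxBl mul1mx -scalemxAl -scalemxAr.
rewrite !(addmxE, oppmxE, scalemxE) mulUT !(addmxE, oppmxE, scalemxE) !mulU.
by ring.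
Qed.

Lemma khat_y (i : 'I_n) a K : 0 < a -> khat_pos K ->
  khat_pos (if (i.+1 < n)%N
    then (1%:M - (ep i * a) *: Umx R i) *m K *m (1%:M - (ep i * a) *: Umx R i)^T
    else K + (ep i * a) *: delta_mx i i).
Proof.
move=> a0 [sK K0 K1]; case: ifP => h; last first.
  have iE : i.+1 = n by have := ltn_ord i; lia.
  have dE (k l : 'I_n) : khat (K + (ep i * a) *: delta_mx i i) k l =
      khat K k l + ((k == i) && (l == i))%:R * a.
    rewrite ep_last // mul1r /khat !mxE; case: (k =P i) => [->|_] /=; last by ring.
    case: (l =P i) => [->|_] /=; last by ring.
    by rewrite !mulrDr sg2 mulr1.
  split=> [|k l|k l kl]; first by rewrite trmxD trmxZ trmx_delta sK.
    by rewrite dE; apply: addr_ge0; rewrite ?K0 // mulr_ge0 ?ler0n ?ltW.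
  rewrite !dE; case: (k =P i) => [ki|_] /=.
    by have := ltn_ord l; rewrite kl ki iE ltnn.
  by rewrite !mul0r !addr0; exact: K1.
pose i1 := Ordinal h.
set K' := _ *m _.
have E (k l : 'I_n) : khat K' k l = khat K k l + (k == i)%:R * a * khat K i1 l +
    (l == i)%:R * a * khat K k i1 + (k == i)%:R * (l == i)%:R * a ^+ 2 * khat K i1 i1.
  rewrite /khat /K' (@Umx_conj i i1) //= sgS.
  case: (k =P i) => [->|_]; case: (l =P i) => [->|_] /=; first by ring.
  - by ring.
  - by ring.
  - by ring.
split=> [|k l|k l kl].
- by rewrite /K' !trmx_mul trmxK sK mulmxA.
- rewrite E; apply: addr_ge0; first apply: addr_ge0; first apply: addr_ge0.
  + exact: K0.
  + by apply: mulr_ge0 => //; rewrite mulr_ge0 ?ler0n // ltW.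
  + by apply: mulr_ge0 => //; rewrite mulr_ge0 ?ler0n // ltW.
  + apply: mulr_ge0 => //; apply: mulr_ge0; last by rewrite exprn_ge0 // ltW.
    by rewrite mulr_ge0 ?ler0n.
rewrite !E; case: (k =P i) kl => [->|_] kl /=; last first.
  rewrite !mul0r !addr0 => /(K1 _ _ kl) hk; apply: ltr_wpDr => //.
  by apply: mulr_ge0 => //; rewrite mulr_ge0 ?ler0n // ltW.
have -> : l = i1 by exact: val_inj.
have -> : (i1 == i) = false by rewrite -val_eqE /=; lia.
have -> : khat K i1 i = khat K i i1 by rewrite /khat -{1}sK mxE; ring.
rewrite !mulr0 !mul0r !addr0 !mul1r.
(* With x, y, z the entries (i, i), (i, i + 1), (i + 1, i + 1), the new entry is y + a z. If y = z =
   0, the new diagonal entry is x, and x > 0 would give y > 0. *)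
have h1 := K0 i i1; have h2 := K0 i1 i1; have := K1 i i1 erefl.
move: (khat K i i) (khat K i i1) (khat K i1 i1) h1 h2 => x y z y0 z0 xy hx.
have [yp|yp] := ltP 0 y; first by rewrite ltr_wpDr // mulr_ge0 // ltW.
have yE : y = 0 by apply/le_anti; rewrite yp y0.
have [zp|zp] := ltP 0 z; first by rewrite ltr_wpDl // mulr_gt0.
have zE : z = 0 by apply/le_anti; rewrite zp z0.
by move: hx xy; rewrite yE zE !mulr0 !addr0 => hx /(_ hx); rewrite ltxx.
Qed.

Lemma y_product_khat s : all (fun c => 0 < c.2) s ->
  exists K h, [/\ h \in unitmx, khat_pos K &
    (\prod_(c <- s) ygen c.1 (ep c.1 * c.2)) *m @frame0 R n = col_mx 1%:M K *m h].
Proof.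
elim: s => [|[i a] s IHs].
  exists 0, 1%:M; rewrite big_nil mul1mx mulmx1 unitmx1; split=> //.
  by split=> [|i j|i j _]; rewrite ?trmx0 // /khat mxE mulr0 ?ltxx.
move=> /andP[/= a0 /IHs[K [h [uh pK E]]]].
rewrite big_cons -[X in X *m _]/(_ *m _) -mulmxA E mulmxA.
have [h' uh' ->] := y_chart i (ep i * a) K.
eexists; exists (h' *m h); split; last by rewrite mulmxA.
  by rewrite unitmx_mul uh' uh.
exact: khat_y.
Qed.

Lemma pin_pos_sub : lagr_pin_pos P `<=` @lagr_pos R n.
Proof. by move=> x /pin_pos_minus/U_minus_pos. Qed.

Lemma pin_pos_khat x : lagr_pin_pos P x ->
  exists2 K, repr_by x (col_mx 1%:M K) &
    forall i j : 'I_n, j = i.+1 :> nat -> 0 < - ep i * K i j.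
Proof.
move=> xP; have [u [s [_ sa ->]] xM] := dotPJ_frame (pin_pos_minus xP).
have [K [h [uh [_ _ K1] E]]] := y_product_khat sa.
have xK : repr_by x (col_mx 1%:M K).
  have := repr_mulr (_ : invmx (sign_mx n d) *m invmx h \in unitmx) xM.
  rewrite unitmx_mul !unitmx_inv uh unit_sign => /(_ isT).
  by rewrite /signed_frame0 !mulmxA mulmxK ?unit_sign // E mulmxK.
exists K => // i j ij.
have /(lagr_posP xK) pK := pin_pos_sub xP.
rewrite gram_col trmx1 mul1mx in pK.
have Kii : 0 < K i i.
  have e0 : (delta_mx i 0 : 'cV[R]_n) != 0.
    by apply/eqP => /matrixP/(_ i 0)/eqP; rewrite !mxE !eqxx oner_eq0.
  by have := pK.2 _ e0; rewrite trmx_delta -rowE -colE !mxE.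
have : 0 < khat K i j by apply: K1 => //; rewrite /khat sg2 mul1r.
rewrite /khat ij sgS (_ : _ * _ * _ = - (sg i * sg i) * (ep i * K i j)); last by ring.
by rewrite sg2 mulN1r mulNr.
Qed.

End PinningCells.

(** * Entries of K as minors of the frame [1; K] *)

Section MinorOfGraph.
Variables (R : realType) (m : nat) (d : nat -> R).
Hypothesis d2 : forall k, d k * d k = 1.
Local Notation n := m.+1.
Variables (K : 'M[R]_n) (b i0 : 'I_n).
Local Notation M := (col_mx 1%:M K : 'M[R]_(n + n, n)).

(** The first n positions with [i0] left out, followed by the position of row [b] of the lower
    block; up to sign the minor is one entry of [K]. *)
Definition swap_rows (i : 'I_n) : nat :=
  if (i.+1 < n)%N then bump i0 i else mirror n b.

Lemma swap_rows_incr : incr swap_rows.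
Proof.
split=> [i j ij|i]; rewrite /swap_rows /bump /mirror; last first.
  by have := ltn_ord b; have := ltn_ord i; case: ifP; case: leqP => //=; lia.
have := ltn_ord b; have := ltn_ord i; have := ltn_ord j.
by do 2 case: ifP => ?; do ?[case: leqP => ? /=]; lia.
Qed.

Lemma tl_graph_low p l : (p < n)%N -> tl d M p l = d p * (p == l)%:R.
Proof.
move=> pn; rewrite /tl (@rowat_eq _ _ _ (lshift n (Ordinal pn))); last exact: pos_small.
rewrite col_mxEu mxE /sgnpos pn; have -> : (p - n = 0)%N by lia.
by rewrite expr0 mulr1.
Qed.

Lemma tl_graph_mirror l : tl d M (mirror n b) l = d b * (-1) ^+ (m - b) * K b l.
Proof.
have bn := ltn_ord b.
rewrite /tl (@rowat_eq _ _ _ (rshift n b)); last exact: pos_mirror.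
rewrite col_mxEd /sgnpos /mirror; have -> : (n + n - 1 - b < n)%N = false by lia.
by do 2 congr (_ * _); [congr d; lia | congr (_ ^+ _); lia].
Qed.

(** A change of frame multiplies both minors by its determinant, so the sign of their product
    belongs to the point; here it is that of [K b i0] up to the signs of [khat]. *)
Lemma minor_graph : minor (@low_rows n) (tl d M) * minor swap_rows (tl d M) =
  (d i0 * (-1) ^+ i0) * (d b * (-1) ^+ b) * K b i0.
Proof.
have -> : minor (@low_rows n) (tl d M) = \prod_(i < n) d i.
  rewrite /minor (_ : (\matrix_(_, _) _) = diag_mx (\row_i d i)).
    by rewrite det_diag; apply: eq_bigr => i _; rewrite mxE.
  apply/matrixP => i l; rewrite !mxE tl_graph_low ?ltn_ord //.
  by rewrite /low_rows -[(_ == _ :> nat)]/(i == l); case: eqP => _;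
    rewrite ?mulr1 ?mulr0.
set q := \prod_(i < n) d i.
rewrite /minor (expand_det_col _ i0) (bigD1 ord_max) //= big1 => [|i im]; last first.
  have iM : (i < m)%N by rewrite ltn_neqAle -ltnS ltn_ord andbT; exact: im.
  rewrite mxE /swap_rows ltnS iM tl_graph_low; last first.
    by rewrite /bump; case: leqP => /=; lia.
  have -> : (bump i0 i == i0) = false by apply/negbTE; rewrite eq_sym neq_bump.
  by rewrite mulr0 mul0r.
rewrite addr0 mxE /swap_rows /= ltnn tl_graph_mirror.
rewrite /cofactor (_ : row' _ _ = diag_mx (\row_i d (lift i0 i))); last first.
  apply/matrixP => i l; rewrite !mxE /swap_rows lift_max ltnS ltn_ord.
  rewrite tl_graph_low; last by rewrite /bump; have := ltn_ord i; case: leqP => /=; lia.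
  rewrite -[bump i0 i]/(val (lift i0 i)) val_eqE (inj_eq lift_inj).
  by case: eqP => [->|_]; rewrite ?mulr1 ?mulr0.
rewrite det_diag (eq_bigr (fun i => d (lift i0 i))) => [|i _]; last by rewrite mxE.
set p := \prod_(i < m) _.
have -> : q = d i0 * p by rewrite /q (bigD1_ord i0).
have p2 : p * p = 1 by rewrite /p -big_split big1 //= => i _; exact: d2.
have s2 : (-1) ^+ m * (-1) ^+ m = 1 :> R by rewrite -expr2 sqrr_sign.
have sE : (-1) ^+ (m - b) * (-1) ^+ b = (-1) ^+ m :> R.
  by rewrite -exprD subnK // -ltnS ltn_ord.
have b2 : (-1) ^+ b * (-1) ^+ b = 1 :> R by rewrite -expr2 sqrr_sign.
rewrite exprD; move: ((-1) ^+ m) ((-1) ^+ (m - b)) ((-1) ^+ b) ((-1) ^+ i0)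
  (d i0) (d b) s2 sE b2 => x y z w u v x2 xE z2.
have -> : u * p * (v * y * K b i0 * (x * w * p)) =
    (p * p) * (y * x) * (u * w * v * K b i0) by ring.
rewrite p2 (_ : y * x = z) ?mul1r; first by ring.
transitivity ((y * z) * x * z); last by rewrite xE x2 mul1r.
by transitivity (y * x * (z * z)); [rewrite z2 mulr1 | ring].
Qed.

End MinorOfGraph.

(** * All pinnings together: disjointness, inclusions and the case n = 2 *)

Section Pinnings.
Variables (R : realType) (n : nat).
Local Notation L := (lagr R n).

Lemma repr_graph_inj (x : L) (K K' : 'M[R]_n) :
  repr_by x (col_mx 1%:M K) -> repr_by x (col_mx 1%:M K') -> K = K'.
Proof.
move=> xK xK'; have [h _] := (repr_eqP xK xK').1 erefl.
by rewrite mul_col_mx mul1mx => /eq_col_mx[<- ->]; rewrite mulmx1.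
Qed.

Lemma pins_disjoint : trivIset (@pinC R n) (@lagr_pin_pos R n).
Proof.
move=> _ _ [e [e1 el] <-] [e' [e1' el'] <-] [x [xe xe']].
suff -> : e = e' by [].
have [K xK Ke] := pin_pos_khat e1 el xe; have [K' xK' Ke'] := pin_pos_khat e1' el' xe'.
rewrite -(repr_graph_inj xK xK') in Ke'; apply/funext => i.
have [h|h] := ltnP i.+1 n; last by rewrite el ?el' //; have := ltn_ord i; lia.
have := Ke i (Ordinal h) erefl; have := Ke' i (Ordinal h) erefl.
by case: (e1 i) => ->; case: (e1' i) => -> //; lra.
Qed.

Lemma pins_pos_sub : \bigcup_(p in @pinC R n) lagr_pin_pos p `<=` @lagr_pos R n.
Proof. by move=> x [_ [e [e1 el] <-]]; exact: pin_pos_sub. Qed.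

Lemma pins_pos_proper : (1 < n)%N ->
  \bigcup_(p in @pinC R n) lagr_pin_pos p <> @lagr_pos R n.
Proof.
(* The identity matrix is positive definite with zeros next to the diagonal, where points of the
   cells have nonzero entries. *)
move=> n1 E; have [x x1] := repr_ex (lag_sym (trmx1 R n)).
have : @lagr_pos R n x by exists 1%:M => //; exact: pos_def1.
rewrite -E => -[_ [e [e1 el] <-] xe].
have [K xK Ke] := pin_pos_khat e1 el xe.
have n0 : (0 < n)%N by lia.
have := Ke (Ordinal n0) (Ordinal n1) erefl.
by rewrite -(repr_graph_inj x1 xK) mxE /= mulr0 ltxx.
Qed.

Lemma pins_nneg_sub : \bigcup_(p in @pinC R n) lagr_pin_nneg p `<=` @lagr_nneg R n.
Proof. by move=> x [_ [e [e1 el] <-]]; exact: pin_nneg_sub. Qed.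

(** * The rank two case *)

(** For n = 2 the values 1 and -1 of [s] give all of [pinC]. *)
Definition const_sign (s : R) (i : 'I_n) : R := if (i.+1 < n)%N then s else 1.

Lemma const_sign1 s : s = 1 \/ s = -1 -> forall i, const_sign s i = 1 \/ const_sign s i = -1.
Proof. by move=> h i; rewrite /const_sign; case: ifP => // _; left. Qed.

Lemma const_sign_last s (i : 'I_n) : i.+1 = n -> const_sign s i = 1.
Proof. by rewrite /const_sign => ->; rewrite ltnn. Qed.

Lemma pos_def_entry (K : 'M[R]_n) i : pos_def K -> 0 < K i i.
Proof.
move=> pK; have e0 : (delta_mx i 0 : 'cV[R]_n) != 0.
  by apply/eqP => /matrixP/(_ i 0)/eqP; rewrite !mxE !eqxx oner_eq0.
by have := pK.2 _ e0; rewrite trmx_delta -rowE -colE !mxE.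
Qed.

Lemma pos_def_minor2 (K : 'M[R]_n) i j : i != j -> pos_def K ->
  K i j ^+ 2 < K i i * K j j.
Proof.
move=> ij pK; have p0 := pos_def_entry i pK.
(* The form takes the value K_ii (K_ii K_jj - K_ij^2) at this vector. *)
pose u : 'cV[R]_n := K i j *: delta_mx i 0 + (- K i i) *: delta_mx j 0.
have u0 : u != 0.
  apply/eqP => /matrixP/(_ j 0)/eqP; rewrite !mxE !eqxx [j == i]eq_sym (negbTE ij).
  by rewrite mulr0 add0r mulr1 oppr_eq0 gt_eqF.
have := pK.2 _ u0; rewrite -/(qf _ _) /u qf_bilin ?pK.1 // !qf_scale.
rewrite trmxZ -!scalemxAl -scalemxAr !scalemxE /qf !trmx_delta -!rowE -!colE !mxE.
have -> : K j i = K i j by rewrite -{1}pK.1 mxE.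
rewrite (_ : _ + _ = K i i * (K i i * K j j - K i j ^+ 2)).
  by rewrite pmulr_rgt0 // subr_gt0.
by rewrite sqrrN mulr2n; ring.
Qed.

Section RankTwo.
Hypothesis n2 : n = 2%N.
Variables (i0 i1 : 'I_n).
Hypotheses (i00 : i0 = 0%N :> nat) (i11 : i1 = 1%N :> nat).

Lemma rank2_cell s K x : s = 1 \/ s = -1 -> pos_def K -> 0 < - s * K i0 i1 ->
  repr_by x (col_mx 1%:M K) -> dotPJ (G_nneg (eps_pinning (const_sign s))) x.
Proof.
move=> s1 pK sK xK; have ex k : k = i0 \/ k = i1.
  have kn := ltn_ord k; rewrite [X in (_ < X)%N]n2 in kn.
  have [k0|k1] := eqVneq (val k) 0%N; [left|right]; apply: val_inj.
    by rewrite [LHS]k0 [RHS]i00.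
  by rewrite [RHS]i11; apply/eqP; rewrite eqn_leq -ltnS kn lt0n k1.
have p0 := pos_def_entry i0 pK.
have i01 : i0 != i1 by rewrite -val_eqE /= i00 i11.
have D := pos_def_minor2 i01 pK.
set q := K i0 i1 in sK D; set p := K i0 i0 in p0 D; set r := K i1 i1 in D.
(* Solves K = [p q; q r] for the product y_2(c) y_1(s a) y_2(r0), which requires p = a^2 r0, q = - s
   a r0 and r = r0 + c; c > 0 is the positivity of det K. *)
pose a := p / (- s * q); have a0 : 0 < a by rewrite divr_gt0.
have q0 : q != 0 by apply: contraTneq sK => ->; rewrite mulr0 ltxx.
pose r0 := q ^+ 2 / p; have r00 : 0 < r0 by rewrite divr_gt0 // exprn_even_gt0.
pose c := r - r0; have c0 : 0 < c.
  by rewrite /c subr_gt0 /r0 ltr_pdivrMr // mulrC.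
have [h1 u1 E1] := y_chart i1 r0 0; have [h2 u2 E2] := y_chart i0 (s * a) (r0 *: delta_mx i1 i1).
have [h3 u3 E3] := y_chart i1 c ((1%:M - (s * a) *: Umx R i0) *m
  (r0 *: delta_mx i1 i1) *m (1%:M - (s * a) *: Umx R i0)^T).
have l1 : (i1.+1 < n)%N = false by lia.
have l0 : (i0.+1 < n)%N by lia.
rewrite l1 add0r in E1; rewrite l0 in E2; rewrite l1 in E3.
have KE : (1%:M - (s * a) *: Umx R i0) *m (r0 *: delta_mx i1 i1) *m
    (1%:M - (s * a) *: Umx R i0)^T + c *: delta_mx i1 i1 = K.
  have i10 : (i1 == i0) = false by rewrite eq_sym (negbTE i01).
  have e00 : p = s * s * a ^+ 2 * r0.
    rewrite /a /r0; have s2 : s * s = 1 by case: s1 => ->; ring.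
    have s0 : s != 0 by apply: contra_eqN s2 => /eqP ->; rewrite mul0r eq_sym oner_eq0.
    by field; rewrite s0 q0 gt_eqF.
  have e01 : q = - (s * a * r0).
    rewrite /a /r0; have s0 : s != 0 by case: s1 => ->; rewrite ?oppr_eq0 oner_eq0.
    by field; rewrite s0 q0 gt_eqF.
  apply/matrixP => k l; rewrite addmxE (@Umx_conj _ _ i0 i1) ?i00 ?i11 // !mxE.
  have [->|->] := ex k; have [->|->] := ex l; rewrite ?eqxx ?i10 ?(negbTE i01) /=.
  - by rewrite -/p e00; ring.
  - by rewrite -/q e01; ring.
  - have -> : K i1 i0 = q by rewrite -{1}pK.1 mxE.
    by rewrite e01; ring.
  - by rewrite -/r /c; ring.
rewrite KE in E3.
pose g := ygen i1 c *m (ygen i0 (s * a) *m ygen i1 r0).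
have Gg : G_nneg (eps_pinning (const_sign s)) g.
  have y1 b : 0 < b -> G_nneg (eps_pinning (const_sign s)) (ygen i1 b).
    by move=> /(G_nneg_y (eps_pinning (const_sign s)) i1); rewrite /= /const_sign l1 mul1r.
  apply: G_nneg_M; first exact: y1.
  apply: G_nneg_M; last exact: y1.
  by have := G_nneg_y (eps_pinning (const_sign s)) i0 a0; rewrite /= /const_sign l0.
apply: (frame_dotPJ Gg (h := h3 *m h2 *m h1) _ _ xK).
- by do 2 ?apply: Sp_mul; exact: Sp_ygen.
- by rewrite !unitmx_mul u3 u2 u1.
by rewrite /g -!mulmxA [ygen i1 r0 *m _]E1 (mulmxA (ygen i0 _)) E2 !mulmxA E3.
Qed.

Lemma rank2_closure x : @lagr_pos R n x ->
  lagr_pin_nneg (eps_pinning (const_sign 1)) x \/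
  lagr_pin_nneg (eps_pinning (const_sign (-1))) x.
Proof.
move=> [K pK xK]; have i01 : i0 != i1 by rewrite -val_eqE /= i00 i11.
have [q0|q0|q0] := ltgtP (K i0 i1) 0.
- left; apply: subset_closure; apply: (rank2_cell _ pK _ xK); first by left.
  by rewrite mulN1r oppr_gt0.
- right; apply: subset_closure; apply: (rank2_cell _ pK _ xK); first by right.
  by rewrite opprK mul1r.
(* A zero entry is approached by negative ones: K - t E stays positive definite for small t > 0 and
   lies in the image for sign 1. *)
left; pose E : 'M[R]_n := delta_mx i0 i1 + delta_mx i1 i0.
have sE : E^T = E by rewrite trmxD !trmx_delta addrC.
pose Kt (t : R) := K - t *: E.
have sKt t : (Kt t)^T = Kt t by rewrite trmxB trmxZ sE pK.1.
pose c t := mkl (lag_sym (sKt t)).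
have cM t : repr_by (c t) (col_mx 1%:M (Kt t)) by exact: repr_mkl.
have cKt (t : R) : ctsmx t Kt.
  apply: ctsmxB; first exact: ctsmx_cst.
  by apply: ctsmxZ; [exact: cvg_id | exact: ctsmx_cst].
have -> : x = c 0.
  by apply: (repr_inj xK); have := cM 0; rewrite /Kt scale0r subr0.
have cc : continuous c.
  by apply: (lagr_continuous_in cM) => t; apply: ctsmx_col => //; exact: ctsmx_cst.
apply: curve_closure => // e e0.
have K0 : pos_def (Kt 0) by rewrite /Kt scale0r subr0.
have /nbhs_ballP[e' /= e'0 eP] := near_pos_def (cKt 0) sKt K0.
pose t := Num.min e e' / 2; have m0 : 0 < Num.min e e' by rewrite lt_min e0.
have t0 : 0 < t by rewrite divr_gt0.
have tm : t < Num.min e e'.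
  by rewrite /t ltr_pdivrMr // ltr_pMr // ltr1n.
have [te te'] : t < e /\ t < e' by apply/andP; rewrite -lt_min.
exists t; first by rewrite gtr0_norm.
apply: (rank2_cell _ _ _ (cM t)); first by left.
  by apply: eP; rewrite /ball /= sub0r normrN gtr0_norm.
rewrite /Kt !mxE q0 !eqxx (negbTE i01) /= addr0 mulr1 sub0r mulrNN mul1r //.
Qed.

End RankTwo.

Lemma pins_nneg_rank2 : n = 2%N ->
  \bigcup_(p in @pinC R n) lagr_pin_nneg p = @lagr_nneg R n.
Proof.
move=> n2; apply/seteqP; split; first exact: pins_nneg_sub.
have h0 : (0 < n)%N by rewrite n2. have h1 : (1 < n)%N by rewrite n2.
pose C s := lagr_pin_nneg (eps_pinning (@const_sign s)).
have sub : C 1 `|` C (-1) `<=` \bigcup_(p in @pinC R n) lagr_pin_nneg p.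
  have h s : s = 1 \/ s = -1 -> C s `<=` \bigcup_(p in @pinC R n) lagr_pin_nneg p.
    move=> s1 x Cx; exists (eps_pinning (const_sign s)) => //.
    exists (const_sign s) => //; split; last exact: const_sign_last.
    exact: const_sign1.
  by move=> x [|]; apply: h; [left|right].
(* The union of the two closed sets is closed, so it is enough that it contains the positive
   part. *)
apply: subset_trans sub; rewrite -closure_lagr_pos.
have -> : C 1 `|` C (-1) = closure (C 1 `|` C (-1)).
  by apply: (closure_id _).1; apply: closedU; exact: closed_closure.
apply: closureS => x xp.
exact: (@rank2_closure n2 (Ordinal h0) (Ordinal h1) erefl erefl x xp).
Qed.

End Pinnings.

(** * Failure of equality for n >= 3 *)

Section RankThree.
Variable R : realType.

Lemma tl_mulr n (d : nat -> R) (M : 'M[R]_(n + n, n)) (h : 'M[R]_n) p l :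
  tl d (M *m h) p l = \sum_k tl d M p k * h k l.
Proof.
rewrite /tl /rowat; under eq_bigr do rewrite mxE.
rewrite exchange_big mulr_sumr; apply: eq_bigr => k _.
by rewrite -mulrA mulr_suml.
Qed.

Lemma minor_mulr n (d : nat -> R) (M : 'M[R]_(n + n, n)) (h : 'M[R]_n) f :
  minor f (tl d (M *m h)) = minor f (tl d M) * \det h.
Proof.
rewrite -det_mulmx; congr (\det _); apply/matrixP => i l.
by rewrite mxE tl_mulr mxE; apply: eq_bigr => k _; rewrite mxE.
Qed.

Lemma ctsr_minor n (d : nat -> R) (M : 'M[R]_(n + n, n)) f :
  ctsr M (fun N => minor f (tl d N)).
Proof.
apply: ctsr_det => i l; apply: (@eq_ctsr R _ M (fun N => tl d N (f i) l)).
  by move=> N; rewrite mxE.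
by apply: ctsrM; [exact: ctsr_cst | apply: ctsr_sum => k; exact: ctsmx_id].
Qed.

(** Nonnegativity of all products of two minors does not depend on the frame and is closed, so it
    passes to the closure; [minor_graph] then reads off the entries. *)
Lemma pin_nneg_khat m (e : 'I_m.+1 -> R) x K :
  (forall i, e i = 1 \/ e i = -1) -> (forall i : 'I_m.+1, i.+1 = m.+1 -> e i = 1) ->
  lagr_pin_nneg (eps_pinning e) x -> repr_by x (col_mx 1%:M K) ->
  forall i j, 0 <= khat e K i j.
Proof.
move=> e1 el xD xK i j; pose d := sgn_of e.
pose good (M : 'M[R]_(m.+1 + m.+1, m.+1)) := forall f g, incr f -> incr g ->
  0 <= minor f (tl d M) * minor g (tl d M) :> R.
have goodM M h : good M -> good (M *m h).
  move=> gM f g fi gi; rewrite !minor_mulr mulrACA.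
  by rewrite mulr_ge0 ?gM // -expr2 sqr_ge0.
have cZ : closed [set y | exists2 M, repr_by y M & good M].
  apply: lagr_closed => [M|M h _ _]; last exact: goodM.
  move=> /existsNP[f /existsNP[g]] /not_implyP[fi] /not_implyP[gi].
  move=> /negP; rewrite -ltNge -oppr_gt0 => h.
  have c : ctsr M (fun N => - (minor f (tl d N) * minor g (tl d N))).
    by apply: ctsrN; apply: ctsrM; exact: ctsr_minor.
  apply: filterS (near_gt0 c h) => N hN /(_ f g fi gi).
  by rewrite oppr_gt0 in hN; rewrite leNgt hN.
have : closure [set y | exists2 M, repr_by y M & good M] x.
  apply: closureS xD => y /(dotPJ_frame e1)[g Gg yM].
  exists (g *m signed_frame0 m.+1 d) => // f f' fi fi'.
  have t := G_nneg_tnn e1 el Gg (tnn_frame0 (n := m.+1) (sgn_of2 e1)).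
  by rewrite mulr_ge0 ?t.
rewrite -((closure_id _).1 cZ) => -[M xM gM].
have [h uh E] := (repr_eqP xM xK).1 erefl.
have := goodM _ h gM; rewrite -E => gK.
have := gK _ _ (@low_rows_incr m.+1) (swap_rows_incr i j).
by rewrite (minor_graph (sgn_of2 e1)) /khat /sg [X in X * K i j]mulrC.
Qed.

Lemma qf_delta n i j (u : 'cV[R]_n) : qf (delta_mx i j) u = u i 0 * u j 0.
Proof.
rewrite /qf -(mul_delta_mx (0 : 'I_1)) !mulmxA -mulmxA mxE big_ord1.
by rewrite -colE -rowE !mxE.
Qed.

Lemma pins_nneg_proper n : (2 < n)%N ->
  \bigcup_(p in @pinC R n) lagr_pin_nneg p <> @lagr_nneg R n.
Proof.
case: n => // m m2 E.
have h0 : (0 < m.+1)%N by []. have h1 : (1 < m.+1)%N by lia.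
pose i0 := Ordinal h0; pose i1 := Ordinal h1; pose i2 := Ordinal m2.
pose D : 'M[R]_m.+1 := delta_mx i0 i1 + delta_mx i1 i0 + (delta_mx i1 i2 + delta_mx i2 i1) +
  (delta_mx i0 i2 + delta_mx i2 i0).
(* As ab + bc + ca <= a^2 + b^2 + c^2, the entries -1/4 leave at least half of the form of the
   identity. *)
pose K := 1%:M - 4^-1 *: D.
have sK : K^T = K.
  rewrite trmxB trmx1 trmxZ /D !trmxD !trmx_delta; congr (_ - _ *: _).
  by rewrite [in X in X + _ + _]addrC [in X in _ + X + _]addrC [in X in _ + X]addrC.
have pK : pos_def K.
  split=> // u /nsq_gt0 u0; rewrite -/(qf K u) /K qfD qfN qfZ !qfD qf1 !qf_delta.
  have : u i0 0 ^+ 2 + (u i1 0 ^+ 2 + u i2 0 ^+ 2) <= nsq u.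
    rewrite nsqE (bigD1 i0) //= (bigD1 i1) //= (bigD1 i2) //= !addrA lerDl.
    by apply: sumr_ge0 => i _; exact: sqr_ge0.
  move: (nsq u) (u i0 0) (u i1 0) (u i2 0) u0 => s a b c s0 abc.
  have := sqr_ge0 (a - b); have := sqr_ge0 (b - c); have := sqr_ge0 (a - c).
  rewrite !sqrrB; nra.
have [x xK] := repr_ex (lag_sym sK).
have : @lagr_nneg R m.+1 x by apply: lagr_pos_sub; exists K.
rewrite -E => -[_ [e [e1 el] <-] xe].
have kh := pin_nneg_khat e1 el xe xK.
(* Each sign [sg] occurs twice in this product, so its sign is that of the product of the three
   entries, which is negative. *)
have := mulr_ge0 (mulr_ge0 (kh i0 i1) (kh i1 i2)) (kh i0 i2).
have K01 : K i0 i1 = - 4^-1 by rewrite /K !mxE /= mulr1n !(addr0, add0r, subr0); field.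
have K12 : K i1 i2 = - 4^-1 by rewrite /K !mxE /= mulr1n !(addr0, add0r, subr0); field.
have K02 : K i0 i2 = - 4^-1 by rewrite /K !mxE /= mulr1n !(addr0, add0r, subr0); field.
rewrite /khat K01 K12 K02.
have a2 := sg2 e1 i0; have b2 := sg2 e1 i1; have c2 := sg2 e1 i2.
move: (sg e i0) (sg e i1) (sg e i2) a2 b2 c2 => a b c a2 b2 c2.
rewrite (_ : _ * _ = - ((a * a) * (b * b) * (c * c) * (4^-1 * 4^-1 * 4^-1))); last by ring.
by rewrite a2 b2 c2 !mul1r oppr_ge0 leNgt !mulr_gt0.
Qed.

End RankThree.

(** * Generalized Pluecker coordinates and their signs *)

Section PluckerCoordinates.
Variables (R : realType) (n : nat).
Local Notation M2 := 'M[R]_(n + n).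
Local Notation F := 'M[R]_(n + n, n).
Local Notation index := {ffun 'I_n -> 'I_(n + n)}.
Local Notation weight := {ffun 'I_n -> int}.
Implicit Types (M : F) (f : index) (nu : weight) (S : pred 'I_n) (v : tensor R n).

Lemma tensor_act_wedge (g : M2) M : tensor_act g (wedge M) = wedge (g *m M).
Proof.
apply/ffunP => f; rewrite !ffunE /determinant.
under eq_bigr do rewrite ffunE /determinant mulr_sumr.
rewrite exchange_big; apply: eq_bigr => s _ /=.
under eq_bigr do rewrite mulrCA -big_split /=.
rewrite -mulr_sumr; congr (_ * _).
under [RHS]eq_bigr do rewrite !mxE.
rewrite bigA_distr_bigA; apply: eq_bigr => h _; apply: eq_bigr => i _.
by rewrite mxE.
Qed.

Lemma tensorZE a v f : (a *: v) f = a * v f.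
Proof. exact: ffunE. Qed.

Lemma tensorDE v v' f : (v + v') f = v f + v' f.
Proof. exact: ffunE. Qed.

Lemma tensor_actE (g : M2) v f :
  tensor_act g v f = \sum_(h : index) (\prod_i g (f i) (h i)) * v h.
Proof. by rewrite ffunE. Qed.

Lemma wedge_mulr M (h : 'M[R]_n) : wedge (M *m h) = \det h *: wedge M.
Proof.
apply/ffunP => f; rewrite !ffunE -[RHS]mulrC -det_mulmx; congr (\det _).
by apply/matrixP => i j; rewrite !mxE; apply: eq_bigr => k _; rewrite mxE.
Qed.

(** * Weights *)

(** The exponents of the character by which T acts on the basis tensor of index [f]. *)
Definition wt f : weight := [ffun k =>
  #|[pred i | f i == lshift n k]|%:Z - #|[pred i | f i == rshift n k]|%:Z].

Lemma torus_act (t : M2) v f : torus t -> tensor_act t v f = torus_char (wt f) t * v f.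
Proof.
move=> [a a0 ->]; rewrite tensor_actE (bigD1 f) //= [X in _ + X]big1 ?addr0 => [|h hf].
  congr (_ * _); pose b : 'rV[R]_(n + n) := row_mx a (\row_i (a 0 i)^-1).
  have bE p : diag_sp a p p = b 0 p by rewrite diag_sp_mx mxE eqxx.
  rewrite (eq_bigr (fun i => b 0 (f i))) => [|i _]; last exact: bE.
  rewrite (partition_big f xpredT) //= big_split_ord /= -big_split /=.
  apply: eq_bigr => k _; rewrite bE /b row_mxEl.
  have cst p c : (forall i, f i == p -> b 0 (f i) = c) ->
      \prod_(i | f i == p) b 0 (f i) = c ^+ #|[pred i | f i == p]|.
    by move=> h; rewrite (eq_bigr (fun=> c)) // prodr_const.
  rewrite (cst _ (a 0 k)) => [|i /eqP ->]; last by rewrite /b row_mxEl.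
  rewrite (cst _ (a 0 k)^-1) => [|i /eqP ->]; last by rewrite /b row_mxEr mxE.
  by rewrite ffunE expfzDr ?a0 // -exprz_inv.
have [i fi] : exists i, h i != f i.
  apply/existsP; apply: contraNT hf; rewrite negb_exists => /forallP hf.
  by apply/eqP/ffunP => i; apply/eqP; have := hf i; rewrite negbK.
rewrite (bigD1 i) //= diag_sp_mx mxE eq_sym (negbTE fi) mulr0n !mul0r //.
Qed.

(** A character takes the value 2 to the power [nu k] here, so these elements separate
    characters. *)
Definition two_torus (k : 'I_n) : M2 := diag_sp (\row_j (if j == k then 2 else 1)).

Lemma two_torusP k : torus (two_torus k).
Proof.
exists (\row_j (if j == k then 2 else 1)) => // j; rewrite mxE.
by case: ifP => _; rewrite ?pnatr_eq0 ?oner_eq0.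
Qed.

Lemma char_two nu k : torus_char nu (two_torus k) = 2 ^ nu k.
Proof.
rewrite /torus_char (bigD1 k) //= big1 ?mulr1 => [|j jk].
  by rewrite /two_torus diag_sp_mx mxE eqxx row_mxEl mxE eqxx.
by rewrite /two_torus diag_sp_mx mxE eqxx row_mxEl mxE (negbTE jk) exp1rz.
Qed.

Lemma char_sep nu nu' :
  (forall t : M2, torus t -> torus_char nu t = torus_char nu' t) -> nu = nu'.
Proof.
move=> h; apply/ffunP => k; have := h _ (two_torusP k); rewrite !char_two.
by apply: ieexprIz => //; rewrite -subr_eq0 addrK oner_eq0.
Qed.

Lemma weight_support nu v f :
  (forall t : M2, torus t -> tensor_act t v = torus_char nu t *: v) ->
  wt f != nu -> v f = 0.
Proof.
move=> h; apply: contraNeq => vf; apply/eqP/char_sep => t tT.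
have := congr1 (fun v : tensor R n => v f) (h t tT).
by rewrite torus_act // tensorZE => /(mulIf vf).
Qed.

(** * Weight components stay in the span of the orbit of [eta] *)

Lemma Vomega_wedge g : Sp g -> Vomega (tensor_act g (@eta R n)).
Proof.
move=> Sg; exists 1%N, (fun=> 1), (fun=> g); split=> //.
by rewrite big_ord1 scale1r.
Qed.

Lemma tensor_act_sum (g : M2) m (c : 'I_m -> R) (u : 'I_m -> tensor R n) :
  tensor_act g (\sum_j c j *: u j) = \sum_j c j *: tensor_act g (u j).
Proof.
apply/ffunP => f; rewrite tensor_actE sum_ffunE.
under eq_bigr do rewrite sum_ffunE mulr_sumr.
rewrite exchange_big; apply: eq_bigr => j _ /=; rewrite tensorZE tensor_actE mulr_sumr.
by apply: eq_bigr => h _; rewrite tensorZE mulrCA.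
Qed.

Lemma Vomega_comb (t : M2) a b v : Sp t -> Vomega v ->
  Vomega (a *: tensor_act t v + b *: v).
Proof.
move=> St [m [c [g [Sg ->]]]].
exists (m + m)%N,
  (fun j => match fintype.split j with inl k => a * c k | inr k => b * c k end),
  (fun j => match fintype.split j with inl k => t *m g k | inr k => g k end).
split=> [j|].
  by case: fintype.split => k //; apply: Sp_mul.
rewrite big_split_ord /= tensor_act_sum !scaler_sumr; congr (_ + _).
  apply: eq_bigr => k _; rewrite -[lshift m k]/(unsplit (inl k)) unsplitK.
  by rewrite scalerA /eta !tensor_act_wedge mulmxA.
apply: eq_bigr => k _; rewrite -[rshift m k]/(unsplit (inr k)) unsplitK.
by rewrite scalerA.
Qed.

(** For a [t] separating two characters chi and chi', the operator (t - chi'(t)) / (chi(t) -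
    chi'(t)) removes the weight chi', fixes the weight chi and preserves the span of the orbit. *)
Lemma Vomega_kill v nu (s : seq weight) : Vomega v -> nu \notin s ->
  exists2 v', Vomega v' &
    forall f, (wt f = nu -> v' f = v f) /\ (wt f \in s -> v' f = 0).
Proof.
move=> Vv; elim: s => [|nu' s IHs]; first by exists v.
rewrite inE negb_or => /andP[nn /IHs[v' Vv' v'E]].
have [t tT ct] : exists2 t : M2, torus t & torus_char nu t != torus_char nu' t.
  apply: contrapT => no; case/eqP: nn; apply: char_sep => t tT.
  by apply/eqP; apply: contrapT => /negP h; apply: no; exists t.
pose a := (torus_char nu t - torus_char nu' t)^-1.
have a0 : torus_char nu t - torus_char nu' t != 0 by rewrite subr_eq0.
exists (a *: tensor_act t v' + (- (a * torus_char nu' t)) *: v').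
  by apply: Vomega_comb => //; have /torus_diag[] := tT.
move=> f; have [h1 h2] := v'E f.
have E : (a *: tensor_act t v' + (- (a * torus_char nu' t)) *: v') f =
    a * (torus_char (wt f) t - torus_char nu' t) * v' f.
  rewrite tensorDE !tensorZE torus_act //; ring.
rewrite E; split=> [wf|]; first by rewrite wf mulVf // mul1r h1.
by rewrite inE => /orP[/eqP ->|/h2 ->]; rewrite ?subrr ?mulr0 ?mul0r.
Qed.

Definition component nu v : tensor R n := [ffun f => if wt f == nu then v f else 0].

Lemma componentE nu v f : component nu v f = if wt f == nu then v f else 0.
Proof. exact: ffunE. Qed.

Lemma component_weight nu v : Vomega v -> weight_space nu (component nu v).
Proof.
move=> Vv; split; last first.
  move=> t tT; apply/ffunP => f; rewrite torus_act // tensorZE !ffunE.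
  by case: eqP => [->//|_]; rewrite !mulr0.
pose s := [seq wt f | f <- enum {: index} & wt f != nu].
have ns : nu \notin s by apply/mapP => -[f]; rewrite mem_filter => /andP[/eqP h _ e]; apply: h.
have [v' Vv' v'E] := Vomega_kill Vv ns.
suff -> : component nu v = v' by [].
apply/ffunP => f; rewrite ffunE; have [h1 h2] := v'E f.
case: eqP => [/h1 //|/eqP wf]; rewrite h2 //.
by apply/mapP; exists f => //; rewrite mem_filter wf mem_enum.
Qed.

(** * Extremal weights *)

Definition mask_index S : index := [ffun i => if S i then rshift n i else lshift n i].

Definition mask_weight S : weight := [ffun k => if S k then -1 else 1].

Lemma wt_mask S : wt (mask_index S) = mask_weight S.
Proof.
apply/ffunP => k; rewrite !ffunE.
have cE (b : bool) : #|[pred i | (i == k) && b]| = b.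
  case: b; first by rewrite (eq_card (_ : _ =i pred1 k)) ?card1 // => i; rewrite !inE /= ?andbT.
  by rewrite (eq_card0 _) // => i; rewrite !inE /= ?andbF.
rewrite (eq_card (_ : _ =i [pred i | (i == k) && ~~ S k])); last first.
  move=> i; rewrite !inE ffunE; have [->|ik] /= := eqVneq i k.
    by case: (S k); rewrite ?eqxx // eq_rlshift.
  by case: (S i); rewrite ?eq_rlshift ?eq_lshift // (negbTE ik).
rewrite [X in _ - X%:Z](eq_card (_ : _ =i [pred i | (i == k) && S k])); last first.
  move=> i; rewrite !inE ffunE; have [->|ik] /= := eqVneq i k.
    by case: (S k); rewrite ?eqxx // eq_lrshift.
  by case: (S i); rewrite ?eq_lrshift ?eq_rshift // (negbTE ik).
by rewrite !cE; case: (S k).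
Qed.

(** No coordinate of the weight vanishes, so each k is met by one of the n factors, hence by exactly
    one, and the sign tells e_k from e_(n+k). *)
Lemma mask_index_perm S f : wt f = mask_weight S ->
  exists s : {perm 'I_n}, forall i, f i = mask_index S (s i).
Proof.
move=> fS; pose b i : 'I_n := match fintype.split (f i) with inl k => k | inr k => k end.
have bl i k : f i = lshift n k -> b i = k.
  by rewrite /b => ->; rewrite -[lshift n k]/(unsplit (inl k)) unsplitK.
have br i k : f i = rshift n k -> b i = k.
  by rewrite /b => ->; rewrite -[rshift n k]/(unsplit (inr k)) unsplitK.
have fb i : f i = lshift n (b i) \/ f i = rshift n (b i).
  rewrite /b; case: (splitP (f i)) => k kE; [left|right]; exact: val_inj.
have wk k : wt f k = mask_weight S k by rewrite fS.
have surj k : exists i, b i = k.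
  apply: contrapT => no; have := wk k; rewrite !ffunE !eq_card0.
  - by case: (S k).
  - by move=> i; rewrite !inE; apply/eqP => /br h; apply: no; exists i.
  - by move=> i; rewrite !inE; apply/eqP => /bl h; apply: no; exists i.
have binj : injective b.
  have h : forall k, {i | b i == k}.
    by move=> k; apply: sigW; have [i <-] := surj k; exists i.
  pose c k := sval (h k); have cK : cancel c b by move=> k; apply/eqP/(svalP (h k)).
  have [c' cc' c'c] := injF_bij (can_inj cK).
  have bE i : b i = c' i by rewrite -{1}(c'c i) cK.
  by move=> i j; rewrite !bE => /(congr1 c); rewrite !c'c.
exists (perm binj) => i; rewrite ffunE permE; have := wk (b i); rewrite !ffunE.
have [fi|fi] := fb i; rewrite fi.
  rewrite [X in _ - X%:Z]eq_card0 => [|j]; last first.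
    rewrite !inE; apply/eqP => fj; have e := binj _ _ (br _ _ fj).
    by move: fj; rewrite e fi => /eqP; rewrite eq_lrshift.
  by case: (S (b i)) => //; rewrite subr0; case: #|_|.
rewrite [X in X%:Z - _]eq_card0 => [|j]; last first.
  rewrite !inE; apply/eqP => fj; have e := binj _ _ (bl _ _ fj).
  by move: fj; rewrite e fi => /eqP; rewrite eq_rlshift.
by case: (S (b i)) => //; rewrite sub0r; case: #|_|.
Qed.

Lemma wedge_perm M S f (s : {perm 'I_n}) : (forall i, f i = mask_index S (s i)) ->
  wedge M f = (-1) ^+ s * wedge M (mask_index S).
Proof.
move=> fE; rewrite !ffunE -det_perm -det_mulmx -row_permE; congr (\det _).
by apply/matrixP => i j; rewrite !mxE fE.
Qed.

Lemma wedge_mask M S : wedge M (mask_index S) = plu S (usubmx M) (dsubmx M).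
Proof.
rewrite ffunE /plu mskC; congr (\det _); apply/matrixP => i j.
rewrite addmxE !msk_mul !mxE ffunE.
by case: (S i); rewrite /= ?mul1r ?mul0r ?addr0 ?add0r.
Qed.

Definition mask_diag S (a : 'rV[R]_n) : 'M[R]_n :=
  diag_mx (\row_k (if S k then (a 0 k)^-1 else a 0 k)).

Lemma torus_maskframe S a :
  diag_sp a *m maskframe R S = maskframe R S *m mask_diag S a.
Proof.
rewrite /diag_sp /maskframe mul_block_col !mul0mx addr0 add0r mul_col_mx.
rewrite mskC /mask_diag; congr col_mx; apply/matrixP => i j;
  rewrite mul_diag_mx mul_mx_diag !mxE; case: eqP => [<-|_] /=;
  rewrite ?mulr0 ?mul0r //; case: (S i) => /=; ring.
Qed.

Lemma det_mask_diag S (a : 'rV[R]_n) : (forall i, a 0 i != 0) ->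
  \det (mask_diag S a) = torus_char (mask_weight S) (diag_sp a).
Proof.
move=> a0; rewrite det_diag; apply: eq_bigr => k _.
rewrite mxE ffunE diag_sp_mx mxE eqxx row_mxEl.
by case: (S k); rewrite ?expr1z // exprN1.
Qed.

Lemma extremal_vectorE (w : set M2) (s : seq 'I_n) : wdot w = word_dot R s -> red s ->
  extremal_vector w = wedge (maskframe R (flipped s)).
Proof.
move=> wE rs; rewrite /extremal_vector /eta tensor_act_wedge wE.
by have [h dh ->] := word_frame R rs; rewrite wedge_mulr dh scale1r.
Qed.

Lemma maskframe_weight S (t : M2) : torus t ->
  tensor_act t (wedge (maskframe R S)) =
  torus_char (mask_weight S) t *: wedge (maskframe R S).
Proof.
move=> [a a0 ->]; rewrite tensor_act_wedge torus_maskframe wedge_mulr.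
by rewrite det_mask_diag.
Qed.

Lemma wedge_maskframe S : wedge (maskframe R S) (mask_index S) = 1.
Proof.
rewrite wedge_mask /plu /maskframe col_mxKu col_mxKd mskC !msk_idem -mskC subrK.
exact: det1.
Qed.

Lemma frame0_tr_mul (D : M2) : (@frame0 R n)^T *m D *m @frame0 R n = ulsubmx D.
Proof.
rewrite -{1}[D]submxK /frame0 tr_col_mx trmx1 trmx0 mul_row_block mul_row_col.
by rewrite !mul1mx !mul0mx !addr0 mulmx1 mulmx0 addr0.
Qed.

(** The character omega_n of a torus element is the determinant of its upper left block; after
    conjugation by [w] it is the determinant of the action of T on the coordinate Lagrangian. *)
Lemma extremal_weightP (w : set M2) (s : seq 'I_n) nu : wdot w = word_dot R s -> red s ->
  is_extremal_weight w nu <-> nu = mask_weight (flipped s).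
Proof.
move=> wE rs.
have E (t : M2) : torus t -> torus_char (omega_n n) (invmx (wdot w) *m t *m wdot w) =
    torus_char (mask_weight (flipped s)) t.
  move=> tT; rewrite wE word_dot_inv.
  have [a' a'0 DE] := word_torus' s tT; set D := _ *m word_dot R s in DE *.
  have -> : torus_char (omega_n n) D = \det (ulsubmx D).
    rewrite DE /diag_sp block_mxKul det_diag; apply: eq_bigr => i _.
    by rewrite ffunE expr1z block_mxEul mxE eqxx.
  rewrite -frame0_tr_mul /D; have [h dh hE] := word_frame R rs.
  rewrite -!mulmxA hE !mulmxA -trmx_mul hE trmx_mul.
  case: tT => a a0 ->; rewrite -!mulmxA (mulmxA (diag_sp a)) torus_maskframe.
  rewrite -!mulmxA (mulmxA _^T (maskframe _ _)).
  have -> : (maskframe R (flipped s : pred 'I_n))^T *m maskframe R (flipped s) = 1%:M.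
    have st S : (msk R S)^T = msk R S by apply/matrixP => i j; rewrite !mxE eq_sym; case: eqP => [->|].
    by rewrite /maskframe mskC tr_col_mx mul_row_col !st !msk_idem -(mskC R) subrK.
  by rewrite mul1mx !det_mulmx det_tr dh mul1r mulr1 det_mask_diag.
split=> [h|-> t tT]; last by rewrite E.
by apply: char_sep => t tT; rewrite h // E.
Qed.

(** Evaluation at [mask_index] isolates one coordinate: vectors of other weights vanish there and
    the extremal vector has value 1. *)
Lemma plucker_coordsP M c : plucker_coords (wedge M) c ->
  forall (w : set M2) (s : seq 'I_n), weyl_minJ w -> wdot w = word_dot R s -> red s ->
  c w = plu (flipped s) (usubmx M) (dsubmx M).
Proof.
move=> [m [nu [u [ni uW vE ext]]]] w s wJ wE rs.
have [j [/(extremal_weightP _ wE rs) nuj uj]] := ext w wJ.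
have off k f : wt f != nu k -> u k f = 0.
  by apply: weight_support; have [] := uW k.
have := congr1 (fun v : tensor R n => v (mask_index (flipped s))) vE.
rewrite wedge_mask sum_ffunE (bigD1 j) //= big1 ?addr0 => [|k kj].
  move=> ->; rewrite uj tensorZE (extremal_vectorE wE rs) wedge_maskframe.
  by rewrite mulr1.
apply: off; rewrite wt_mask -nuj; apply: contra kj => /eqP/ni ->; exact: eqxx.
Qed.

(** The coordinate as a function of the coset [w], which is what [plucker_coords] expects, without a
    choice of word. *)
Definition flag_coef M (w : set M2) : R :=
  \det ((wdot w *m @frame0 R n)^T *m M).

Lemma tr_msk S : (msk R S)^T = msk R S.
Proof. by apply/matrixP => i j; rewrite !mxE eq_sym; case: eqP => [->|]. Qed.

Lemma flag_coefE M (w : set M2) (s : seq 'I_n) : wdot w = word_dot R s -> red s ->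
  flag_coef M w = plu (flipped s) (usubmx M) (dsubmx M).
Proof.
move=> wE rs; rewrite /flag_coef wE; have [h dh ->] := word_frame R rs.
rewrite trmx_mul -mulmxA det_mulmx det_tr dh mul1r -{1}[M]vsubmxK.
by rewrite /maskframe tr_col_mx mul_row_col trmxB trmx1 tr_msk.
Qed.

Lemma plucker_coords_ex g : Sp g ->
  plucker_coords (tensor_act g (@eta R n)) (flag_coef (g *m @frame0 R n)).
Proof.
move=> Sg; have Vv := Vomega_wedge Sg; move: Vv.
rewrite /eta tensor_act_wedge; set M := g *m _ => Vv.
pose s := undup [seq wt f | f <- enum {: index}].
have us : uniq s by exact: undup_uniq.
have ws f : wt f \in s by rewrite mem_undup; apply: map_f; rewrite mem_enum.
exists (size s), (fun j => tnth (in_tuple s) j), (fun j => component (tnth (in_tuple s) j) (wedge M)).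
have ni : injective (fun j => tnth (in_tuple s) j).
  move=> i j; rewrite !(tnth_nth 0) /= => /eqP.
  by rewrite nth_uniq // => /eqP/val_inj.
have ex f : exists j, tnth (in_tuple s) j = wt f.
  have h := ws f; rewrite -index_mem in h; exists (Ordinal h).
  by rewrite (tnth_nth 0) /= nth_index.
split=> //.
- by move=> j; exact: component_weight.
- apply/ffunP => f; rewrite sum_ffunE; have [j jE] := ex f.
  rewrite (bigD1 j) //= big1 ?addr0 => [|k kj]; first by rewrite componentE jE eqxx.
  rewrite componentE -jE; case: eqP => // /ni jk; by rewrite jk eqxx in kj.
move=> w [ww _]; have [r rr [wE _]] := wdot_word ww.
have [j jE] := ex (mask_index (flipped r)); rewrite wt_mask in jE.
exists j; split; first exact/(extremal_weightP _ wE rr).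
rewrite (flag_coefE _ wE rr) (extremal_vectorE wE rr) jE.
apply/ffunP => f; rewrite tensorZE; have [wf|wf] := eqVneq (wt f) (mask_weight (flipped r)).
  have [p fp] := mask_index_perm wf.
  rewrite componentE wf eqxx (wedge_perm M fp) (wedge_perm (maskframe R _) fp).
  by rewrite wedge_maskframe wedge_mask mulr1 mulrC.
rewrite componentE (negbTE wf) (weight_support _ wf) ?mulr0 // => t tT.
exact: maskframe_weight.
Qed.

(** * Every subset of rows is read by an element of W^J *)

Lemma state_cat (s r : seq 'I_n) p : state (s ++ r) p = state r (state s p).
Proof. by elim: s p => //= i s IHs p. Qed.

Lemma state_J (r : seq 'I_n) p : all (fun i : 'I_n => i.+1 != n) r ->
  (p < n + n)%N -> (n <= state r p)%N = (n <= p)%N.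
Proof.
elim: r p => //= i r IHr p /andP[ni /IHr h] pn; have iN := ltn_ord i.
rewrite h ?refl_lt // /refl; do ?[case: ifP => ?]; apply/idP/idP; lia.
Qed.

Lemma word_dot_cat (s r : seq 'I_n) : word_dot R (s ++ r) = word_dot R s *m word_dot R r.
Proof.
elim: s => [|i s IHs]; first by rewrite {2}/word_dot big_nil mul1mx.
by rewrite cat_cons !word_dot_cons IHs mulmxA.
Qed.

Lemma tcoset_mul (s r : seq 'I_n) :
  mulS (tcoset (word_dot R s)) (tcoset (word_dot R r)) = tcoset (word_dot R (s ++ r)).
Proof.
rewrite word_dot_cat; apply/seteqP; split=> [_ [_ [t tT <-] [_ [u uT <-] <-]]|_ [t tT <-]].
  exists ((word_dot R r)^T *m t *m word_dot R r *m u).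
    by apply: torus_mul => //; exact: word_torus'.
  rewrite !mulmxA -[_ *m word_dot R r *m (word_dot R r)^T]mulmxA word_dot_trK mulmx1.
  by [].
exists (word_dot R s); first exact: tcoset_refl.
by exists (word_dot R r *m t); [exists t | rewrite mulmxA].
Qed.

(** A shortest word with flip set [S] is minimal in its coset, since multiplication by W_J on the
    right does not change the flip set. *)
Lemma min_word S : exists w : set M2, weyl_minJ w /\ exists s : seq 'I_n,
  [/\ wdot w = word_dot R s, red s & forall i : 'I_n, flipped s i = S i].
Proof.
pose good (s : seq 'I_n) := forall i : 'I_n, flipped s i = S i.
have [s0 s0E] := word_ex n (fun k => [exists i : 'I_n, (val i == k) && S i]).
have good0 : good s0.
  move=> i; rewrite s0E ?ltn_ord //; apply/existsP/idP => [[j /andP[/eqP/val_inj ->]]//|Si].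
  by exists i; rewrite eqxx.
have [s gs mins] : exists2 s, good s & forall s', good s' -> (size s <= size s')%N.
  have [k] := ubnP (size s0); elim: k s0 good0 {s0E} => // k IHk s0 g0 sk.
  have [[s' [gs' ss']]|no] := pselect (exists s', good s' /\ (size s' < size s0)%N).
    by apply: (IHk s') => //; apply: leq_trans ss' _.
  exists s0 => // s' gs'; rewrite leqNgt; apply/negP => h; apply: no.
  by exists s'.
have eqg (s1 s2 : seq 'I_n) : same_state s1 s2 -> good s2 -> good s1.
  by move=> e g2 i; rewrite -g2 /flipped e //; have := ltn_ord i; lia.
have rs : red s by move=> s' ss'; apply: mins; exact: eqg gs.
exists (tcoset (word_dot R s)); split.
  split; first exact: weyl_word.
  move=> _ [r rJ <-]; rewrite tcoset_mul wlength_red //.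
  have [s' ss' rs'] := red_ex (s ++ r).
  have -> : tcoset (word_dot R (s ++ r)) = tcoset (word_dot R s').
    by apply: tcoset_eq; exact/state_coset.
  rewrite wlength_red //; apply: mins; apply: (eqg _ _ ss') => i.
  rewrite /flipped state_cat state_J // ?state_lt //; first exact: gs.
  by have := ltn_ord i; lia.
have [s' rs' [E _]] := wdot_word (weyl_word R s).
have h := red_reduced R rs.
rewrite /wdot; case: xgetP => [s2 _ /= [ws2 min2]|no]; last by case: (no s).
have ss2 := (state_coset _ _ _).1 ws2.
exists s2; split=> //; last exact: eqg gs.
move=> r hr; apply: leq_trans (min2 s _) _; first exact: tcoset_refl.
by apply: rs => p pn; rewrite hr // ss2.
Qed.

Local Notation pluM S M := (plu S (usubmx M) (dsubmx M)).

Lemma plu_frame_mulr S M (h : 'M[R]_n) : pluM S (M *m h) = pluM S M * \det h.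
Proof. by rewrite -mul_usub_mx -mul_dsub_mx plu_mulr. Qed.

(** [Q] is positivity or nonnegativity; the determinant of the change of frame is absorbed in the
    common scalar [k]. *)
Lemma plucker_signP (Q : R -> Prop) (x : lagr R n) M : repr_by x M ->
  (exists g c, [/\ is_flag x g, plucker_coords (tensor_act g (@eta R n)) c &
    exists2 k, k != 0 & forall w, weyl_minJ w -> Q (k * c w)]) <->
  exists2 k, k != 0 & forall S, Q (k * pluM S M).
Proof.
move=> xM; split.
  move=> [g [c [[Sg xg] pc [k k0 kc]]]].
  have [h uh ->] := (repr_eqP xg xM).1 erefl.
  have dh : \det h != 0 by rewrite -unitfE -unitmxE.
  exists (k / \det h) => [|S]; first by rewrite mulf_neq0 ?invr_eq0.
  have [w [wJ [s [wE rs sS]]]] := min_word S.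
  rewrite /eta tensor_act_wedge in pc.
  rewrite plu_frame_mulr mulrA mulrAC mulfVK // -(eq_plu _ _ sS).
  by rewrite -(plucker_coordsP pc wJ wE rs); exact: kc.
move=> [k k0 kS]; have [g [Sg xg]] := flag_ex x.
have [h uh ME] := (repr_eqP xg xM).1 erefl.
have dh : \det h != 0 by rewrite -unitfE -unitmxE.
exists g, (flag_coef (g *m @frame0 R n)); split=> //.
  exact: plucker_coords_ex.
exists (k * \det h) => [|w [ww _]]; first by rewrite mulf_neq0.
have [s rs [wE _]] := wdot_word ww.
by rewrite (flag_coefE _ wE rs) -mulrA (mulrC (\det h)) -plu_frame_mulr -ME; exact: kS.
Qed.

(** * Positivity of all coordinates *)

Lemma plu_pos_def (A C : 'M[R]_n) k : lag_frame (col_mx A C) ->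
  (forall S, 0 < k * plu S A C) -> pos_def (A^T *m C).
Proof.
move=> lM kS; have k0 : k != 0.
  by apply: contraTneq (kS pred0) => ->; rewrite mul0r ltxx.
have dA : 0 < k * \det A by rewrite -(plu0 A C).
have uA : A \in unitmx.
  by rewrite unitmxE unitfE; apply: contraTneq dA => ->; rewrite mulr0 ltxx.
pose K := C *m invmx A; have ME : col_mx A C = col_mx 1%:M K *m A.
  by rewrite mul_col_mx mul1mx mulmxKV.
have sK : K^T = K.
  have : lag_frame (col_mx 1%:M K).
    rewrite -[col_mx _ _](mulmxK uA) -ME; apply: lag_mulr => //.
    by rewrite unitmx_inv.
  by move=> /lag_frameP[]; rewrite trmx1 mul1mx mulmx1.
have pK : pos_def K.
  apply/(sylvester sK) => S; rewrite -(pmulr_rgt0 _ dA).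
  by rewrite mulrAC -mulrA -(plu_unit _ _ uA).
have := (pos_def_congr_unit K uA).2 pK.
rewrite /K -[X in pos_def X](_ : A^T *m C = _) //.
by rewrite mulmxA mulmxKV.
Qed.

Lemma pos_def_plu (K : 'M[R]_n) S : pos_def K -> 0 < plu S 1%:M K.
Proof. by move=> pK; apply: (sylvester pK.1).1. Qed.

Lemma lagr_pos_plu (x : lagr R n) M : repr_by x M ->
  @lagr_pos R n x <-> exists2 k, k != 0 & forall S, 0 < k * pluM S M.
Proof.
move=> xM; split.
  move=> [K pK xK]; have [h uh ->] := (repr_eqP xK xM).1 erefl.
  have dh : \det h != 0 by rewrite -unitfE -unitmxE.
  exists (\det h)^-1 => [|S]; first by rewrite invr_eq0.
  rewrite plu_frame_mulr mulrCA mulVf // mulr1 col_mxKu col_mxKd.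
  exact: pos_def_plu.
move=> [k k0 kS]; apply/(lagr_posP xM); apply: (plu_pos_def (k := k)) => //.
by rewrite vsubmxK; exact: repr_lag xM.
Qed.

(** * Nonnegativity of all coordinates *)

Lemma pluE S (A C : 'M[R]_n) :
  plu S A C = \det (\matrix_(k, l) (if S k then C k l else A k l)).
Proof.
rewrite /plu mskC; congr (\det _); apply/matrixP => k l.
by rewrite addmxE !msk_mul mxE; case: (S k); rewrite /= ?mul1r ?mul0r ?addr0 ?add0r.
Qed.

Lemma plu_swap S (A C : 'M[R]_n) : plu S A C = plu (fun i => ~~ S i) C A.
Proof.
by rewrite !pluE; congr (\det _); apply/matrixP => k l; rewrite !mxE; case: (S k).
Qed.

(** Passing from A to A + t C one row at a time makes each step linear in a single row. *)
Definition addrows (m : nat) t (A C : 'M[R]_n) : 'M[R]_n :=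
  \matrix_(k, l) (A k l + (k < m)%N%:R * t * C k l).

Lemma addrows0 t A C : addrows 0 t A C = A.
Proof. by apply/matrixP => k l; rewrite mxE ltn0 !mul0r addr0. Qed.

Lemma addrows_full t A C : addrows n t A C = A + t *: C.
Proof. by apply/matrixP => k l; rewrite !mxE ltn_ord mul1r. Qed.

Lemma plu_addrows S (i : 'I_n) t (A C : 'M[R]_n) :
  plu S (addrows i.+1 t A C) C = plu S (addrows i t A C) C +
  (~~ S i)%:R * (t * plu (fun j => S j || (j == i)) (addrows i t A C) C).
Proof.
have lt k : k != i -> (k < i.+1)%N = (k < i)%N.
  by rewrite -val_eqE /=; lia.
rewrite !pluE; case Si: (S i).
  rewrite mul0r addr0; congr (\det _); apply/matrixP => k l; rewrite !mxE.
  by have [->|/lt ->//] := eqVneq k i; rewrite Si.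
rewrite mul1r -[X in X + _]mul1r; apply: (@determinant_multilinear _ _ _ _ _ i).
- by apply/rowP => l; rewrite !mxE eqxx Si /= ltnn ltnSn !mul1r !mul0r addr0.
- apply/matrixP => k l; rewrite !mxE; case: (S _) => //.
  by rewrite lt // eq_sym neq_lift.
- apply/matrixP => k l; rewrite !mxE eq_sym (negbTE (neq_lift i k)) orbF.
  by case: (S _) => //; rewrite lt // eq_sym neq_lift.
Qed.

Section RowSpread.
Variables (q t : R) (A C : 'M[R]_n).
Hypotheses (t0 : 0 < t) (q0 : forall S, 0 <= q * plu S A C).

Lemma spread_ge0 m S : (m <= n)%N -> 0 <= q * plu S (addrows m t A C) C.
Proof.
elim: m S => [|m IHm] S mn; first by rewrite addrows0.
rewrite (plu_addrows S (Ordinal mn)) mulrDr addr_ge0 ?IHm ?(ltnW mn) //.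
by rewrite mulrCA mulr_ge0 ?ler0n // mulrCA mulr_ge0 ?IHm ?(ltnW mn) // ltW.
Qed.

(** Rows leave the set one by one: once row m is modified, the coordinate without m gains t times
    the positive coordinate with m. *)
Lemma spread_pos0 U : 0 < q * plu U A C -> 0 < q * plu pred0 (A + t *: C) C.
Proof.
move=> U0; suff : forall m, (m <= n)%N -> exists2 V : pred 'I_n,
    0 < q * plu V (addrows m t A C) C & forall i, V i -> (m <= i)%N.
  move=> /(_ _ (leqnn n))[V V0 Vn]; rewrite -addrows_full.
  by rewrite (eq_plu (T := V)) // => i; apply/esym/negP => /Vn; have := ltn_ord i; lia.
elim=> [|m IHm] mn; first by exists U; rewrite ?addrows0.
have [V V0 Vm] := IHm (ltnW mn); pose i := Ordinal mn.
have [Vi|nVi] := boolP (V i); last first.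
  exists V => [|j Vj]; last first.
    rewrite ltn_neqAle Vm // andbT; apply: contraNneq nVi => mj.
    by have -> : i = j by exact: val_inj.
  rewrite (plu_addrows V i) nVi mul1r mulrDr ltr_wpDr // mulrCA.
  by rewrite mulr_ge0 ?spread_ge0 ?(ltnW mn) // ltW.
exists (fun j => V j && (j != i)) => [|j /andP[Vj ji]]; last first.
  by rewrite ltn_neqAle Vm // andbT; apply: contra ji => /eqP mj; apply/eqP/val_inj.
rewrite (plu_addrows _ i) eqxx andbF mul1r mulrDr ltr_wpDl ?spread_ge0 ?(ltnW mn) //.
rewrite mulrCA mulr_gt0 // (eq_plu (T := V)) // => j.
by have [->|] := eqVneq j i; rewrite ?Vi ?orbT // andbT orbF.
Qed.

(** Starting from det C, every modified row may be taken out of the set, since the new coordinate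
    contains t times the one with this row taken from C. *)
Lemma spread_all : 0 < q * plu predT A C -> forall S, 0 < q * plu S (A + t *: C) C.
Proof.
move=> T0; suff h : forall m, (m <= n)%N -> forall S : pred 'I_n,
    (forall i : 'I_n, (m <= i)%N -> S i) -> 0 < q * plu S (addrows m t A C) C.
  move=> S; rewrite -addrows_full; apply: h => // i; have := ltn_ord i; lia.
elim=> [|m IHm] mn S Sm.
  by rewrite addrows0 (eq_plu (T := predT)) // => i; rewrite Sm.
pose i := Ordinal mn; rewrite (plu_addrows S i) mulrDr.
have [Si|nSi] := boolP (S i).
  rewrite mul0r mulr0 addr0; apply: IHm; first exact: ltnW.
  move=> j mj; have [->//|ji] := eqVneq j i.
  by apply: Sm; rewrite ltn_neqAle mj andbT; apply: contra ji => /eqP e; apply/eqP/val_inj.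
rewrite mul1r ltr_wpDl ?spread_ge0 ?(ltnW mn) // mulrCA mulr_gt0 //.
apply: IHm; first exact: ltnW.
move=> j mj; have [->|ji] := eqVneq j i; first by rewrite orbT.
by rewrite Sm // ltn_neqAle mj andbT; apply: contra ji => /eqP e; apply/eqP/val_inj.
Qed.

End RowSpread.

(** The first move makes det (A + t C) positive, from any one positive coordinate; with the blocks
    exchanged this is the coordinate of the full set, from which the second move makes all of them
    positive. *)
Lemma push_plu_pos (q t : R) M U : 0 < t -> (forall S, 0 <= q * pluM S M) ->
  0 < q * pluM U M -> forall S, 0 < q * pluM S (pushM M t).
Proof.
move=> t0 q0 U0 S; rewrite /pushM col_mxKu col_mxKd.
set A := usubmx M in q0 U0 *; set C := dsubmx M in q0 U0 *.
have A0 S' : 0 <= q * plu S' (A + t *: C) C.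
  by rewrite -addrows_full; exact: spread_ge0.
have AT := spread_pos0 t0 q0 U0.
rewrite plu_swap; apply: spread_all => // [S'|].
  by rewrite plu_swap; exact: A0.
by rewrite plu_swap (eq_plu (T := pred0)).
Qed.

(* Take a maximal set of independent rows of A and complete it by the other
   rows of C: a vector killed by all these rows is killed by A, and its image
   under C is orthogonal to the rows of A chosen, which are independent. *)
Lemma lag_plu_neq0 M : lag_frame M -> exists S, pluM S M != 0.
Proof.
rewrite -[M]vsubmxK col_mxKu col_mxKd; set A := usubmx M; set C := dsubmx M.
move=> /lag_frameP[sAC iAC]; pose f := maxrankfun A.
exists (fun i => i \notin codom f); rewrite -unitfE -unitmxE.
apply: inj_unitmx => u Nu.
have rowE i : ((if i \in codom f then A else C) *m u) i 0 = 0.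
  have := congr1 (fun w : 'cV[R]_n => w i 0) Nu; rewrite [RHS]mxE.
  rewrite mskC mulmxDl addmxE -!mulmxA !msk_mul negbK.
  by case: (i \in codom f); rewrite /= ?mul1r ?mul0r ?addr0 ?add0r.
have Au : A *m u = 0.
  have /submxP[X XE] : (A <= rowsub f A)%MS by rewrite eq_maxrowsub.
  rewrite XE -mulmxA (_ : rowsub f A *m u = 0) ?mulmx0 //.
  apply/matrixP => k j; rewrite ord1 [RHS]mxE.
  have := rowE (f k); rewrite codom_f !mxE => h; rewrite -[RHS]h.
  by apply: eq_bigr => l _; rewrite mxE.
apply: iAC => //; pose z : 'rV[R]_(\rank A) := \row_k (C *m u) (f k) 0.
have yE : (C *m u)^T = z *m rowsub f 1%:M.
  apply/rowP => i; rewrite mxE [RHS]mxE.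
  have [/codomP[k ->]|nf] := boolP (i \in codom f).
    rewrite (bigD1 k) //= big1 => [|k' kk]; rewrite !mxE.
      by rewrite eqxx mulr1 addr0.
    by rewrite (inj_eq (@maxrankfun_inj _ _ _ A)) (negbTE kk) mulr0.
  have := rowE i; rewrite (negbTE nf) => ->; rewrite big1 // => k _.
  rewrite !mxE; case: eqP => [h|_]; last by rewrite mulr0.
  by move: nf; rewrite -h codom_f.
have yA : (C *m u)^T *m A = 0 by rewrite trmx_mul -mulmxA -sAC mulmxA -trmx_mul Au trmx0 mul0mx.
have z0 : z = 0.
  apply: (row_free_inj (maxrowsub_free A)); rewrite mul0mx.
  by rewrite rowsubE mulmxA -yE.
by apply: trmx_inj; rewrite yE z0 mul0mx trmx0.
Qed.

(** A nonnegative point is the limit at t = 0 of positive ones, whose coordinates share one sign, so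
    products of two coordinates are nonnegative and any nonzero coordinate can serve as [k].
    Conversely, such a [k] puts the pushing curve in the positive part for t > 0. *)
Lemma lagr_nneg_plu (x : lagr R n) M : repr_by x M ->
  @lagr_nneg R n x <-> exists2 k, k != 0 & forall S, 0 <= k * pluM S M.
Proof.
move=> xM; have lM := repr_lag xM; pose c t := mkl (push_lag t lM).
have cM t : repr_by (c t) (pushM M t) by exact: repr_mkl.
have x0 : x = c 0 by apply: (repr_inj xM); have := cM 0; rewrite pushM0.
split=> [/(lagr_nnegP xM) pM|[k k0 kS]].
  have prod S U : 0 <= pluM S M * pluM U M.
    rewrite leNgt -oppr_gt0; apply/negP => h.
    have cp (V : pred 'I_n) : ctsr (0 : R) (fun t => pluM V (pushM M t)).
      apply: ctsr_det; apply: ctsmxD; (apply: ctsmxM; first exact: ctsmx_cst).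
        by apply: ctsmx_usub; exact: ctsmx_push.
      by apply: ctsmx_dsub; exact: ctsmx_push.
    have cc : ctsr (0 : R) (fun t => - (pluM S (pushM M t) * pluM U (pushM M t))).
      by apply: ctsrN; apply: ctsrM.
    have h' : 0 < - (pluM S (pushM M 0) * pluM U (pushM M 0)) by rewrite pushM0.
    have /nbhs_ballP[e /= e0 eP] := near_gt0 cc h'.
    have e2 : 0 < e / 2 by rewrite divr_gt0.
    have : 0 < - (pluM S (pushM M (e / 2)) * pluM U (pushM M (e / 2))).
      apply: eP; rewrite /ball /= sub0r normrN gtr0_norm //.
      by rewrite ltr_pdivrMr // ltr_pMr // ltr1n.
    have /(lagr_posP (cM _)) := push_pos lM pM e2.
    move=> /(lagr_pos_plu (cM _))[k k0 kS].
    have := mulr_gt0 (kS S) (kS U); rewrite mulrACA -expr2 pmulr_rgt0 ?exprn_even_gt0 //.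
    by rewrite oppr_gt0 => h1 h2; have := lt_trans h1 h2; rewrite ltxx.
  have [U U0] := lag_plu_neq0 lM.
  by exists (pluM U M) => // S; exact: prod.
have [U U0] := lag_plu_neq0 lM.
have kU : 0 < k * pluM U M by rewrite lt0r mulf_neq0 ?kS.
rewrite -closure_lagr_pos x0; apply: curve_closure.
  by apply: (lagr_continuous_in cM) => t; exact: ctsmx_push.
move=> d d0; have d2 : 0 < d / 2 by rewrite divr_gt0.
exists (d / 2); first by rewrite gtr0_norm // ltr_pdivrMr // ltr_pMr // ltr1n.
apply/(lagr_pos_plu (cM _)); exists k => //; exact: push_plu_pos kU.
Qed.

Lemma lagr_plucker_posE : @lagr_pos R n = @lagr_plucker_pos R n.
Proof.
apply/seteqP; split=> x; have [M xM] := ex_repr x.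
  by move/(lagr_pos_plu xM)/(plucker_signP (fun r => 0 < r) xM).
by move/(plucker_signP (fun r => 0 < r) xM)/(lagr_pos_plu xM).
Qed.

Lemma lagr_plucker_nnegE : @lagr_nneg R n = @lagr_plucker_nneg R n.
Proof.
apply/seteqP; split=> x; have [M xM] := ex_repr x.
  by move/(lagr_nneg_plu xM)/(plucker_signP (fun r => 0 <= r) xM).
by move/(plucker_signP (fun r => 0 <= r) xM)/(lagr_nneg_plu xM).
Qed.

End PluckerCoordinates.

Theorem theorem3p2 (R : realType) (n : nat) (n_gt0 : (0 < n)%N) :
  ([set LJ0_orbit x | x in @lagr_nneg R n] =
     [set X | exists v w : set 'M[R]_(n + n),
        [/\ weyl v, weyl w, bruhat v w & X = @lagr_nneg R n `&` richardson v w]]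
   /\ (forall v w : set 'M[R]_(n + n), weyl v -> weyl w -> bruhat v w ->
         is_component (@lagr_nneg R n `&` richardson v w) (richardson v w))
   /\ closure (@lagr_pos R n) = @lagr_nneg R n) /\
  (homeomorphic (@lagr_nneg R n) (@closed_ball_eucl R (n * n.+1 %/ 2)) /\
   homeomorphic (@lagr_nneg R n `\` @lagr_pos R n)
     (@sphere_eucl R (n * n.+1 %/ 2 - 1))) /\
  (trivIset (@pinC R n) (@lagr_pin_pos R n) /\
   \bigcup_(p in @pinC R n) lagr_pin_pos p `<=` @lagr_pos R n /\
   ((1 < n)%N -> \bigcup_(p in @pinC R n) lagr_pin_pos p <> @lagr_pos R n) /\
   \bigcup_(p in @pinC R n) lagr_pin_nneg p `<=` @lagr_nneg R n /\
   (n = 2%N -> \bigcup_(p in @pinC R n) lagr_pin_nneg p = @lagr_nneg R n) /\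
   ((2 < n)%N -> \bigcup_(p in @pinC R n) lagr_pin_nneg p <> @lagr_nneg R n)) /\
  (@lagr_pos R n = @lagr_plucker_pos R n /\
   @lagr_nneg R n = @lagr_plucker_nneg R n).
Proof.
split; last split; last split.
- split; first exact: LJ0_orbits.
  by split; [exact: richardson_component | exact: closure_lagr_pos].
- by split; [exact: lagr_nneg_ball | exact: lagr_boundary_sphere].
- split; first exact: pins_disjoint.
  split; first exact: pins_pos_sub.
  split; first exact: pins_pos_proper.
  split; first exact: pins_nneg_sub.
  by split; [exact: pins_nneg_rank2 | exact: pins_nneg_proper].
- by split; [exact: lagr_plucker_posE | exact: lagr_plucker_nnegE].
Qed.
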